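(* Let $d>1$, let $H\in C^2(\mathbb{R}^d)$ be uniformly convex, and let $F(p):=\sqrt{D^2H(p)}$. Consider the following two propagation properties for a function $u$ and a constant $C>0$ (all matrix inequalities in the viscosity sense in $\mathbb{R}^d$): $(P_+)$ if $-F(Du(\cdot,0))D^2u(\cdot,0)F(Du(\cdot,0))\ge -C\,I$, then, for all $t>0$, $-F(Du(\cdot,t))D^2u(\cdot,t)F(Du(\cdot,t))\ge -\frac{C}{(1-Ct)_+}I$; $(P_-)$ if $-F(Du(\cdot,0))D^2u(\cdot,0)F(Du(\cdot,0))\le C\,I$, then, for all $t>0$, $-F(Du(\cdot,t))D^2u(\cdot,t)F(Du(\cdot,t))\le \frac{C}{(1-Ct)_+}I$. Then the following hold. (i) If $(P_+)$ holds for every $C>0$ and every viscosity solution $u\in\mathrm{BUC}(\mathbb{R}^d\times[0,\infty))$ of $u_t=H(Du)$ in $\mathbb{R}^d\times(0,\infty)$ with $u(\cdot,0)\in C^{0,1}(\mathbb{R}^d)$, then, for all $p,\xi\in\mathbb{R}^d$ and all $\xi^\perp\in\mathbb{R}^d$ orthogonal to $\xi$, the map $\lambda\mapsto (D^2H(p+\lambda\xi)\xi^\perp,\xi^\perp)$, $\lambda\in\mathbb{R}$, is concave. (ii) If $(P_-)$ holds for every $C>0$ and every viscosity solution $u\in\mathrm{BUC}(\mathbb{R}^d\times[0,\infty))$ of $u_t=-H(Du)$ in $\mathbb{R}^d\times(0,\infty)$ with $u(\cdot,0)\in C^{0,1}(\mathbb{R}^d)$, then, for all $p,\xi\in\mathbb{R}^d$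 and all $\xi^\perp\in\mathbb{R}^d$ orthogonal to $\xi$, the map $\lambda\mapsto (D^2H(p+\lambda\xi)\xi^\perp,\xi^\perp)$, $\lambda\in\mathbb{R}$, is convex. (iii) In particular, both estimates hold without any restriction on the data (that is, $(P_+)$ holds for every $C>0$ and every viscosity solution $u\in\mathrm{BUC}(\mathbb{R}^d\times[0,\infty))$ of $u_t=H(Du)$, and $(P_-)$ holds for every $C>0$ and every viscosity solution $u\in\mathrm{BUC}(\mathbb{R}^d\times[0,\infty))$ of $u_t=-H(Du)$) if and only if $H$ is quadratic.
   Context: $\mathrm{BUC}(X)$ is the set of bounded uniformly continuous real functions on $X$; $C^{0,1}(\mathbb{R}^d)$ is the set of Lipschitz continuous functions on $\mathbb{R}^d$. $I$ is the $d\times d$ identity matrix, and matrix inequalities are in the sense of symmetric matrices; $(\cdot,\cdot)$ is the Euclidean inner product. ''$H\in C^2(\mathbb{R}^d)$ is uniformly convex'' means that there exist $\Theta,\theta>0$ such that $\theta I\le D^2H(p)\le\Theta I$ for all $p\in\mathbb{R}^d$. $F(p)=\sqrt{D^2H(p)}$ is the positive definite symmetric square root. $H$ is called quadratic if there exists a symmetric matrix $A$ with $\theta I\le A\le\Theta I$ for some $\theta,\Theta>0$ such that $H(p)=(Ap,p)$ for all $p$. Solutions of $u_t=\pm H(Du)$ are Crandall-Lions viscosity solutions. For a continuous $v:\mathbb{R}^d\to\mathbb{R}$ and a constant $K$, the inequality $-F(Dv)D^2vF(Dv)\le K I$ (resp. $\ge -KI$) holds in the viscosity sense if, for every smooth $\phi$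 and every maximum (resp. minimum) point $x_0$ of $v-\phi$, $-F(D\phi(x_0))D^2\phi(x_0)F(D\phi(x_0))\le K I$ (resp. $\ge -KI$). $s_+=\max(s,0)$, and when $(1-Ct)_+=0$ the quotient $\frac{C}{(1-Ct)_+}$ is $+\infty$, so the inequality is void.
   Formalization: Solutions are taken bounded and uniformly continuous on R^d×[0,T] for every T rather than on R^d×[0,∞) (no such solution exists if H(0)≠0), and in (iii) ''H is quadratic'' is replaced by ''H minus its tangent affine map at 0 is quadratic'', as the literal claims fail for H with an affine part. *)

(* Defs.v *)
From HB Require Import structures.
From mathcomp Require Import all_boot all_order all_algebra.
From mathcomp Require Import all_classical all_reals all_analysis.

Set Implicit Arguments.
Unset Strict Implicit.
Unset Printing Implicit Defensive.

Import Order.TTheory GRing.Theory Num.Theory.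
Import numFieldNormedType.Exports.

Local Open Scope classical_set_scope.
Local Open Scope ring_scope.

(* Vectors of R^d are row vectors; a symmetric matrix A acts by x *m A.       *)
(* The topologies of 'rV[R]_d and 'rV[R]_d * R come from sup norms, so the    *)
(* notions below that only depend on the norm up to equivalence (continuity,  *)
(* uniform continuity, Lipschitz continuity) are the Euclidean ones.          *)

Definition dot (R : realType) (d : nat) (x y : 'rV[R]_d) : R :=
  (x *m y^T) 0 0.

Definition mxle (R : realType) (d : nat) (A B : 'M[R]_d) : Prop :=
  forall x : 'rV[R]_d, dot (x *m A) x <= dot (x *m B) x.

Definition posdef (R : realType) (d : nat) (A : 'M[R]_d) : Prop :=
  forall x : 'rV[R]_d, x != 0 -> 0 < dot (x *m A) x.

(* The positive definite symmetric square root of A (junk value 0 if there is *)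
(* none; it exists and is unique when A is symmetric positive definite).      *)
Definition sqrtmx (R : realType) (d : nat) (A : 'M[R]_d) : 'M[R]_d :=
  xget 0 [set B | [/\ B^T = B, posdef B & B *m B = A]].

Definition basis_vec (R : realType) (d : nat) (i : 'I_d) : 'rV[R]_d :=
  delta_mx 0 i.

Definition grad (R : realType) (d : nat) (f : 'rV[R]_d -> R) (p : 'rV[R]_d) :
    'rV[R]_d :=
  \row_i 'D_(basis_vec R i) f p.

Definition hess (R : realType) (d : nat) (f : 'rV[R]_d -> R) (p : 'rV[R]_d) :
    'M[R]_d :=
  \matrix_(i, j) 'D_(basis_vec R i) (fun q => 'D_(basis_vec R j) f q) p.

(* All iterated directional derivatives up to order k exist and are           *)
(* continuous. For finite-dimensional V (the only use here) this is C^k(V).   *)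
Fixpoint Ck (R : realType) (V : normedModType R) (k : nat) (f : V -> R) :
    Prop :=
  continuous f /\
  if k is k'.+1 then
    forall v : V,
      (forall x, derivable f x v) /\ Ck k' (fun x => 'D_v f x)
  else True.

Definition smooth (R : realType) (V : normedModType R) (f : V -> R) : Prop :=
  forall k, Ck k f.

Definition uniformly_convex (R : realType) (d : nat) (H : 'rV[R]_d -> R) :
    Prop :=
  exists theta Theta : R, [/\ 0 < theta, 0 < Theta &
    forall p, mxle theta%:M (hess H p) /\ mxle (hess H p) Theta%:M].

Definition quadratic (R : realType) (d : nat) (H : 'rV[R]_d -> R) : Prop :=
  exists A : 'M[R]_d,
    [/\ A^T = A,
        exists theta Theta : R, [/\ 0 < theta, 0 < Theta,
          mxle theta%:M A & mxle A Theta%:M]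
      & forall p, H p = dot (p *m A) p].

(* H minus its affine tangent map at the origin. An affine part (b, p) + c of  *)
(* H only moves solutions of u_t = H(Du) to u(x + b t, t) + c t and leaves     *)
(* D^2H unchanged, so Hessian bounds on solutions determine H only up to it.   *)
Definition remove_affine (R : realType) (d : nat) (H : 'rV[R]_d -> R)
    (p : 'rV[R]_d) : R :=
  H p - H 0 - dot (grad H 0) p.

Lemma remove_affine_id (R : realType) (d : nat) (H : 'rV[R]_d -> R) :
  H 0 = 0 -> grad H 0 = 0 -> remove_affine H = H.
Proof.
move=> H0 DH0; apply/funext => p.
by rewrite /remove_affine H0 DH0 /dot mul0mx mxE !subr0.
Qed.

Lemma quadratic_remove_affine (R : realType) (d : nat) (H : 'rV[R]_d -> R) :
  quadratic H -> quadratic (remove_affine H).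
Proof.
move=> qH; suff -> : remove_affine H = H by [].
have [A [_ _ HE]] := qH.
have H0 : H 0 = 0 by rewrite HE /dot !mul0mx mxE.
apply: remove_affine_id => //; apply/rowP => i; rewrite !mxE.
set v := basis_vec R i; rewrite /derive.
apply: cvg_lim => //.
have -> : (fun h : R => h^-1 *: ((H \o shift 0) (h *: v) - H 0)) =
          (fun h : R => h * H v).
  apply/funext => h /=; rewrite H0 subr0 addr0 !HE /dot.
  rewrite -scalemxAl linearZ /= -scalemxAr -scalemxAl !mxE.
  have [->|h0] := eqVneq h 0; first by rewrite !mul0r scaler0.
  by rewrite /GRing.scale /= mulKf.
have : (fun h : R => h * H v) @ nbhs (0 : R) --> (0 : R) * H v.
  by apply: cvgM; [exact: cvg_id | exact: cvg_cst].
by rewrite mul0r => Hv; exact: cvg_within_filter Hv.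
Qed.

Definition buc (R : realType) (V : normedModType R) (X : set V) (f : V -> R) :
    Prop :=
  (exists M : R, forall x, X x -> `|f x| <= M) /\
  (forall e : R, 0 < e -> exists2 r : R, 0 < r &
     forall x y, X x -> X y -> `|x - y| < r -> `|f x - f y| < e).

(* The class BUC(R^d x [0, oo)) of functions that are bounded and uniformly   *)
(* continuous on R^d x [0, T] for every T. Boundedness cannot be uniform in   *)
(* time for general H: if H(0) <> 0, every solution of u_t = H(Du) that is    *)
(* bounded at time 0 drifts like t * H(0). If H(0) = 0, the solutions in this *)
(* class are bounded and uniformly continuous on all of R^d x [0, oo).        *)
(* Values at negative times are never used.                                   *)
Definition buc_spacetime (R : realType) (d : nat) (u : 'rV[R]_d * R -> R) :
    Prop :=
  forall T : R, 0 < T -> buc [set z : 'rV[R]_d * R | 0 <= z.2 <= T] u.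

Definition slice (R : realType) (d : nat) (u : 'rV[R]_d * R -> R) (t : R) :
    'rV[R]_d -> R :=
  fun x => u (x, t).

Definition dt (R : realType) (d : nat) (phi : 'rV[R]_d * R -> R)
    (z : 'rV[R]_d * R) : R :=
  derive1 (fun s : R => phi (z.1, s)) z.2.

(* Crandall-Lions viscosity solution of u_t = G(Du) in R^d x (0, oo).         *)
(* Extrema are local, so test functions may be taken C^1 on the whole space.  *)
Definition viscosity_solution (R : realType) (d : nat) (G : 'rV[R]_d -> R)
    (u : 'rV[R]_d * R -> R) : Prop :=
  forall phi : 'rV[R]_d * R -> R, Ck 1 phi ->
  forall z0 : 'rV[R]_d * R, 0 < z0.2 ->
    ((\forall z \near z0, u z - phi z <= u z0 - phi z0) ->
       dt phi z0 <= G (grad (slice phi z0.2) z0.1)) /\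
    ((\forall z \near z0, u z0 - phi z0 <= u z - phi z) ->
       G (grad (slice phi z0.2) z0.1) <= dt phi z0).

(* - F(Dphi(x)) D^2phi(x) F(Dphi(x)) with F = sqrt (D^2 H). *)
Definition FD2F (R : realType) (d : nat) (H phi : 'rV[R]_d -> R)
    (x : 'rV[R]_d) : 'M[R]_d :=
  let F := sqrtmx (hess H (grad phi x)) in - (F *m hess phi x *m F).

Definition visc_FD2F_le (R : realType) (d : nat) (H v : 'rV[R]_d -> R)
    (K : R) : Prop :=
  forall phi : 'rV[R]_d -> R, smooth phi ->
  forall x0, (forall x, v x - phi x <= v x0 - phi x0) ->
    mxle (FD2F H phi x0) K%:M.

Definition visc_FD2F_ge (R : realType) (d : nat) (H v : 'rV[R]_d -> R)
    (K : R) : Prop :=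
  forall phi : 'rV[R]_d -> R, smooth phi ->
  forall x0, (forall x, v x0 - phi x0 <= v x - phi x) ->
    mxle K%:M (FD2F H phi x0).

(* In both properties the bound is void when (1 - C t)_+ = 0. *)
Definition propagates_ge (R : realType) (d : nat) (H : 'rV[R]_d -> R)
    (u : 'rV[R]_d * R -> R) (C : R) : Prop :=
  visc_FD2F_ge H (slice u 0) (- C) ->
  forall t : R, 0 < t -> 0 < Num.max (1 - C * t) 0 ->
    visc_FD2F_ge H (slice u t) (- (C / Num.max (1 - C * t) 0)).

Definition propagates_le (R : realType) (d : nat) (H : 'rV[R]_d -> R)
    (u : 'rV[R]_d * R -> R) (C : R) : Prop :=
  visc_FD2F_le H (slice u 0) C ->
  forall t : R, 0 < t -> 0 < Num.max (1 - C * t) 0 ->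
    visc_FD2F_le H (slice u t) (C / Num.max (1 - C * t) 0).

Definition concave_on_line (R : realType) (h : R -> R) : Prop :=
  convex_function [set: R^o] (fun l : R^o => - h l).

Definition convex_on_line (R : realType) (h : R -> R) : Prop :=
  convex_function [set: R^o] (h : R^o -> R^o).

(* Main.v *)
From HB Require Import structures.
Require Import Defs.
From mathcomp Require Import all_boot all_order all_algebra.
From mathcomp Require Import all_classical all_reals all_analysis.
From mathcomp Require Import complex.
From mathcomp Require Import ring lra.
Import Order.TTheory GRing.Theory Num.Theory.
Import numFieldNormedType.Exports.
Local Open Scope classical_set_scope.
Local Open Scope ring_scope.
Set Implicit Arguments.
Unset Strict Implicit.
Unset Printing Implicit Defensive.

(** Write [N(p)] for the inverse of [D^2H(p)]; it is the Hessian at [DH(p)] of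
    the convex conjugate [L] of [H]. Conjugation by the square root [F] turns
    the inequality [- F D^2u F >= - C I] into [D^2u <= C N(Du)]
    ([mxle_FD2F]), so that the property [(P_+)] concerns semiconcavity measured
    by [N].

    Necessity. If [(P_+)] holds for Lipschitz data, then [D^2H] is constant.
    The profile [L(. + DH(p)) - L(DH(p))] satisfies the bound with constant 1,
    with equality, and so does the minimum of two such profiles of slopes [p0]
    and [p0 + xi], a concave corner, capped to be bounded and Lipschitz. The
    Hopf-Lax formula solves [u_t = H(Du)] from these data. The corner opens into
    a rarefaction in which every slope [pl = p0 + l xi] appears, and there the
    solution is bounded below to second order by paths starting close to the
    corner. For [h] orthogonal to [xi], the propagated bound at slope [pl] gives
    that [l |-> (N(p0 + l xi) h, h)] is concave ([corner_inequality]). Since [N]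
    is bounded, this function is constant on whole lines ([nform_orthogonal]).
    In dimension at least two this leaves no freedom. In the plane of two
    orthogonal vectors [e], [f] of equal length, the forms at [e], [f], [e + f]
    and [e - f] each depend on a single coordinate, and the parallelogram law
    among them forces second differences to be constant, hence zero by
    boundedness ([nform_diagonal], [hess_const]). In particular the maps in (i)
    are constant, so concave.

    Reflection. The function [- u] solves [w_t = H(- Dw)] when [u] solves
    [u_t = - H(Du)], and this exchanges the two matrix inequalities
    ([propagates_reflection]). Thus [(P_-)] for [H] is [(P_+)] for the reflected
    Hamiltonian, which gives (ii) and half of (iii).

    Sufficiency. Let [D^2H] be constant. At a point of the solution at time [t],
    the best path of the Hopf-Lax formula starts from a point where the data are
    touched from above by a paraboloid. The bound on the data, which holds in
    the viscosity sense only, makes this paraboloid one with Hessian [C N] that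
    stays above the data globally ([semiconcave_at]). With constant [D^2H] the
    equation carries it to the explicit solution with Hessian
    [C N / (1 - C t)]. Two comparison arguments with explicit test functions,
    valid for any solution that is bounded and uniformly continuous on strips,
    show that this paraboloid stays above the solution ([subsolution_le]) and
    touches it ([supersolution_ge]). *)

(** * Inner product and quadratic forms *)

Section Dot.
Context {R : realType} {d : nat}.
Implicit Types (x y z : 'rV[R]_d) (A : 'M[R]_d) (a : R).

Lemma dotE x y : dot x y = \sum_i x 0 i * y 0 i.
Proof. by rewrite /dot mxE; apply: eq_bigr => i _; rewrite mxE. Qed.

Lemma dotC x y : dot x y = dot y x.
Proof. by rewrite !dotE; apply: eq_bigr => i _; rewrite mulrC. Qed.

Lemma dotDl x y z : dot (x + y) z = dot x z + dot y z.
Proof. by rewrite /dot mulmxDl mxE. Qed.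

Lemma dotDr x y z : dot x (y + z) = dot x y + dot x z.
Proof. by rewrite dotC dotDl !(dotC _ x). Qed.

Lemma dotZl a x y : dot (a *: x) y = a * dot x y.
Proof. by rewrite /dot -scalemxAl mxE. Qed.

Lemma dotZr a x y : dot x (a *: y) = a * dot x y.
Proof. by rewrite dotC dotZl dotC. Qed.

Lemma dotNl x y : dot (- x) y = - dot x y.
Proof. by rewrite -scaleN1r dotZl mulN1r. Qed.

Lemma dotNr x y : dot x (- y) = - dot x y.
Proof. by rewrite dotC dotNl dotC. Qed.

Lemma dot0l x : dot 0 x = 0.
Proof. by rewrite /dot mul0mx mxE. Qed.

Lemma dot0r x : dot x 0 = 0.
Proof. by rewrite dotC dot0l. Qed.

Lemma dotBl x y z : dot (x - y) z = dot x z - dot y z.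
Proof. by rewrite dotDl dotNl. Qed.

Lemma dotBr x y z : dot x (y - z) = dot x y - dot x z.
Proof. by rewrite dotDr dotNr. Qed.

Lemma dot_mulmx x y A : dot (x *m A) y = dot x (y *m A^T).
Proof. by rewrite /dot trmx_mul trmxK mulmxA. Qed.

Lemma dot_sym x y A : A^T = A -> dot (x *m A) y = dot (y *m A) x.
Proof. by move=> sA; rewrite dot_mulmx sA dotC. Qed.

Lemma dot_ge0 x : 0 <= dot x x.
Proof. by rewrite dotE; apply: sumr_ge0 => i _; rewrite -expr2 sqr_ge0. Qed.

Lemma dot_eq0 x : (dot x x == 0) = (x == 0).
Proof.
apply/eqP/eqP => [|->]; last by rewrite dot0l.
rewrite dotE => /eqP; rewrite psumr_eq0 => [/allP h|i _]; last first.
  by rewrite -expr2 sqr_ge0.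
apply/rowP => i; have := h i (mem_index_enum i).
by rewrite /= mulf_eq0 orbb mxE => /eqP.
Qed.

Lemma dot_gt0 x : (0 < dot x x) = (x != 0).
Proof. by rewrite lt_neqAle dot_ge0 andbT eq_sym dot_eq0. Qed.

Lemma dot_scalar x a : dot (x *m a%:M) x = a * dot x x.
Proof. by rewrite mul_mx_scalar dotZl. Qed.

Lemma young s x y : 0 < s -> dot x y <= s / 2 * dot x x + dot y y / (2 * s).
Proof.
move=> s0; have := dot_ge0 (s *: x - y).
rewrite dotBl !dotBr !dotZl !dotZr (dotC y x) => h.
rewrite -(ler_pM2l s0).
have -> : s * (s / 2 * dot x x + dot y y / (2 * s)) =
  (s * s * dot x x + dot y y) / 2 by field; rewrite gt_eqF.
lra.
Qed.

Lemma sqr_dot_le x y : dot x y ^+ 2 <= dot x x * dot y y.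
Proof.
have [->|x0] := eqVneq x 0; first by rewrite !dot0l expr0n mul0r.
have xp : 0 < dot x x by rewrite dot_gt0.
have := dot_ge0 (dot x y *: x - dot x x *: y).
rewrite dotBl !dotBr !dotZl !dotZr (dotC y x) => h.
rewrite -(ler_pM2l xp); lra.
Qed.

Lemma coord_le_norm x i : `|x 0 i| <= `|x|.
Proof.
rewrite [leRHS]/Num.norm /= mx_normrE.
by apply/bigmax_geP; right => /=; exists (0, i).
Qed.

Lemma norm_le_coord x c : 0 <= c -> (forall i, `|x 0 i| <= c) -> `|x| <= c.
Proof.
move=> c0 h; rewrite [leLHS]/Num.norm /= mx_normrE.
by apply/bigmax_leP; split => // -[i j] _ /=; rewrite (ord1 i).
Qed.

Lemma norm_sqr_le_dot x : `|x| ^+ 2 <= dot x x.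
Proof.
have h i : x 0 i ^+ 2 <= dot x x.
  rewrite dotE (bigD1 i) //= -expr2 lerDl; apply: sumr_ge0 => j _.
  by rewrite -expr2 sqr_ge0.
rewrite -[leRHS]sqr_sqrtr ?dot_ge0 // ler_sqr ?nnegrE ?sqrtr_ge0 //.
apply: norm_le_coord => [|i]; first by rewrite sqrtr_ge0.
by rewrite -sqrtr_sqr ler_wsqrtr.
Qed.

Lemma dot_le_norm x y : `|dot x y| <= d%:R * (`|x| * `|y|).
Proof.
rewrite dotE; apply: (le_trans (ler_norm_sum _ _ _)).
apply: (@le_trans _ _ (\sum_(i < d) `|x| * `|y|)).
  apply: ler_sum => i _; rewrite normrM.
  by apply: ler_pM => //; exact: coord_le_norm.
by rewrite sumr_const card_ord [leRHS]mulrC mulr_natr.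
Qed.

Lemma dot_le_sqr_norm x : dot x x <= d%:R * `|x| ^+ 2.
Proof. by rewrite expr2; apply: (le_trans (ler_norm _)); exact: dot_le_norm. Qed.

Lemma norm_lt_dot x r : 0 < r -> dot x x < r ^+ 2 -> `|x| < r.
Proof.
move=> r0 h; rewrite -(@ltr_pXn2r _ 2) ?nnegrE ?normr_ge0 ?(ltW r0) //.
by apply: le_lt_trans h; exact: norm_sqr_le_dot.
Qed.

(** The entries of [A] being small makes the form small: this is how continuity
    of the second derivatives becomes uniform over directions. *)
Lemma form_le_entries x A e : 0 <= e -> (forall i j, `|A i j| <= e) ->
  `|dot (x *m A) x| <= (d%:R ^+ 2) * e * dot x x.
Proof.
move=> e0 hA.
have h1 : `|x *m A| <= d%:R * (`|x| * e).
  apply: norm_le_coord => [|j]; first by rewrite !mulr_ge0.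
  rewrite mxE; apply: (le_trans (ler_norm_sum _ _ _)).
  apply: (@le_trans _ _ (\sum_(i < d) `|x| * e)).
    apply: ler_sum => i _; rewrite normrM.
    by apply: ler_pM => //; exact: coord_le_norm.
  by rewrite sumr_const card_ord [leRHS]mulrC mulr_natr.
apply: (le_trans (dot_le_norm _ _)).
apply: (@le_trans _ _ (d%:R * (d%:R * (`|x| * e) * `|x|))).
  by rewrite ler_wpM2l // ler_wpM2r.
have -> : d%:R * (d%:R * (`|x| * e) * `|x|) = d%:R ^+ 2 * e * `|x| ^+ 2 by ring.
by rewrite ler_wpM2l ?norm_sqr_le_dot // mulr_ge0.
Qed.

Lemma dot_basis x i : dot x (basis_vec R i) = x 0 i.
Proof.
rewrite dotE (bigD1 i) //= big1 => [|j ji]; last first.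
  by rewrite !mxE eqxx /= (negbTE ji) mulr0.
by rewrite mxE !eqxx mulr1 addr0.
Qed.

Lemma row_basis x : x = \sum_i x 0 i *: basis_vec R i.
Proof. exact: row_sum_delta. Qed.

Lemma dot_inj x y : (forall z, dot x z = dot y z) -> x = y.
Proof. by move=> h; apply/rowP => i; rewrite -!dot_basis h. Qed.

Lemma form_entry A i j :
  dot (basis_vec R i *m A) (basis_vec R j) = A i j.
Proof. by rewrite dot_basis -rowE mxE. Qed.

End Dot.

(** * C^k functions and Taylor expansions *)

Section Calculus.
Context {R : realType} {V : normedModType R}.
Implicit Types (f g : V -> R) (x v w : V) (a h e : R).

Lemma cont_at_eps f x : {for x, continuous f} <->
  forall e, 0 < e -> exists2 r : R, 0 < r &
    forall w, `|w| < r -> `|f (x + w) - f x| < e.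
Proof.
split.
  move=> /cvgrPdist_lt cf e e0; have /nbhs_ballP[r r0 hr] := cf _ e0.
  exists r => // w wr; rewrite distrC; apply: hr.
  by rewrite -ball_normE /= opprD addNKr normrN.
move=> h; apply/cvgrPdist_lt => e e0; have [r r0 hr] := h _ e0.
apply/nbhs_ballP; exists r => // y; rewrite -ball_normE /= => yr.
by rewrite distrC -(subrKC x y); apply: hr; rewrite distrC.
Qed.

Lemma is_derive_epsP f x v a : is_derive x v f a <->
  forall e, 0 < e -> exists2 r : R, 0 < r &
    forall h, `|h| < r -> `|f (x + h *: v) - f x - h * a| <= e * `|h|.
Proof.
have Q h : h != 0 ->
    `|a - h^-1 *: (f (h *: v + x) - f x)| * `|h| = `|f (x + h *: v) - f x - h * a|.
  move=> h0; rewrite -normrM distrC; congr (`| _ |).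
  by rewrite [h *: v + x]addrC /GRing.scale /=; field.
split=> [[fd fa] e e0|H].
  have : (fun h => h^-1 *: ((f \o shift x) (h *: v) - f x)) @ 0^' --> a.
    by rewrite -fa; exact: fd.
  move=> /cvgrPdist_lt /(_ e e0) /nbhs_ballP[r r0 hr].
  exists r => // h hr'; have [->|h0] := eqVneq h 0.
    by rewrite scale0r addr0 subrr mul0r subr0 normr0 mulr0.
  rewrite -Q // ler_wpM2r // ltW //; apply: (hr h) => //.
  by rewrite -ball_normE /= sub0r normrN.
have : (fun h => h^-1 *: ((f \o shift x) (h *: v) - f x)) @ 0^' --> a.
  apply/cvgrPdist_le => e e0; have [r r0 hr] := H _ e0.
  apply/nbhs_ballP; exists r => // h; rewrite -ball_normE /= sub0r normrN => hr' h0.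
  by rewrite -(@ler_pM2r _ `|h|) ?normr_gt0 // Q //; apply: hr.
move=> c; split; last exact: cvg_lim c.
by apply/cvg_ex; exists a.
Qed.

Lemma is_derive_line f x v (s a : R) : is_derive (x + s *: v) v f a ->
  is_derive s (1 : R) (fun t : R => f (x + t *: v)) a.
Proof.
have E : (fun h : R => h^-1 *: (((fun t : R => f (x + t *: v)) \o shift s) (h *: 1)
     - f (x + s *: v))) =
   (fun h => h^-1 *: ((f \o shift (x + s *: v)) (h *: v) - f (x + s *: v))).
  apply/funext => h /=; congr (_ *: (f _ - _)).
  by rewrite [h *: 1]mulr1 scalerDl addrCA.
by move=> [fd fa]; split; rewrite ?/derivable ?/derive E.
Qed.

Lemma mvt_line f x v : (forall y, derivable f y v) ->
  exists2 c : R, 0 < c < 1 & f (x + v) - f x = 'D_v f (x + c *: v).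
Proof.
move=> fd; pose g t : R := f (x + t *: v).
have gd (t : R) : is_derive t (1 : R) g ('D_v f (x + t *: v)).
  by apply: is_derive_line; exact/derivableP.
have cg : {within `[0, 1], continuous g}.
  apply: continuous_subspaceT => t.
  by apply: differentiable_continuous; apply/derivable1_diffP; case: (gd t).
have [c] := MVT ltr01 (fun t _ => gd t) cg.
rewrite in_itv /= => c01; rewrite subr0 mulr1 /g scale1r scale0r addr0 => E.
by exists c.
Qed.

Lemma Ck_cont k f : Ck k f -> continuous f.
Proof. by case: k => [|k] []. Qed.

Lemma CkW k f : Ck k.+1 f -> Ck k f.
Proof.
elim: k f => [|k IH] f [cf H]; first by split.
split=> // v; have [fd Df] := H v; split=> //; exact: IH.
Qed.

Lemma Ck_le k m f : (m <= k)%N -> Ck k f -> Ck m f.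
Proof.
elim: k => [|k IH]; first by rewrite leqn0 => /eqP->.
by rewrite leq_eqVlt => /orP[/eqP->//|]; rewrite ltnS => mk /CkW; exact: IH.
Qed.

Lemma Ck_derivable k f x v : Ck k.+1 f -> derivable f x v.
Proof. by move=> [_ /(_ v)[]]. Qed.
Arguments Ck_derivable {k f} x v _.

Lemma Ck_D k f v : Ck k.+1 f -> Ck k (fun x => 'D_v f x).
Proof. by move=> [_ /(_ v)[]]. Qed.

Lemma Ck_cst k (a : R) : Ck k (fun _ : V => a).
Proof.
elim: k a => [|k IH] a; split=> //; try exact: cst_continuous.
move=> v; split=> [x|]; first exact: derivable_cst.
have -> : (fun x => 'D_v (fun _ : V => a) x) = (fun _ => 0).
  by apply/funext => x; rewrite derive_cst.
exact: IH.
Qed.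

Lemma Ck_add k f g : Ck k f -> Ck k g -> Ck k (fun x => f x + g x).
Proof.
elim: k f g => [|k IH] f g [cf Hf] [cg Hg]; split=> //.
- by move=> x; apply: cvgD; [exact: cf|exact: cg].
- by move=> x; apply: cvgD; [exact: cf|exact: cg].
move=> v; have [fd Df] := Hf v; have [gd Dg] := Hg v; split.
  by move=> x; apply: derivableD.
have -> : (fun x => 'D_v (fun x => f x + g x) x) = (fun x => 'D_v f x + 'D_v g x).
  by apply/funext => x; rewrite -deriveD.
exact: IH.
Qed.

Lemma Ck_mul k f g : Ck k f -> Ck k g -> Ck k (fun x => f x * g x).
Proof.
elim: k f g => [|k IH] f g Cf Cg.
  by case: Cf Cg => cf _ [cg _]; split=> // x; apply: cvgM; [exact: cf|exact: cg].
split=> [x|v]; first by apply: cvgM; [exact: (Ck_cont Cf)|exact: (Ck_cont Cg)].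
split=> [x|]; first by apply: derivableM; apply: Ck_derivable; eassumption.
have -> : (fun x => 'D_v (fun x => f x * g x) x) =
    (fun x => f x * 'D_v g x + g x * 'D_v f x).
  apply/funext => x; rewrite -[fun x => f x * g x]/(f * g) deriveM //;
  apply: Ck_derivable; eassumption.
by apply: Ck_add; apply: IH; (exact: CkW) || exact: Ck_D.
Qed.

Lemma Ck_opp k f : Ck k f -> Ck k (fun x => - f x).
Proof.
move=> Cf; have -> : (fun x => - f x) = (fun x => (fun=> -1) x * f x).
  by apply/funext => x; rewrite mulN1r.
by apply: Ck_mul => //; exact: Ck_cst.
Qed.

Lemma Ck_sub k f g : Ck k f -> Ck k g -> Ck k (fun x => f x - g x).
Proof. by move=> Cf Cg; apply: Ck_add => //; exact: Ck_opp. Qed.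

Lemma Ck_exp k f n : Ck k f -> Ck k (fun x => f x ^+ n).
Proof.
move=> Cf; elim: n => [|n IH]; first exact: Ck_cst.
under eq_fun do rewrite exprS.
exact: Ck_mul.
Qed.

Lemma Ck_sum k n (F : 'I_n -> V -> R) :
  (forall i, Ck k (F i)) -> Ck k (fun x => \sum_i F i x).
Proof.
elim: n F => [|n IH] F CF.
  by under eq_fun do rewrite big_ord0; exact: Ck_cst.
by under eq_fun do rewrite big_ord_recl; apply: Ck_add => //; exact: IH.
Qed.

Lemma Ck_affine k f (f' : V -> R) (K : R) : (forall v, `|f' v| <= K * `|v|) ->
  (forall x h v, f (x + h *: v) = f x + h * f' v) -> Ck k f.
Proof.
move=> f'K fE; have cf : continuous f.
  move=> x; apply/cont_at_eps => e e0; have K1 : 0 < `|K| + 1 by rewrite ltr_wpDl.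
  exists (e / (`|K| + 1)) => [|w]; first by rewrite divr_gt0.
  rewrite ltr_pdivlMr // => we; rewrite -[w]scale1r fE mul1r addrAC subrr add0r.
  apply: le_lt_trans we; apply: (le_trans (f'K w)).
  rewrite mulrC ler_wpM2l //; apply: (le_trans (ler_norm K)); by rewrite lerDl.
case: k => [|k]; split=> // v.
have D x : is_derive x v f (f' v).
  apply/is_derive_epsP => e e0; exists 1 => // h _.
  have -> : f (x + h *: v) - f x - h * f' v = 0 by rewrite fE; ring.
  by rewrite normr0 mulr_ge0 // ltW.
split=> [x|]; first by case: (D x).
have -> : (fun x => 'D_v f x) = (fun=> f' v).
  by apply/funext => x; case: (D x).
exact: Ck_cst.
Qed.

Lemma deriveZ_dir f x v a : derivable f x v -> 'D_(a *: v) f x = a * 'D_v f x.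
Proof.
have [->|a0] := eqVneq a 0; first by rewrite scale0r derive0 mul0r.
move=> /derivableP /is_derive_epsP D1.
suff: is_derive x (a *: v) f (a * 'D_v f x) by case.
apply/is_derive_epsP => e e0; have na0 : 0 < `|a| by rewrite normr_gt0.
have [r r0 Hr] := D1 _ (divr_gt0 e0 na0).
exists (r / `|a|) => [|h]; first by rewrite divr_gt0.
rewrite ltr_pdivlMr // -normrM => /Hr.
rewrite scalerA mulrA => /le_trans; apply.
by rewrite normrM mulrCA divfK ?gt_eqF // mulrC.
Qed.

(** The directional derivative of a C^1 function is linear in the direction:
    moving along [v] and then along [w] only costs continuity of ['D_w f]. *)
Lemma derive_lin f x v w a : Ck 1 f ->
  'D_(a *: v + w) f x = a * 'D_v f x + 'D_w f x.
Proof.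
move=> Cf; suff: is_derive x (a *: v + w) f (a * 'D_v f x + 'D_w f x) by case.
apply/is_derive_epsP => e e0.
have e2 : 0 < e / 2 by rewrite divr_gt0.
have /cont_at_eps /(_ _ e2)[r1 r10 H1] :
  {for x, continuous (fun y => 'D_w f y)} by apply: (Ck_cont (Ck_D w Cf)).
have a1 : 0 < `|a| + 1 by rewrite ltr_wpDl.
have /is_derive_epsP /(_ _ (divr_gt0 e2 a1))[r2 r20 H2] :
  is_derive x v f ('D_v f x) by apply: derivableP; exact: Ck_derivable Cf.
pose B : R := `|a| * `|v| + `|w| + 1.
have B0 : 0 < B by rewrite ltr_wpDl // addr_ge0 // mulr_ge0.
exists (Num.min (r1 / B) (r2 / (`|a| + 1))).
  by rewrite lt_min !divr_gt0.
move=> h; rewrite lt_min !ltr_pdivlMr // => /andP[h1 h2].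
have [c /andP[c0 c1] E] : exists2 c : R, 0 < c < 1 &
    f (x + (h * a) *: v + h *: w) - f (x + (h * a) *: v) =
    h * 'D_w f (x + (h * a) *: v + (c * h) *: w).
  have [->|h0] := eqVneq h 0.
    by exists (1/2); rewrite ?mul0r ?scale0r ?addr0 ?subrr ?mul0r //; lra.
  have [c c01 E] := @mvt_line f (x + (h * a) *: v) (h *: w)
     (fun y => Ck_derivable y (h *: w) Cf).
  exists c => //; rewrite E scalerA.
  by rewrite deriveZ_dir //; exact: Ck_derivable Cf.
have -> : f (x + h *: (a *: v + w)) - f x - h * (a * 'D_v f x + 'D_w f x) =
  (f (x + (h * a) *: v) - f x - (h * a) * 'D_v f x)
  + h * ('D_w f (x + (h * a) *: v + (c * h) *: w) - 'D_w f x).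
  by rewrite mulrBr -E scalerDr scalerA addrA; ring.
apply: (le_trans (ler_normD _ _)).
have -> : e * `|h| = e / 2 * `|h| + `|h| * (e / 2) by field.
apply: lerD.
  have hab : `|h * a| <= `|h| * (`|a| + 1).
    by rewrite normrM ler_wpM2l // lerDl.
  apply: (le_trans (H2 _ (le_lt_trans hab h2))).
  by rewrite mulrAC ler_pdivrMr // -[leRHS]mulrA ler_wpM2l // ltW.
rewrite normrM ler_wpM2l // ltW // -addrA; apply: H1.
apply: le_lt_trans h1; apply: (le_trans (ler_normD _ _)).
rewrite !normrZ /B (gtr0_norm c0).
have : c * (`|h| * `|w|) <= `|h| * `|w| by rewrite ler_piMl ?mulr_ge0 // ltW.
have := normr_ge0 h; lra.
Qed.

(** Rolle's theorem, used twice on the restriction of [f] to the segment minus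
    the parabola with the same endpoint values and initial slope. *)
Lemma taylor2 f x v : Ck 2 f -> exists2 c : R, 0 < c < 1 &
  f (x + v) = f x + 'D_v f x + 'D_v (fun y => 'D_v f y) (x + c *: v) / 2.
Proof.
move=> Cf; pose D := fun y => 'D_v f y; pose g (t : R) := f (x + t *: v).
pose g1 (t : R) := D (x + t *: v).
have gd (t : R) : is_derive t (1 : R) g (g1 t).
  by apply: is_derive_line; exact/derivableP/(Ck_derivable _ _ Cf).
have g1d (t : R) : is_derive t (1 : R) g1 ('D_v D (x + t *: v)).
  by apply: is_derive_line; apply/derivableP/(Ck_derivable _ _ (Ck_D v Cf)).
pose K : R := (f (x + v) - f x - D x) * 2.
pose k := (fun t : R => g t - (K / 2 * t + D x) * t).
have kd (t : R) : is_derive t (1 : R) k (g1 t - (K * t + D x)).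
  apply: is_derive_eq.
  by rewrite /GRing.scale /=; field.
pose k1 := (fun t : R => g1 t - (K * t + D x)).
have k1d (t : R) : is_derive t (1 : R) k1 ('D_v D (x + t *: v) - K).
  apply: is_derive_eq.
  by rewrite /GRing.scale /=; field.
have cts (F dF : R -> R) (a b : R) : (forall t : R, is_derive t (1 : R) F (dF t)) ->
   {within `[a, b], continuous F}.
  move=> Fd; apply: continuous_subspaceT => s.
  by apply: differentiable_continuous; apply/derivable1_diffP; case: (Fd s).
have k01 : k 0 = k 1.
  by rewrite /k /g scale0r scale1r addr0 mulr0 /K; field.
have [c1] := Rolle ltr01 (fun t _ => @ex_derive _ _ _ _ _ _ _ (kd t)) (cts _ _ _ _ kd) k01.
rewrite in_itv /= => /andP[c10 c11] [_ E1].
have {}E1 : k1 c1 = 0 by case: (kd c1) => _ E0; rewrite /k1 -E0.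
have k1E : k1 0 = k1 c1.
  by rewrite E1 /k1 /g1 scale0r addr0 mulr0 add0r subrr.
have [c] := Rolle c10 (fun t _ => @ex_derive _ _ _ _ _ _ _ (k1d t)) (cts _ _ _ _ k1d) k1E.
rewrite in_itv /= => /andP[c0 cc] [_ E].
have {}E : 'D_v D (x + c *: v) = K.
  by case: (k1d c) => _ E0; apply/eqP; rewrite -subr_eq0 -E0 E.
exists c; first by rewrite c0 (lt_trans cc).
by rewrite -/D E /K -/(D x); field.
Qed.

(** A second order upper expansion along one line pins down the first
    derivative and bounds the second one; touching arguments all end here. *)
Lemma derive2_upper f x v (a b : R) : Ck 2 f ->
  (forall e, 0 < e -> exists2 r : R, 0 < r & forall h, `|h| < r ->
     f (x + h *: v) <= f x + h * a + h ^+ 2 / 2 * b + e * h ^+ 2) ->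
  'D_v f x = a /\ 'D_v (fun y => 'D_v f y) x <= b.
Proof.
move=> Cf H; pose D2 (y : V) : R := 'D_v (fun z => 'D_v f z) y.
have C1 : Ck 1 f by exact: CkW.
have T h : exists2 c : R, 0 < c < 1 &
   f (x + h *: v) = f x + h * 'D_v f x + h ^+ 2 / 2 * D2 (x + (c * h) *: v).
  have [c c01 E] := taylor2 x (h *: v) Cf; exists c => //.
  rewrite {}E deriveZ_dir; last exact: Ck_derivable C1; congr (_ + _).
  have -> : (fun y => 'D_(h *: v) f y) = (fun y => (cst h) y * 'D_v f y).
    by apply/funext => y; rewrite deriveZ_dir //; exact: Ck_derivable C1.
  have -> z : 'D_(h *: v) (fun y => cst h y * 'D_v f y) z = h * (h * D2 z).
    rewrite -deriveZ_dir; last by apply: (@Ck_derivable 0); exact: Ck_D.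
    rewrite -[fun y => _]/(h \*o (fun y => 'D_v f y)) deriveMl //.
    by apply: (@Ck_derivable 0); exact: Ck_D.
  by rewrite scalerA; field.
have cD2 : {for x, continuous D2} by apply: (Ck_cont (Ck_D v (Ck_D v Cf))).
have near e : 0 < e -> exists2 r : R, 0 < r & forall h, `|h| < r ->
   h * ('D_v f x - a) + h ^+ 2 / 2 * (D2 x - b) <= e * h ^+ 2.
  move=> e0; have e2 : 0 < e / 2 by rewrite divr_gt0.
  have [r1 r10 H1] := H _ e2.
  have /cont_at_eps /(_ _ e0)[r2 r20 H2] := cD2.
  have v1 : 0 < `|v| + 1 by rewrite ltr_wpDl.
  exists (Num.min r1 (r2 / (`|v| + 1))); first by rewrite lt_min r10 divr_gt0.
  move=> h; rewrite lt_min ltr_pdivlMr // => /andP[h1 h2].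
  have := H1 _ h1; have [c /andP[c0 c1] ->] := T h.
  have : `|D2 (x + (c * h) *: v) - D2 x| < e.
    apply: H2; rewrite normrZ normrM gtr0_norm //; apply: le_lt_trans h2.
    rewrite -mulrA mulrDr mulr1 mulrCA.
    apply: (@le_trans _ _ (`|h| * `|v|)); last by rewrite lerDl.
    by rewrite ler_wpM2l // ler_piMl // ltW.
  rewrite ltr_norml => /andP[+ _].
  have := sqr_ge0 h; set q := h ^+ 2; set A : R := D2 _; set B : R := D2 x; set G : R := 'D_v f x.
  move=> q0 hA hB;
  have : q * (- e) <= q * (A - B) by rewrite ler_wpM2l // ltW.
  lra.
have Da : 'D_v f x = a.
  apply/eqP; rewrite -subr_eq0; apply/negP => /negP nz.
  pose m : R := 'D_v f x - a; have m0 : 0 < `|m| by rewrite normr_gt0.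
  have [r r0 Hr] := near 1 ltr01.
  pose B : R := 2 + `|D2 x - b|.
  have B0 : 0 < B by rewrite ltr_wpDr.
  pose s : R := Num.min (r / 2) (`|m| / (2 * B)).
  have s0 : 0 < s by rewrite lt_min !divr_gt0 // mulr_gt0.
  have s1 : s < r by rewrite /s gt_min; apply/orP; left; lra.
  have s2 : s * (2 * B) <= `|m|.
    by rewrite -ler_pdivlMr ?mulr_gt0 // /s ge_min lexx orbT.
  have sg : Num.sg m ^+ 2 = 1 by rewrite sqr_sg nz.
  have E1 : Num.sg m * s * m = s * `|m| by rewrite normrEsg; ring.
  have ns : `|Num.sg m * s| < r.
    by rewrite normrM normr_sg nz /= mulr1n mul1r gtr0_norm.
  have := Hr _ ns; rewrite -/m E1 exprMn sg !mul1r.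
  have : - `|D2 x - b| <= D2 x - b by rewrite lerNl -normrN ler_norm.
  set q := D2 x - b; rewrite /B in s2 B0 * => hq.
  have ss : 0 < s * s by rewrite mulr_gt0.
  have : s * s * (- `|q|) <= s * s * q by rewrite ler_pM2l.
  have : s * (s * (2 * (2 + `|q|))) <= s * `|m| by rewrite ler_pM2l.
  have := mulr_ge0 (ltW ss) (normr_ge0 q); rewrite expr2; lra.
split=> //; rewrite leNgt; apply/negP => lt; rewrite -/(D2 x) in lt.
have e0 : 0 < (D2 x - b) / 4 by rewrite divr_gt0 // subr_gt0.
have [r r0 Hr] := near _ e0.
have := Hr (r / 2); rewrite gtr0_norm ?divr_gt0 //.
have r2 : r / 2 < r by lra.
move=> /(_ r2); rewrite Da subrr mulr0 add0r.
have : 0 < (r / 2) ^+ 2 by rewrite exprn_gt0 // divr_gt0.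
set q := (r / 2) ^+ 2 => q0; rewrite -subr_le0.
have -> : q / 2 * (D2 x - b) - (D2 x - b) / 4 * q = q * ((D2 x - b) / 4) by field.
by rewrite leNgt mulr_gt0.
Qed.

Lemma derive2_expansion f x v (a b K : R) : Ck 2 f ->
  (forall h, `|h| <= 1 ->
    `|f (x + h *: v) - (f x + h * a + h ^+ 2 / 2 * b)| <= K * `|h| ^+ 3) ->
  'D_v f x = a /\ 'D_v (fun y => 'D_v f y) x = b.
Proof.
move=> Cf H.
have up g (a' b' : R) : Ck 2 g -> (forall h, `|h| <= 1 ->
    `|g (x + h *: v) - (g x + h * a' + h ^+ 2 / 2 * b')| <= K * `|h| ^+ 3) ->
    'D_v g x = a' /\ 'D_v (fun y => 'D_v g y) x <= b'.
  move=> Cg Hg; apply: derive2_upper => // e e0.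
  have K1 : 0 < `|K| + 1 by rewrite ltr_wpDl.
  exists (Num.min 1 (e / (`|K| + 1))); first by rewrite lt_min ltr01 divr_gt0.
  move=> h; rewrite lt_min ltr_pdivlMr // => /andP[h1 h2].
  have := Hg h (ltW h1); rewrite ler_norml => /andP[_].
  have : K * `|h| ^+ 3 <= e * h ^+ 2.
    rewrite exprS -normrX mulrA [`|h ^+ 2|]ger0_norm ?sqr_ge0 //.
    apply: ler_wpM2r; first exact: sqr_ge0.
    apply: (le_trans _ (ltW h2)); rewrite mulrC ler_wpM2l //.
    by apply: (le_trans (ler_norm K)); rewrite lerDl.
  lra.
have [Da Db] := up f a b Cf H.
have [|_] := up (fun y => - f y) (- a) (- b) (Ck_opp Cf).
  move=> h /H; rewrite -normrN; congr (`| _ | <= _); ring.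
have -> : (fun y => 'D_v (fun y0 => - f y0) y) = (fun y => - 'D_v f y).
  by apply/funext => y; rewrite -deriveN //; exact: Ck_derivable Cf.
rewrite -[fun y => - _]/(- (fun y => 'D_v f y)) deriveN; last first.
  by apply: (@Ck_derivable 0); exact: Ck_D.
by rewrite lerN2 => Db'; split=> //; apply/eqP; rewrite eq_le Db.
Qed.

End Calculus.
Arguments Ck_derivable {R V k f} x v _.

(** * Gradient and Hessian *)

(** The Hessian as a bilinear form, sealed because unification otherwise tries
    to compare second derivatives at different points by unfolding them. *)
HB.lock Definition hform (R : realType) (d : nat) (f : 'rV[R]_d -> R)
  (x v w : 'rV[R]_d) : R := dot (v *m hess f x) w.

Section Gradient.
Context {R : realType} {d : nat}.
Implicit Types (f : 'rV[R]_d -> R) (x y v w : 'rV[R]_d).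

Lemma derive_grad f x v : Ck 1 f -> 'D_v f x = dot (grad f x) v.
Proof.
move=> Cf; rewrite dotE [in LHS](row_basis v).
elim/big_rec2: _ => [|i y1 y2 _ IH]; first exact: derive0.
by rewrite derive_lin // IH mxE mulrC.
Qed.

Lemma derive_hess f x v w : Ck 2 f ->
  'D_v (fun y => 'D_w f y) x = hform f x v w.
Proof.
move=> Cf; rewrite hform.unlock; have C1 : Ck 1 f by exact: CkW.
have -> : (fun y => 'D_w f y) =
    (fun y => \sum_j w 0 j * 'D_(basis_vec R j) f y).
  apply/funext => y; rewrite derive_grad // dotE.
  by apply: eq_bigr => j _; rewrite mxE mulrC.
pose F (j : 'I_d) (y : 'rV[R]_d) : R := w 0 j * 'D_(basis_vec R j) f y.
have -> : (fun y => \sum_j w 0 j * 'D_(basis_vec R j) f y) = \sum_j F j.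
  by apply/funext => y; rewrite fct_sumE.
have D1 j : Ck 1 (fun y => 'D_(basis_vec R j) f y) by exact: Ck_D.
have DF j : derivable (F j) x v.
  by apply: derivableM => //; apply: (@Ck_derivable _ _ 0); exact: D1.
rewrite derive_sum // dotE; apply: eq_bigr => j _.
rewrite -[F j]/(w 0 j \*o (fun y => 'D_(basis_vec R j) f y)) deriveMl; last first.
  by apply: (@Ck_derivable _ _ 0); exact: D1.
rewrite mulrC; congr (_ * _); rewrite derive_grad // dotE mxE.
by apply: eq_bigr => i _; rewrite !mxE mulrC.
Qed.

Lemma hformE f x v w : hform f x v w = dot (v *m hess f x) w.
Proof. by rewrite hform.unlock. Qed.

Lemma hformDl f x u v w : hform f x (u + v) w = hform f x u w + hform f x v w.
Proof. by rewrite !hformE mulmxDl dotDl. Qed.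

Lemma hformDr f x u v w : hform f x w (u + v) = hform f x w u + hform f x w v.
Proof. by rewrite !hformE dotDr. Qed.

Lemma hformZl f x (a : R) v w : hform f x (a *: v) w = a * hform f x v w.
Proof. by rewrite !hformE -scalemxAl dotZl. Qed.

Lemma hformZr f x (a : R) v w : hform f x v (a *: w) = a * hform f x v w.
Proof. by rewrite !hformE dotZr. Qed.

Lemma taylor2_form f x v : Ck 2 f -> exists2 c : R, 0 < c < 1 &
  f (x + v) = f x + dot (grad f x) v + hform f (x + c *: v) v v / 2.
Proof.
move=> Cf; have [c c01 E] := taylor2 x v Cf; exists c => //.
by rewrite E derive_hess // derive_grad //; exact: CkW.
Qed.

Lemma hess_entry_cont f i j : Ck 2 f -> continuous (fun y => hess f y i j).
Proof.
move=> Cf; have -> : (fun y => hess f y i j) =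
   (fun y => 'D_(basis_vec R i) (fun z => 'D_(basis_vec R j) f z) y).
  by apply/funext => y; rewrite mxE.
exact: (Ck_cont (Ck_D _ (Ck_D _ Cf))).
Qed.

Lemma hess_cont f x (e : R) : Ck 2 f -> 0 < e -> exists2 r : R, 0 < r &
  forall y v, `|y| < r ->
    `|hform f (x + y) v v - hform f x v v| <= e * dot v v.
Proof.
move=> Cf e0; have d0 : 0 < d%:R ^+ 2 + 1 :> R.
  by rewrite ltr_wpDl // exprn_ge0.
pose e' := e / (d%:R ^+ 2 + 1).
have e'0 : 0 < e' by rewrite divr_gt0.
have : \forall y \near x, forall ij : 'I_d * 'I_d,
    `|hess f x ij.1 ij.2 - hess f y ij.1 ij.2| <= e'.
  refine (@filter_forall _ _ (fun (ij : 'I_d * 'I_d) y =>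
    `|hess f x ij.1 ij.2 - hess f y ij.1 ij.2| <= e') (nbhs x) _ _) => -[i j].
  by have /cvgrPdist_le /(_ _ e'0) := @hess_entry_cont f i j Cf x.
move=> /nbhs_ballP[r r0 Hr]; exists r => // y v yr.
have Exy i j : `|(hess f (x + y) - hess f x) i j| <= e'.
  have -> : (hess f (x + y) - hess f x) i j = hess f (x + y) i j - hess f x i j.
    by move: (hess f (x + y)) (hess f x) => A B; rewrite !mxE.
  rewrite distrC; apply: (Hr (x + y) _ (i, j)).
  by rewrite -ball_normE /= opprD addNKr normrN.
have -> : hform f (x + y) v v - hform f x v v =
    dot (v *m (hess f (x + y) - hess f x)) v.
  by rewrite !hformE; move: (hess f (x + y)) (hess f x) => A B; rewrite mulmxBr dotBl.
apply: (le_trans (form_le_entries v (ltW e'0) Exy)).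
rewrite ler_wpM2r ?dot_ge0 // /e' mulrA ler_pdivrMr // mulrC ler_wpM2l //.
  exact: ltW.
by rewrite lerDl.
Qed.

Lemma taylor2_o f x (e : R) : Ck 2 f -> 0 < e -> exists2 r : R, 0 < r &
  forall v, `|v| < r ->
    `|f (x + v) - (f x + dot (grad f x) v + hform f x v v / 2)|
      <= e * dot v v.
Proof.
move=> Cf e0; have [r r0 Hr] := hess_cont x Cf e0; exists r => // v vr.
have [c /andP[c0 c1] ->] := taylor2_form x v Cf.
have cv : `|c *: v| < r.
  by rewrite normrZ gtr0_norm //; apply: le_lt_trans vr; rewrite ler_piMl // ltW.
have e2 : 0 <= e * dot v v by rewrite mulr_ge0 ?dot_ge0 // ltW.
have := Hr (c *: v) v cv; move: (x + c *: v) => y.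
move: (hform f y v v) (hform f x v v) e2 => p q.
move: (e * _) (dot (grad f x) v) (f x) => E G F E0.
rewrite !ler_norml => /andP[h1 h2]; apply/andP; split; lra.
Qed.

(** Symmetry of the Hessian. Going from [x] to [x + h(v + w)] along the two
    sides [h v] and [h w] produces the mixed term ['D_v 'D_w f] on its own,
    whereas the straight path symmetrises it. *)
Lemma hess_sym f x : Ck 2 f -> (hess f x)^T = hess f x.
Proof.
move=> Cf; have C1 : Ck 1 f by exact: CkW.
pose B v w := hform f x v w.
suff H v w : B w v <= B v w.
  apply/matrixP => i j; rewrite mxE -!form_entry -!hformE.
  by apply/eqP; rewrite eq_le; apply/andP; split; apply: H.
have [|_ ] := @derive2_upper _ _ f x (v + w) (dot (grad f x) v + dot (grad f x) w)
  (B v v + 2 * B v w + B w w) Cf; last first.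
  rewrite derive_hess // hformDl !hformDr -/(B v v) -/(B w w).
  rewrite -/(B v w) -/(B w v).
  by move: (B v v) (B v w) (B w v) (B w w) => *; lra.
move=> e e0; pose M : R := dot v v + dot w w + 1.
have M0 : 0 < M by rewrite ltr_wpDl // addr_ge0 ?dot_ge0.
have e3 : 0 < e / (4 * M) by rewrite divr_gt0 // mulr_gt0.
have [r1 r10 H1] := taylor2_o x Cf e3.
have [r2 r20 H2] := hess_cont x Cf e3.
have /is_derive_epsP /(_ _ (divr_gt0 e0 (ltr0n _ 4)))[r3 r30 H3] :
    is_derive x v (fun y => 'D_w f y) (B v w).
  rewrite /B -derive_hess //; apply: derivableP.
  by apply: (@Ck_derivable _ _ 0); exact: Ck_D.
pose N : R := `|v| + `|w| + 1.
have N0 : 0 < N by rewrite ltr_wpDl // addr_ge0.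
exists (Num.min r3 (Num.min r1 r2 / N)).
  by rewrite !lt_min r30 divr_gt0 // lt_min r10 r20.
move=> h; rewrite lt_min ltr_pdivlMr // lt_min => /andP[h3 /andP[h1 h2]].
have [c /andP[c0 c1] E] := taylor2_form (x + h *: v) (h *: w) Cf.
have -> : x + h *: (v + w) = x + h *: v + h *: w by rewrite scalerDr addrA.
rewrite {}E -derive_grad //.
have hv : `|h *: v| < r1.
  rewrite normrZ; apply: le_lt_trans h1; rewrite ler_wpM2l // /N.
  by rewrite -addrA lerDl addr_ge0.
have hw : `|h *: v + c *: (h *: w)| < r2.
  apply: le_lt_trans h2; apply: (le_trans (ler_normD _ _)).
  rewrite !normrZ (gtr0_norm c0) /N.
  have : c * (`|h| * `|w|) <= `|h| * `|w| by rewrite ler_piMl ?mulr_ge0 // ltW.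
  have := normr_ge0 h; lra.
have k1 := H1 _ hv; have k2 := H2 (h *: v + c *: (h *: w)) (h *: w) hw.
rewrite addrA in k2; rewrite (deriveZ_dir h (Ck_derivable (x + h *: v) w C1)).
have k3 : h * ('D_w f (x + h *: v) - 'D_w f x - h * B v w) <= e / 4 * (h * h).
  apply: (le_trans (ler_norm _)); rewrite normrM.
  have -> : h * h = `|h| * `|h| by rewrite -normrM ger0_norm // -expr2 sqr_ge0.
  by rewrite mulrCA ler_wpM2l // H3.
rewrite -!(derive_grad x _ C1); rewrite -(derive_grad x _ C1) in k1.
rewrite (deriveZ_dir h (Ck_derivable x v C1)) in k1.
have q u : dot u u <= M -> e / (4 * M) * dot (h *: u) (h *: u) <= e / 4 * (h * h).
  move=> uM; rewrite dotZl dotZr.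
  have -> : e / (4 * M) * (h * (h * dot u u)) = e / 4 * (h * h) * (dot u u / M).
    by field; rewrite gt_eqF.
  rewrite ler_piMr //; last by rewrite ler_pdivrMr // mul1r.
  by rewrite mulr_ge0 // ?divr_ge0 // ?(ltW e0) // -expr2 sqr_ge0.
have q1 : e / (4 * M) * dot (h *: v) (h *: v) <= e / 4 * (h * h).
  by apply: q; rewrite /M -addrA lerDl addr_ge0 ?dot_ge0.
have q2 : e / (4 * M) * dot (h *: w) (h *: w) <= e / 4 * (h * h).
  by apply: q; rewrite /M addrAC lerDr addr_ge0 ?dot_ge0.
have {}k1 := le_trans k1 q1; have {}k2 := le_trans k2 q2.
rewrite !ler_norml in k1 k2.
rewrite !hformZl !hformZr -/(B v v) in k1.
have Ew : hform f x (h *: w) (h *: w) = h * (h * B w w).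
  by rewrite hformZl hformZr.
rewrite Ew in k2.
move: k1 k2 k3 => /andP[_ k1] /andP[_ k2]; rewrite expr2.
move: (hform f _ (h *: w) (h *: w)) (f (x + h *: v)) (f x) k1 k2 => Y F G.
move: ('D_w f (x + h *: v)) ('D_w f x) ('D_v f x) => E1 E2 E3.
move: (B v v) (B v w) (B w w) => B1 B2 B3 k1 k2 k3.
have := mulr_ge0 (ltW e0) (sqr_ge0 h); rewrite expr2; lra.
Qed.

(** Lets the derivatives of explicit functions be read off from their exact
    expansion. *)
Lemma grad_hess_expansion f x g (b : 'rV[R]_d -> R) : Ck 2 f ->
  (forall v, exists K : R, forall h : R, `|h| <= 1 ->
    `|f (x + h *: v) - (f x + h * dot g v + h ^+ 2 / 2 * b v)| <= K * `|h| ^+ 3) ->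
  grad f x = g /\ forall v, hform f x v v = b v.
Proof.
move=> Cf H; have C1 : Ck 1 f by exact: CkW.
have D v : 'D_v f x = dot g v /\ 'D_v (fun y => 'D_v f y) x = b v.
  by have [K HK] := H v; exact: derive2_expansion HK.
split=> [|v]; last by rewrite -derive_hess //; case: (D v).
by apply: dot_inj => v; rewrite -derive_grad //; case: (D v).
Qed.

End Gradient.

(** * Derivatives in space and time *)

Section Polynomials.
Context {R : realType} {d : nat} {V : normedModType R}.
Implicit Types l m : V -> 'rV[R]_d.

Lemma Ck_dot k l m : (forall i, Ck k (fun z => l z 0 i)) ->
  (forall i, Ck k (fun z => m z 0 i)) -> Ck k (fun z => dot (l z) (m z)).
Proof.
move=> Cl Cm; under eq_fun do rewrite dotE.
by apply: Ck_sum => i; exact: Ck_mul.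
Qed.

Lemma Ck_form k l (A : 'M[R]_d) : (forall i, Ck k (fun z => l z 0 i)) ->
  Ck k (fun z => dot (l z *m A) (l z)).
Proof.
move=> Cl; apply: Ck_dot => // i; under eq_fun do rewrite mxE.
by apply: Ck_sum => j; apply: Ck_mul => //; exact: Ck_cst.
Qed.

End Polynomials.

Section SpaceTime.
Context {R : realType} {d : nat}.
Implicit Types (phi : 'rV[R]_d * R -> R) (z : 'rV[R]_d * R) (v : 'rV[R]_d).

Lemma Ck_coord k i (c : 'rV[R]_d) : Ck k (fun x : 'rV[R]_d => (x - c) 0 i).
Proof.
apply: (@Ck_affine _ _ _ _ (fun v => v 0 i) 1) => [v|x h v].
  by rewrite mul1r coord_le_norm.
by rewrite !mxE; ring.
Qed.

Lemma fst_norm_le (z : 'rV[R]_d * R) : `|z.1| <= `|z|.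
Proof. by rewrite [leRHS]/Num.norm /= le_max lexx. Qed.

Lemma snd_norm_le (z : 'rV[R]_d * R) : `|z.2| <= `|z|.
Proof. by rewrite [leRHS]/Num.norm /= le_max lexx orbT. Qed.

Lemma Ck_coord_st k i (c b : 'rV[R]_d) :
  Ck k (fun z : 'rV[R]_d * R => (z.1 - c + z.2 *: b) 0 i).
Proof.
apply: (@Ck_affine R ('rV[R]_d * R)%type k _ (fun v : 'rV[R]_d * R => v.1 0 i + v.2 * b 0 i) (1 + `|b|)).
  move=> v; apply: (le_trans (ler_normD _ _)); rewrite mulrDl mul1r lerD //.
    exact: le_trans (coord_le_norm _ _) (fst_norm_le _).
  by rewrite normrM mulrC ler_pM // ?coord_le_norm // snd_norm_le.
by move=> x h v; rewrite /= !mxE /=; rewrite /GRing.scale /=; ring.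
Qed.

Lemma Ck_time k : Ck k (fun z : 'rV[R]_d * R => z.2).
Proof.
apply: (@Ck_affine R ('rV[R]_d * R)%type k _ (fun v : 'rV[R]_d * R => v.2) 1) => [v|x h v] //.
by rewrite mul1r snd_norm_le.
Qed.

Lemma dot_grad_slice phi z v : Ck 1 phi ->
  dot (grad (slice phi z.2) z.1) v = 'D_(v, 0 : R) phi z.
Proof.
move=> Cphi.
have E i : grad (slice phi z.2) z.1 0 i = 'D_(basis_vec R i, 0 : R) phi z.
  rewrite mxE /derive; set D1 := (fun _ : R => _); set D2 := (fun _ : R => _).
  suff -> : D1 = D2 by []. apply/funext => h; rewrite /D1 /D2.
  rewrite /slice /=; congr (_ *: (phi _ - _)); last by case: (z).
  rewrite -[RHS]/(h *: basis_vec R i + z.1, h * 0 + z.2).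
  by rewrite mulr0 add0r.
have -> : (v, 0 : R) = \sum_i v 0 i *: (basis_vec R i, 0 : R).
  rewrite [in LHS](row_basis v).
  elim/big_rec2: _ => // i y1 y2 _ <-.
  rewrite -[RHS]/(v 0 i *: basis_vec R i + y2, v 0 i * 0 + 0).
  by rewrite mulr0 add0r.
rewrite dotE; elim/big_rec2: _ => [|i y1 y2 _ ->]; first by rewrite derive0.
by rewrite derive_lin // E mulrC.
Qed.

Lemma dtE phi z : dt phi z = 'D_(0 : 'rV[R]_d, 1 : R) phi z.
Proof.
rewrite /dt /derive1 /derive; set D1 := (fun _ : R => _).
set D2 := (fun _ : R => _); suff -> : D1 = D2 by [].
apply/funext => h; rewrite /D1 /D2.
congr (_ *: (phi _ - _)); last by case: (z).
rewrite -[RHS]/(h *: 0 + z.1, h * 1 + z.2).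
by rewrite scaler0 add0r mulr1.
Qed.

Lemma derive_st phi z v (a : R) : Ck 1 phi ->
  'D_(v, a) phi z = dot (grad (slice phi z.2) z.1) v + a * dt phi z.
Proof.
move=> Cphi; rewrite dot_grad_slice // dtE.
have -> : (v, a) = a *: (0 : 'rV[R]_d, 1 : R) + (v, 0).
  rewrite -[RHS]/(a *: 0 + v, a * 1 + 0).
  by rewrite scaler0 add0r mulr1 addr0.
by rewrite derive_lin // addrC.
Qed.

Lemma grad_dt_expansion phi z (g : 'rV[R]_d) (a : R) : Ck 1 phi ->
  (forall v b, exists K : R, forall h : R, `|h| <= 1 ->
    `|phi (z.1 + h *: v, z.2 + h * b) - phi z - h * (dot g v + b * a)|
      <= K * h ^+ 2) ->
  grad (slice phi z.2) z.1 = g /\ dt phi z = a.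
Proof.
move=> Cphi H.
have D v (b : R) : 'D_(v, b) phi z = dot g v + b * a.
  have [K HK] := H v b.
  suff: is_derive z (v, b) phi (dot g v + b * a) by case.
  apply/is_derive_epsP => e e0.
  have K1 : 0 < `|K| + 1 by rewrite ltr_wpDl.
  exists (Num.min 1 (e / (`|K| + 1))); first by rewrite lt_min ltr01 divr_gt0.
  move=> h; rewrite lt_min ltr_pdivlMr // => /andP[h1 h2].
  have -> : z + h *: (v, b) = (z.1 + h *: v, z.2 + h * b) by case: z {H HK}.
  apply: (le_trans (HK h (ltW h1))).
  have -> : h ^+ 2 = `|h| * `|h| by rewrite -normrM -expr2 ger0_norm ?sqr_ge0.
  rewrite mulrA ler_wpM2r //; apply: (le_trans _ (ltW h2)).
  by rewrite mulrC ler_wpM2l //; apply: (le_trans (ler_norm K)); rewrite lerDl.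
split.
  by apply: dot_inj => v; rewrite dot_grad_slice // D mul0r addr0.
by rewrite dtE D dot0r add0r mul1r.
Qed.

End SpaceTime.

(** * Maxima of coercive functions *)

Section Extrema.
Context {R : realType} {d : nat}.
Implicit Types (f : 'rV[R]_d -> R) (v w : 'rV[R]_d).

Lemma compact_ball (r : R) : compact [set v : 'rV[R]_d | `|v| <= r].
Proof.
apply: bounded_closed_compact.
  exists r; split; first exact: num_real.
  by move=> M rM v /= vr; apply: le_trans vr (ltW rM).
rewrite -[X in closed X]/((fun v : 'rV[R]_d => `|v|) @^-1` [set s | s <= r]).
apply: (@closed_comp _ _ (fun v : 'rV[R]_d => `|v|)); last exact: closed_le.
by move=> v _; exact: norm_continuous.
Qed.

Lemma evt_coercive f (A c : R) : continuous f -> 0 < c ->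
  (forall v, f v <= A - c * dot v v) -> exists v, forall w, f w <= f v.
Proof.
move=> cf c0 fA; pose r : R := `|A - f 0| / c + 1.
have r1 : 1 <= r by rewrite lerDr divr_ge0 // ltW.
have [|v _ vmax] := EVT_max_rV _ (@compact_ball r) (continuous_subspaceT cf).
  by exists 0; rewrite /= normr0 (le_trans ler01).
exists v => w; have [wr|wr] := leP `|w| r; first by apply: vmax; rewrite inE.
apply: (@le_trans _ _ (f 0)); last first.
  by apply: vmax; rewrite inE /= normr0 (le_trans ler01).
apply: (le_trans (fA w)); rewrite lerBlDr -lerBlDl.
apply: (le_trans (ler_norm _)).
have : `|A - f 0| <= c * r.
  by rewrite /r mulrDr mulr1 mulrC divfK ?gt_eqF // lerDl ltW.
move=> /le_trans; apply; rewrite ler_wpM2l ?(ltW c0) //.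
apply: (le_trans (ltW wr)); apply: (le_trans _ (norm_sqr_le_dot w)).
by rewrite expr2 ler_peMr // (le_trans r1 (ltW wr)).
Qed.

Lemma evt_strip (f : 'rV[R]_d * R -> R) (T A c : R) : continuous f -> 0 <= T ->
  0 < c -> (forall v s, 0 <= s <= T -> f (v, s) <= A - c * dot v v) ->
  exists v s, 0 <= s <= T /\ forall w t, 0 <= t <= T -> f (w, t) <= f (v, s).
Proof.
move=> cf T0 c0 fA; pose r : R := `|A - f (0, 0)| / c + 1.
have r1 : 1 <= r by rewrite lerDr divr_ge0 // ltW.
pose K := [set v : 'rV[R]_d | `|v| <= r] `*` `[0, T]%classic.
have cK : compact K by apply: compact_setX; [exact: compact_ball | exact: segment_compact].
have K0 : K (0, 0).
  by split; rewrite /= ?normr0 ?(le_trans ler01) // in_itv /= lexx.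
have [|[v s] /[!inE] -[_ /=]] :=
  compact_EVT_max _ cK (continuous_subspaceT cf : {within K, continuous f}).
  by exists (0, 0).
rewrite in_itv /= => sT vmax; exists v, s; split=> // w t tT.
have [wr|wr] := leP `|w| r.
  by apply: vmax; rewrite inE; split; rewrite //= in_itv.
apply: (@le_trans _ _ (f (0, 0))); last by apply: vmax; rewrite inE.
apply: (le_trans (fA w t tT)); rewrite lerBlDr -lerBlDl.
apply: (le_trans (ler_norm _)).
have : `|A - f (0, 0)| <= c * r.
  by rewrite /r mulrDr mulr1 mulrC divfK ?gt_eqF // lerDl ltW.
move=> /le_trans; apply; rewrite ler_wpM2l ?(ltW c0) //.
apply: (le_trans (ltW wr)); apply: (le_trans _ (norm_sqr_le_dot w)).
by rewrite expr2 ler_peMr // (le_trans r1 (ltW wr)).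
Qed.

Lemma dot_small (e : R) : 0 < e ->
  exists2 r : R, 0 < r & forall z : 'rV[R]_d, `|z| < r -> dot z z < e.
Proof.
move=> e0; have d1 : 0 < d%:R + 1 :> R by rewrite ltr_wpDl.
exists (Num.min 1 (e / (d%:R + 1))); first by rewrite lt_min ltr01 divr_gt0.
move=> z; rewrite lt_min ltr_pdivlMr // => /andP[z1 z2].
apply: le_lt_trans z2; apply: (le_trans (dot_le_sqr_norm z)).
have : `|z| * `|z| <= `|z| by rewrite ler_piMl // ltW.
have := normr_ge0 z; have : 0 <= d%:R :> R by []; rewrite expr2; nra.
Qed.

End Extrema.

(** * Legendre duality for a uniformly convex Hamiltonian *)

Section Legendre.
Context {R : realType} {d : nat}.
Variables (H : 'rV[R]_d -> R) (th Th : R).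
Hypotheses (C2 : Ck 2 H) (th0 : 0 < th) (Th0 : 0 < Th).
Hypothesis Hlo : forall p v, th * dot v v <= hform H p v v.
Hypothesis Hhi : forall p v, hform H p v v <= Th * dot v v.
Implicit Types (p q v w z : 'rV[R]_d).

Local Notation b := (grad H).

Lemma H_lower p q : H p + dot (b p) q + th / 2 * dot q q <= H (p + q).
Proof.
have [c _ ->] := taylor2_form p q C2; rewrite lerD2l.
by rewrite mulrAC ler_wpM2r // Hlo.
Qed.

Lemma H_upper p q : H (p + q) <= H p + dot (b p) q + Th / 2 * dot q q.
Proof.
have [c _ ->] := taylor2_form p q C2; rewrite lerD2l.
by rewrite [leRHS]mulrAC ler_wpM2r // Hhi.
Qed.

(** By uniform convexity [(q, v) - H(q)] has a maximum point [q]; a gradient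
    step of length [1 / Th] from it would increase the value unless
    [DH(q) = v]. *)
Lemma grad_surj v : exists q, b q = v.
Proof.
have cf : continuous (fun q => dot q v - H q).
  apply: (@Ck_cont _ _ 0); apply: Ck_sub; last exact: (Ck_le _ C2).
  have -> : (fun q => dot q v) = (fun q => dot (q - 0) v).
    by apply/funext => q; rewrite subr0.
  by apply: Ck_dot => i; [exact: Ck_coord | exact: Ck_cst].
have [||q qmax] := @evt_coercive _ _ (fun q => dot q v - H q)
   (dot (v - b 0) (v - b 0) / th - H 0) (th / 4) cf.
- by rewrite divr_gt0.
- move=> q; have := H_lower 0 q; rewrite add0r.
  have th2 : 0 < th / 2 by rewrite divr_gt0.
  have := young q (v - b 0) th2; rewrite dotBr (dotC q (b 0)).
  have -> : 2 * (th / 2) = th by field.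
  lra.
exists q; apply/eqP; rewrite eq_sym -subr_eq0 -dot_eq0 eq_le dot_ge0 andbT.
pose w := v - b q; rewrite -/w.
have := qmax (q + Th^-1 *: w); have := H_upper q (Th^-1 *: w).
rewrite dotDl !dotZl !dotZr => h1 h2.
have h3 : Th^-1 * (dot w v - dot (b q) w) <= Th / 2 * (Th^-1 * (Th^-1 * dot w w)).
  lra.
have wE : dot w v - dot (b q) w = dot w w by rewrite [RHS]dotBr (dotC w (b q)).
rewrite wE in h3; have h4 : Th / 2 * (Th^-1 * (Th^-1 * dot w w)) = Th^-1 * dot w w / 2.
  by field; rewrite gt_eqF.
rewrite h4 -mulrA ler_pM2l ?invr_gt0 // in h3; lra.
Qed.

Definition slope v := projT1 (cid (grad_surj v)).

Lemma grad_slope v : b (slope v) = v.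
Proof. exact: projT2 (cid (grad_surj v)). Qed.

(** The convex conjugate of [H], the maximum of [(q, v) - H(q)] being attained
    at [slope v]. *)
Definition legendre v : R := dot (slope v) v - H (slope v).

Local Notation L := legendre.

Lemma fenchel q v : dot q v <= H q + L v.
Proof.
have := H_lower (slope v) (q - slope v); rewrite grad_slope subrKC dotBr /legendre.
have := dot_ge0 (q - slope v); rewrite (dotC q) (dotC (slope v)).
have : 0 < th / 2 by rewrite divr_gt0.
move: (dot (q - slope v) _) => D; nra.
Qed.

Lemma legendre_grad q : L (b q) = dot q (b q) - H q.
Proof.
apply/eqP; rewrite eq_le [X in _ && X]lerBlDl fenchel andbT /legendre.
set q' := slope _; have := H_lower q (q' - q); rewrite subrKC dotBr.
have := dot_ge0 (q' - q); rewrite (dotC q) (dotC q').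
have : 0 < th / 2 by rewrite divr_gt0.
move: (dot (q' - q) _) => D; nra.
Qed.

(** Conjugation exchanges the upper and lower quadratic bounds on [H] and
    inverts their constants. *)
Lemma legendre_upper p z : L (b p + z) <= L (b p) + dot p z + dot z z / (2 * th).
Proof.
rewrite legendre_grad /legendre; set q := slope _; have := H_lower p (q - p).
rewrite subrKC; have := young (q - p) z th0.
rewrite [dot (b p) _]dotBr [dot (q - p) z]dotBl [dot q (_ + _)]dotDr (dotC q (b p)) (dotC p (b p)).
lra.
Qed.

Lemma legendre_lower p z : L (b p) + dot p z + dot z z / (2 * Th) <= L (b p + z).
Proof.
rewrite legendre_grad; have := fenchel (p + Th^-1 *: z) (b p + z).
have := H_upper p (Th^-1 *: z).
rewrite !dotDl !dotDr !dotZl !dotZr (dotC z (b p)).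
have -> : Th / 2 * (Th^-1 * (Th^-1 * dot z z)) = Th^-1 * dot z z / 2.
  by field; rewrite gt_eqF.
have -> : dot z z / (2 * Th) = Th^-1 * dot z z / 2.
  by field; rewrite gt_eqF.
lra.
Qed.

Lemma legendre_convex (s : R) v w : 0 <= s <= 1 ->
  L ((1 - s) *: v + s *: w) <= (1 - s) * L v + s * L w.
Proof.
move=> /andP[s0 s1]; set x := _ + _; rewrite {1}/legendre.
have := fenchel (slope x) v; have := fenchel (slope x) w.
rewrite {3}/x dotDr !dotZr => h1 h2.
have h3 : s * dot (slope x) w <= s * (H (slope x) + L w) by rewrite ler_wpM2l.
have h4 : (1 - s) * dot (slope x) v <= (1 - s) * (H (slope x) + L v).
  by rewrite ler_wpM2l // subr_ge0.
lra.
Qed.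

Lemma legendre_grow v : - H 0 + dot (v - b 0) (v - b 0) / (2 * Th) <= L v.
Proof.
have := legendre_lower 0 (v - b 0); rewrite subrKC legendre_grad !dot0l; lra.
Qed.

Lemma legendre_ge v : - H 0 <= L v.
Proof.
have := fenchel 0 v; rewrite dot0l; lra.
Qed.

Lemma legendre_cont : continuous L.
Proof.
move=> v; apply/cont_at_eps => e e0; rewrite -(grad_slope v).
set p := slope v.
have [r1 r10 H1] := @dot_small R d (th * e) (mulr_gt0 th0 e0).
pose D : R := d%:R * `|p| + 1.
have D0 : 0 < D by rewrite ltr_wpDl // mulr_ge0.
exists (Num.min r1 (e / (2 * D))).
  by rewrite lt_min r10 divr_gt0 // mulr_gt0.
move=> w; rewrite lt_min ltr_pdivlMr ?mulr_gt0 // => /andP[/H1 w1 w2].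
have h1 := legendre_upper p w; have h2 := legendre_lower p w.
have h3 : `|dot p w| < e / 2.
  apply: (le_lt_trans (dot_le_norm p w)); rewrite ltr_pdivlMr //.
  apply: le_lt_trans w2; rewrite /D; have := normr_ge0 w; nra.
have h4 : dot w w / (2 * th) < e / 2.
  by rewrite ltr_pdivrMr ?mulr_gt0 //; lra.
have h5 : 0 <= dot w w / (2 * Th) by rewrite divr_ge0 ?dot_ge0 // mulr_ge0 // ltW.
move: h3; rewrite !ltr_norml => /andP[h6 h7]; apply/andP; split; lra.
Qed.

Lemma hess_unit p : hess H p \in unitmx.
Proof.
rewrite -row_free_unit -kermx_eq0; apply/eqP/row_matrixP => i; rewrite row0.
set k := row i _; have : k *m hess H p = 0.
  by apply/sub_kermxP; exact: row_sub.
have := Hlo p k; rewrite hformE => /[swap] ->; rewrite dot0l.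
rewrite pmulr_rle0 // => k0; apply/eqP; rewrite -dot_eq0 eq_le k0; exact: dot_ge0.
Qed.

End Legendre.

(** The inverse Hessian as a bilinear form, sealed like [hform]. *)
HB.lock Definition nform (R : realType) (d : nat) (f : 'rV[R]_d -> R)
  (x v w : 'rV[R]_d) : R := dot (v *m invmx (hess f x)) w.

Section InverseHessian.
Context {R : realType} {d : nat}.
Variables (H : 'rV[R]_d -> R) (th Th : R).
Hypotheses (C2 : Ck 2 H) (th0 : 0 < th) (Th0 : 0 < Th).
Hypothesis Hlo : forall p v, th * dot v v <= hform H p v v.
Hypothesis Hhi : forall p v, hform H p v v <= Th * dot v v.
Implicit Types (p q v w z : 'rV[R]_d).

Local Notation b := (grad H).
Local Notation L := (legendre C2 th0 Th0 Hlo Hhi).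

Lemma nformE p v w : nform H p v w = dot (v *m invmx (hess H p)) w.
Proof. by rewrite nform.unlock. Qed.

Lemma nformDl p u v w : nform H p (u + v) w = nform H p u w + nform H p v w.
Proof. by rewrite !nformE mulmxDl dotDl. Qed.

Lemma nformDr p u v w : nform H p w (u + v) = nform H p w u + nform H p w v.
Proof. by rewrite !nformE dotDr. Qed.

Lemma nformZl p (a : R) v w : nform H p (a *: v) w = a * nform H p v w.
Proof. by rewrite !nformE -scalemxAl dotZl. Qed.

Lemma nformZr p (a : R) v w : nform H p v (a *: w) = a * nform H p v w.
Proof. by rewrite !nformE dotZr. Qed.

Lemma nformC p v w : nform H p v w = nform H p w v.
Proof. by rewrite !nformE dot_sym // trmx_inv hess_sym. Qed.

Lemma nform_hess p k w : nform H p (k *m hess H p) w = dot k w.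
Proof. by rewrite nformE mulmxK // (hess_unit th0 Hlo). Qed.

Lemma hform_sym p v w : hform H p v w = hform H p w v.
Proof. by rewrite !hformE dot_sym // hess_sym. Qed.

Lemma nform_slope p z : exists k, [/\ z = k *m hess H p,
  nform H p z z = hform H p k k, nform H p z z = dot k z &
  dot k k <= dot z z / th ^+ 2].
Proof.
exists (z *m invmx (hess H p)).
have zE : z = z *m invmx (hess H p) *m hess H p.
  by rewrite mulmxKV // (hess_unit th0 Hlo).
set k := z *m _ in zE *; have nE : nform H p z z = dot k z by rewrite nformE.
have nh : nform H p z z = hform H p k k by rewrite hformE -zE nE dotC.
split=> //; have := Hlo p k; have := young k z th0; rewrite -nh nE => h1 h2.
have : th * dot k k <= dot z z / th.
  have -> : dot z z / th = 2 * (dot z z / (2 * th)).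
    by field; rewrite gt_eqF.
  lra.
by rewrite mulrC -ler_pdivlMr // => /le_trans; apply; rewrite expr2 invfM mulrA.
Qed.

Lemma nform_ge0 p z : 0 <= nform H p z z.
Proof.
have [k [_ -> _ _]] := nform_slope p z; apply: le_trans (Hlo p k).
by rewrite mulr_ge0 ?dot_ge0 // ltW.
Qed.

Lemma nform_le p z : nform H p z z <= dot z z / th.
Proof.
have [k [_ nh nk _]] := nform_slope p z.
have := Hlo p k; have := young k z th0; rewrite -nh -nk => h1 h2.
have -> : dot z z / th = 2 * (dot z z / (2 * th)).
  by field; rewrite gt_eqF.
lra.
Qed.

(** The lower bound is Fenchel's inequality at [p + k], where [z] is the image
    of [k] under the Hessian at [p]. For the upper bound, uniform convexity
    keeps the maximiser [p + m] at [DH(p) + z] within a multiple of [|z|] of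
    [p], and the terms in [m - k] form a nonpositive square. *)
Lemma legendre_taylor2 p (e : R) : 0 < e -> exists2 r : R, 0 < r & forall z, `|z| < r ->
  `|L (b p + z) - (L (b p) + dot p z + nform H p z z / 2)| <= e * dot z z.
Proof.
move=> e0; have e1 : 0 < e * th ^+ 2 by rewrite mulr_gt0 // exprn_gt0.
have [r r0 Hr] := taylor2_o p C2 e1.
have [r' r'0 Hr'] : exists2 r' : R, 0 < r' &
    forall z : 'rV[R]_d, `|z| < r' -> dot z z < r ^+ 2 * th ^+ 2.
  by apply: dot_small; rewrite mulr_gt0 ?exprn_gt0.
have small (z k : 'rV[R]_d) : `|z| < r' -> dot k k <= dot z z / th ^+ 2 ->
   `|k| < r /\ e * th ^+ 2 * dot k k <= e * dot z z.
  move=> /Hr' zr kz; split.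
    apply: norm_lt_dot => //; apply: (le_lt_trans kz).
    by rewrite ltr_pdivrMr // exprn_gt0.
  rewrite -mulrA ler_wpM2l ?(ltW e0) // mulrC -ler_pdivlMr //; exact: exprn_gt0.
exists r' => // z zr; have [k [zE nh nk kz]] := nform_slope p z.
have [kr ke] := small z _ zr kz.
rewrite legendre_grad ler_norml; apply/andP; split.
  have := fenchel C2 th0 Th0 Hlo Hhi (p + k) (b p + z).
  have := Hr _ kr; rewrite ler_norml => /andP[_].
  rewrite !dotDl !dotDr -nk -nh (dotC k); lra.
set q := slope C2 th0 Th0 Hlo Hhi (b p + z);
have [m qE] : exists m, q = p + m by exists (q - p); rewrite subrKC.
have bq : b q = b p + z by rewrite grad_slope.
have mz : dot m m <= dot z z / th ^+ 2.
  have h1 := H_lower C2 Hlo p m.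
  have := H_lower C2 Hlo q (- m); have -> : q - m = p by rewrite qE addrK.
  rewrite bq !dotNr dotNl dotDl opprK.
  rewrite -qE in h1; have := young m z th0; rewrite (dotC z m) => h2 h3.
  have : th * dot m m <= dot z z / th.
    have -> : dot z z / th = 2 * (dot z z / (2 * th)).
      by field; rewrite gt_eqF.
    lra.
  by rewrite mulrC -ler_pdivlMr // => /le_trans; apply; rewrite expr2 invfM mulrA.
have [mr me] := small z _ zr mz.
rewrite /legendre -/q qE dotDl !dotDr (dotC m (b p)).
have := Hr _ mr; rewrite ler_norml => /andP[h1 _].
have kz2 : dot m z = hform H p m k by rewrite zE dotC hform_sym hformE.
have := Hlo p (m - k); have := mulr_ge0 (ltW th0) (dot_ge0 (m - k)).
have -> : hform H p (m - k) (m - k) =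
    hform H p m m - 2 * hform H p m k + hform H p k k.
  rewrite -(scaleN1r k) hformDl !hformDr !hformZl !hformZr (hform_sym p k m).
  by ring.
rewrite -kz2 -nh.
move: (dot (m + _) _) => D; lra.
Qed.

End InverseHessian.

(** * The Hopf-Lax semigroup *)

Section HopfLax.
Context {R : realType} {d : nat}.
Variables (H : 'rV[R]_d -> R) (th Th : R).
Hypotheses (C2 : Ck 2 H) (th0 : 0 < th) (Th0 : 0 < Th).
Hypothesis Hlo : forall p v, th * dot v v <= hform H p v v.
Hypothesis Hhi : forall p v, hform H p v v <= Th * dot v v.
Implicit Types (p q v w x y z : 'rV[R]_d) (s t : R).

Local Notation b := (grad H).
Local Notation L := (legendre C2 th0 Th0 Hlo Hhi).

Variables (u0 : 'rV[R]_d -> R) (M : R).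
Hypothesis u0M : forall x, `|u0 x| <= M.

(** Payoff of running at constant velocity [v] for a time [t]. *)
Definition payoff x t v : R := u0 (x + t *: v) - t * L v.

(** The maximal payoff over all velocities. *)
Definition hopf_lax (z : 'rV[R]_d * R) : R :=
  payoff z.1 z.2 (xget 0 [set v | forall w, payoff z.1 z.2 w <= payoff z.1 z.2 v]).

Lemma payoff_opt x t : continuous u0 -> 0 <= t ->
  exists v, forall w, payoff x t w <= payoff x t v.
Proof.
move=> cu0; rewrite le_eqVlt => /orP[/eqP<-|t0].
  by exists 0 => w; rewrite /payoff !scale0r !mul0r.
apply: (@evt_coercive _ _ _ (M + t * H 0 + t / (2 * Th) * dot (b 0) (b 0)) (t / (4 * Th))).
- have cu : continuous (fun v => u0 (x + t *: v)).
    move=> v; apply/cont_at_eps => e e0.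
    have /cont_at_eps /(_ _ e0)[r r0 Hr] := cu0 (x + t *: v).
    exists (r / t) => [|w]; first by rewrite divr_gt0.
    rewrite ltr_pdivlMr // => wr; rewrite scalerDr addrA; apply: Hr.
    by rewrite normrZ gtr0_norm // mulrC.
  apply: (@Ck_cont _ _ 0); apply: Ck_sub; first by split.
  apply: Ck_mul; first exact: Ck_cst.
  by split=> //; exact: legendre_cont.
- by rewrite divr_gt0 // mulr_gt0.
move=> v; rewrite /payoff.
have h1 : u0 (x + t *: v) <= M by apply: le_trans (u0M _); exact: ler_norm.
have h2 := legendre_grow C2 th0 Th0 Hlo Hhi v.
have h3 : dot v v / (4 * Th) <= dot (v - b 0) (v - b 0) / (2 * Th) + dot (b 0) (b 0) / (2 * Th).
  rewrite -mulrDl ler_pdivrMr ?mulr_gt0 //.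
  have -> : (dot (v - b 0) (v - b 0) + dot (b 0) (b 0)) / (2 * Th) * (4 * Th) =
     (dot (v - b 0) (v - b 0) + dot (b 0) (b 0)) * 2 by field; rewrite gt_eqF.
  have := dot_ge0 (v - b 0 - b 0); rewrite !dotBl !dotBr (dotC v (b 0)); lra.
have h4 : t * (- H 0 + dot v v / (4 * Th) - dot (b 0) (b 0) / (2 * Th)) <= t * L v.
  by rewrite ler_pM2l //; lra.
have -> : t / (2 * Th) * dot (b 0) (b 0) = t * (dot (b 0) (b 0) / (2 * Th)) by ring.
have -> : t / (4 * Th) * dot v v = t * (dot v v / (4 * Th)) by ring.
lra.
Qed.

Variable K : R.
Hypothesis K0 : 0 <= K.
Hypothesis u0K : forall x y, `|u0 x - u0 y| <= K * `|x - y|.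

Lemma lipschitz_data_cont : continuous u0.
Proof.
move=> x; apply/cont_at_eps => e e0.
have K1 : 0 < K + 1 by rewrite ltr_wpDl.
exists (e / (K + 1)) => [|w]; first by rewrite divr_gt0.
rewrite ltr_pdivlMr // => we; apply: (le_lt_trans (u0K _ _)).
rewrite addrAC subrr add0r; apply: le_lt_trans we.
by rewrite mulrC ler_wpM2l // lerDl.
Qed.

Lemma hopf_lax_ge x t v : 0 <= t -> payoff x t v <= hopf_lax (x, t).
Proof.
move=> t0; rewrite /hopf_lax /=; case: xgetP => [w _ ->//|/(_ _) E].
by have [w Hw] := payoff_opt x lipschitz_data_cont t0; case: (E w).
Qed.

Lemma hopf_lax_ex x t : exists v, hopf_lax (x, t) = payoff x t v.
Proof. by eexists. Qed.

Lemma hopf_lax0 x : hopf_lax (x, 0) = u0 x.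
Proof.
by have [v ->] := hopf_lax_ex x 0; rewrite /payoff scale0r addr0 mul0r subr0.
Qed.

(** Dynamic programming: playing [v] during [s] and then optimally is a
    competitor, by convexity of the Lagrangian. *)
Lemma hopf_lax_dpp x t s v : 0 <= s <= t ->
  hopf_lax (x + s *: v, t - s) - s * L v <= hopf_lax (x, t).
Proof.
move=> /andP[s0]; rewrite le_eqVlt => /orP[/eqP st|st].
  rewrite -{}st subrr hopf_lax0; have := hopf_lax_ge x v s0.
  by rewrite /payoff.
have t0 : 0 < t by apply: le_lt_trans st.
have [w ->] := hopf_lax_ex (x + s *: v) (t - s).
pose l := (t - s) / t; have l1 : 1 - l = s / t by rewrite /l; field; rewrite gt_eqF.
have l01 : 0 <= l <= 1.
  rewrite divr_ge0 ?subr_ge0 ?(ltW t0) ?(ltW st) //=.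
  by rewrite ler_pdivrMr // mul1r lerBlDr lerDl.
have := hopf_lax_ge x ((1 - l) *: v + l *: w) (ltW t0); apply: le_trans.
rewrite /payoff scalerDr !scalerA.
have -> : t * (1 - l) = s by rewrite l1 mulrC divfK // gt_eqF.
have -> : t * l = t - s by rewrite /l mulrC divfK // gt_eqF.
have := legendre_convex C2 th0 Th0 Hlo Hhi v w l01; rewrite -(ler_pM2l t0).
have -> : t * ((1 - l) * L v + l * L w) = s * L v + (t - s) * L w.
  by rewrite l1 /l; field; rewrite gt_eqF.
rewrite addrA; lra.
Qed.

Lemma hopf_lax_opt x t : exists v, forall s, 0 <= s <= t ->
  hopf_lax (x, t) <= hopf_lax (x + s *: v, t - s) - s * L v.
Proof.
have [v E] := hopf_lax_ex x t; exists v => s /andP[s0 st]; rewrite E.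
have := @hopf_lax_ge (x + s *: v) (t - s) v; rewrite subr_ge0 => /(_ st).
rewrite /payoff -addrA -scalerDl subrKC; lra.
Qed.

Lemma near_line (z : 'rV[R]_d * R) (P : 'rV[R]_d * R -> Prop) v (a : R) :
  (\forall y \near z, P y) -> exists2 r : R, 0 < r &
    forall h : R, `|h| < r -> P (z.1 + h *: v, z.2 + h * a).
Proof.
move=> /nbhs_ballP[r r0 Hr].
have n1 : 0 < `|v| + `|a| + 1 by rewrite ltr_wpDl // addr_ge0.
exists (r / (`|v| + `|a| + 1)); first by rewrite divr_gt0.
move=> h; rewrite ltr_pdivlMr // => hr; apply: Hr.
rewrite -ball_normE /= [X in X < _]/Num.norm /= gt_max; apply/andP; split.
  rewrite -[(_ - _).1]/(z.1 - (z.1 + h *: v)) opprD addNKr normrN normrZ; apply: le_lt_trans hr.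
  by rewrite ler_wpM2l // -addrA lerDl addr_ge0.
rewrite -[(_ - _).2]/(z.2 - (z.2 + h * a)) opprD addNKr normrN normrM; apply: le_lt_trans hr.
by rewrite ler_wpM2l // addrAC lerDr addr_ge0.
Qed.

Lemma near_derive (phi : 'rV[R]_d * R -> R) (z : 'rV[R]_d * R) v (a e : R) :
  Ck 1 phi -> 0 < e -> exists2 r : R, 0 < r & forall h : R, `|h| < r ->
  `|phi (z.1 + h *: v, z.2 + h * a) - phi z -
    h * (dot (grad (slice phi z.2) z.1) v + a * dt phi z)| <= e * `|h|.
Proof.
move=> Cphi e0.
have /is_derive_epsP /(_ _ e0)[r r0 Hr] := derivableP (Ck_derivable z (v, a) Cphi).
exists r => // h hr; have := Hr h hr; rewrite derive_st //.
Qed.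

(** Dynamic programming over a short time. Fenchel's inequality at the optimal
    velocity gives the subsolution property, and the equality case, at the
    velocity [DH] of the test gradient, the supersolution property. *)
Lemma hopf_lax_viscosity : viscosity_solution H hopf_lax.
Proof.
move=> phi Cphi [x t] /= t0.
set g := grad _ _; set a := dt _ _.
split=> [near_max|near_min].
  have [v Hv] := hopf_lax_opt x t.
  have [r1 r10 H1] := near_line v (-1) near_max.
  apply/ler_addgt0Pr => e e0.
  have [r2 r20 H2] := near_derive (x, t) v (-1) Cphi e0.
  pose s : R := Num.min (t / 2) (Num.min (r1 / 2) (r2 / 2)).
  have s0 : 0 < s by rewrite !lt_min !divr_gt0.
  have st : s <= t by rewrite ge_min; apply/orP; left; lra.
  have sr1 : `|s| < r1 by rewrite gtr0_norm // !gt_min; apply/orP; right; apply/orP; left; lra.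
  have sr2 : `|s| < r2 by rewrite gtr0_norm // !gt_min; apply/orP; right; apply/orP; right; lra.
  have := H1 _ sr1; have := H2 _ sr2; have := Hv s; rewrite st ltW //= -/g -/a.
  rewrite mulrN1 mulN1r (gtr0_norm s0) ler_norml => /(_ isT) h1 /andP[_ h2] h3.
  have := fenchel C2 th0 Th0 Hlo Hhi g v => h4.
  rewrite -(ler_pM2l s0).
  have : s * dot g v <= s * (H g + L v) by rewrite ler_pM2l.
  lra.
have [r1 r10 H1] := near_line (b g) (-1) near_min.
apply/ler_addgt0Pr => e e0.
have [r2 r20 H2] := near_derive (x, t) (b g) (-1) Cphi e0.
pose s : R := Num.min (t / 2) (Num.min (r1 / 2) (r2 / 2)).
have s0 : 0 < s by rewrite !lt_min !divr_gt0.
have st : s <= t by rewrite ge_min; apply/orP; left; lra.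
have sr1 : `|s| < r1 by rewrite gtr0_norm // !gt_min; apply/orP; right; apply/orP; left; lra.
have sr2 : `|s| < r2 by rewrite gtr0_norm // !gt_min; apply/orP; right; apply/orP; right; lra.
have := H1 _ sr1; have := H2 _ sr2; have := @hopf_lax_dpp x t s (b g).
rewrite st ltW //= -/g -/a.
rewrite mulrN1 mulN1r (gtr0_norm s0) ler_norml legendre_grad => /(_ isT) h1 /andP[h2 _] h3.
rewrite -(ler_pM2l s0); lra.
Qed.

(** The growth of the Lagrangian outweighs that of Lipschitz data, which makes
    the solution Lipschitz in time. *)
Lemma norm_sub_legendre v : K * `|v| - L v <= K * `|b 0| + H 0 + K ^+ 2 * Th / 2.
Proof.
have h1 := legendre_grow C2 th0 Th0 Hlo Hhi v.
have h2 : K * `|v| <= K * (`|v - b 0| + `|b 0|).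
  by rewrite ler_wpM2l // -{1}(subrK (b 0) v) ler_normD.
have h3 : K * `|v - b 0| <= K ^+ 2 * Th / 2 + dot (v - b 0) (v - b 0) / (2 * Th).
  set n := `|v - b 0|.
  apply: (@le_trans _ _ (K ^+ 2 * Th / 2 + n ^+ 2 / (2 * Th))).
    have := sqr_ge0 (K * Th - n) => h; rewrite -(ler_pM2l Th0).
    have -> : Th * (K ^+ 2 * Th / 2 + n ^+ 2 / (2 * Th)) =
       (K ^+ 2 * Th ^+ 2 + n ^+ 2) / 2 by field; rewrite gt_eqF.
    lra.
  rewrite lerD2l ler_wpM2r ?norm_sqr_le_dot // invr_ge0 mulr_ge0 // ltW //.
lra.
Qed.

Lemma hopf_lax_lip : exists C : R, 0 <= C /\ forall x y s t, 0 <= s -> 0 <= t ->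
  `|hopf_lax (x, t) - hopf_lax (y, s)| <= K * `|x - y| + C * `|t - s|.
Proof.
pose C := K * `|b 0| + `|H 0| + K ^+ 2 * Th / 2.
have KTh : 0 <= K ^+ 2 * Th / 2 by rewrite divr_ge0 // mulr_ge0 ?sqr_ge0 // ltW.
have Kb : 0 <= K * `|b 0| by rewrite mulr_ge0.
exists C; split; first by rewrite !addr_ge0.
have lipx x y t : 0 <= t -> hopf_lax (x, t) <= hopf_lax (y, t) + K * `|x - y|.
  move=> t0; have [v ->] := hopf_lax_ex x t; have := hopf_lax_ge y v t0.
  rewrite /payoff; have := u0K (x + t *: v) (y + t *: v).
  rewrite opprD addrACA subrr addr0 ler_norml => /andP[_]; lra.
have lipt x s t : 0 <= s -> s <= t -> hopf_lax (x, t) <= hopf_lax (x, s) + C * (t - s)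
    /\ hopf_lax (x, s) <= hopf_lax (x, t) + C * (t - s).
  move=> s0 st; have t0 := le_trans s0 st; have ts : 0 <= t - s by rewrite subr_ge0.
  split.
    have [v ->] := hopf_lax_ex x t; have := hopf_lax_ge x v s0; rewrite /payoff.
    have := u0K (x + t *: v) (x + s *: v).
    rewrite opprD addrACA subrr add0r -scalerBl normrZ (ger0_norm ts).
    rewrite ler_norml => /andP[_ h1] h2.
    have h3 : (t - s) * (K * `|v| - L v) <= (t - s) * C.
      rewrite ler_wpM2l //; apply: (le_trans (norm_sub_legendre v)).
      have := ler_norm (H 0); rewrite /C; lra.
    lra.
  have := @hopf_lax_dpp x t (t - s) (b 0); rewrite ts lerBlDr lerDl s0 subKr.
  move=> /(_ isT); have := lipx x (x + (t - s) *: b 0) s s0.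
  rewrite opprD addNKr normrN normrZ (ger0_norm ts) legendre_grad dot0l => h1 h2.
  have h3 : (t - s) * (K * `|b 0| - H 0) <= (t - s) * C.
    by rewrite ler_wpM2l //; have := ler_norm (- H 0); rewrite normrN /C; lra.
  lra.
have main x y s t : 0 <= s -> s <= t ->
   `|hopf_lax (x, t) - hopf_lax (y, s)| <= K * `|x - y| + C * (t - s).
  move=> s0 st; have [h1 h2] := lipt x s t s0 st.
  have h3 := lipx x y s s0; have := lipx y x s s0; rewrite distrC => h4.
  by rewrite ler_norml; apply/andP; split; lra.
move=> x y s t s0 t0; have [st|ts] := leP s t.
  by rewrite (@ger0_norm _ (t - s)) ?subr_ge0 // main.
by rewrite distrC (distrC x) (distrC t) (@gtr0_norm _ (s - t)) ?subr_gt0 // main // ltW.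
Qed.

Lemma hopf_lax_buc : buc_spacetime hopf_lax.
Proof.
move=> T T0; have [C [C0 HC]] := hopf_lax_lip; split.
  exists (M + C * T) => -[x t] /= /andP[t0 tT].
  have := HC x x 0 t (lexx _) t0; rewrite hopf_lax0 subrr normr0 mulr0 add0r subr0.
  rewrite (ger0_norm t0) => h; have := ler_normD (hopf_lax (x, t) - u0 x) (u0 x).
  rewrite subrK => /le_trans; apply; rewrite addrC lerD //.
  by apply: (le_trans h); rewrite ler_wpM2l.
move=> e e0; have KC : 0 < K + C + 1 by rewrite ltr_wpDl // addr_ge0.
exists (e / (K + C + 1)); first by rewrite divr_gt0.
move=> [x t] [y s] /= /andP[t0 _] /andP[s0 _]; rewrite ltr_pdivlMr // => xy.
apply: (le_lt_trans (HC _ _ _ _ s0 t0)); apply: le_lt_trans xy.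
have h1 : `|x - y| <= `|(x, t) - (y, s)| := fst_norm_le ((x, t) - (y, s)).
have h2 : `|t - s| <= `|(x, t) - (y, s)| := snd_norm_le ((x, t) - (y, s)).
have h3 := ler_wpM2l K0 h1; have h4 := ler_wpM2l C0 h2.
have := le_trans (normr_ge0 _) h1; lra.
Qed.

End HopfLax.

(** * Square roots of positive definite matrices *)

Section SquareRoot.
Context {R : realType}.

Lemma interpolation (F : fieldType) (s : seq F) (g : F -> F) :
  exists p : {poly F}, forall x, x \in s -> p.[x] = g x.
Proof.
elim: s => [|a s [p Hp]]; first by exists 0.
have [ain|anin] := boolP (a \in s).
  by exists p => x; rewrite inE => /orP[/eqP->|]; exact: Hp.
pose m := \prod_(y <- s) ('X - y%:P).
exists (p + ((g a - p.[a]) / m.[a])%:P * m) => x; rewrite inE !hornerE.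
have ma : m.[a] != 0.
  rewrite -[_ == 0]/(root m a) /m root_prod_XsubC; exact: anin.
move=> /orP[/eqP->|xs]; first by rewrite divfK // subrKC.
have /eqP -> : m.[x] == 0 by rewrite -[_ == 0]/(root m x) /m root_prod_XsubC.
by rewrite mulr0 addr0 Hp.
Qed.

Lemma horner_mx_tr n (A : 'M[R]_n.+1) p : A^T = A ->
  (horner_mx A p)^T = horner_mx A p.
Proof.
move=> sA; elim/poly_ind: p => [|p c IH].
  by rewrite rmorph0 trmx0.
rewrite rmorphD rmorphM /= horner_mx_X horner_mx_C linearD /= tr_scalar_mx.
congr (_ + _); rewrite -[_ * A]/(_ *m A) trmx_mul sA IH.
by apply: comm_mx_horner; exact: comm_mx_refl.
Qed.

Lemma posdef_eigenvalue_gt0 n (A : 'M[R]_n) a : posdef A -> eigenvalue A a -> 0 < a.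
Proof.
move=> pA /eigenvalueP[v vA v0]; have := pA v v0; rewrite vA dotZl.
by rewrite pmulr_lgt0 // dot_gt0.
Qed.

(** Over the complex numbers [A] is unitarily diagonal with positive real
    spectrum; a real polynomial [r] interpolating the fourth root on that
    spectrum gives the symmetric root [r(A)^2], positive because it is a
    square of an invertible symmetric matrix. *)
Lemma posdef_sqrt_succ n (A : 'M[R]_n.+1) : A^T = A -> posdef A ->
  exists B, [/\ B^T = B, posdef B & B *m B = A].
Proof.
move=> sA pA; pose f := @real_complex_def R (Phant R).
pose A' := map_mx f A.
have A's : A'^T = A' by apply/matrixP => i j; rewrite !mxE -{1}sA mxE.
have Ah : A' \is hermsymmx.
  apply: realsym_hermsym.
    by apply/is_hermitianmxP; rewrite expr0 scale1r map_mx_id // A's.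
  apply/mxOverP => i j; rewrite mxE; by rewrite complex_real.
have [P [sp [Pu spreal AE]]] : exists (P : 'M[R[i]]_n.+1) (sp : 'rV[R[i]]_n.+1), [/\ P \in unitmx,
    forall i, sp 0 i \is Num.real & A' = invmx P *m diag_mx sp *m P].
  exists (spectralmx A'), (spectral_diag A'); split.
  - exact: spectral_unit.
  - by move=> i; have /mxOverP := hermitian_spectral_diag_real Ah.
  exact: orthomx_spectralP (hermitian_normalmx Ah).
have spR i : exists2 a : R, f a = sp 0 i & 0 < a.
  have /RRe_real spE := spreal i; exists (complex.Re (sp 0 i)) => //.
  apply: (@posdef_eigenvalue_gt0 _ A) => //; rewrite -(eigenvalue_map f).
  apply/eigenvalueP; exists (row i P).
    rewrite -/A' {1}AE -row_mul !mulmxA mulmxV // mul1mx row_mul.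
    by rewrite row_diag_mx -scalemxAl -rowE -spE.
  by apply/negP => /eqP r0; have := Pu; rewrite -row_free_unit => /row_freeP[Q PQ];
    have := congr1 (row i) PQ; rewrite row_mul r0 mul0mx => /rowP /(_ i) /eqP;
    rewrite !mxE eqxx eq_sym oner_eq0.
pose s := [seq complex.Re (sp 0 i) | i : 'I_n.+1].
have [r Hr] := interpolation s (fun a => Num.sqrt (Num.sqrt a)).
pose S := horner_mx A r.
have S4 : S ^+ 4 = A.
  rewrite /S -rmorphXn /=; apply: (map_mx_inj (f := f)).
  rewrite map_horner_mx -/A' {1}AE.
  have rE i : (map_poly f (r ^+ 4)).[sp 0 i] = sp 0 i.
    have [a fa a0] := spR i; rewrite -fa horner_map horner_exp /= Hr.
      by rewrite -[4%N]/(2 * 2)%N exprM !sqr_sqrtr ?sqrtr_ge0 ?ltW.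
    by apply/mapP; exists i; rewrite ?mem_enum // -fa.
  rewrite horner_mx_uconjC // horner_mx_diag [RHS]AE; congr (_ *m _ *m _).
  by congr diag_mx; apply/rowP => i; rewrite mxE rE.
have sS : S^T = S by exact: horner_mx_tr.
exists (S *m S); split.
- by rewrite trmx_mul sS.
- move=> x x0; rewrite mulmxA dot_mulmx sS dot_gt0; apply/negP => /eqP xS.
  have := pA x x0; rewrite -S4 !exprS expr0 mulr1 -[S * _]/(S *m _) mulmxA xS mul0mx.
  by rewrite dot0l ltxx.
by rewrite -[RHS]S4 -[4%N]/(2 + 2)%N exprD expr2.
Qed.

Lemma posdef_sqrt d (A : 'M[R]_d) : A^T = A -> posdef A ->
  exists B, [/\ B^T = B, posdef B & B *m B = A].
Proof.
case: d A => [|n] A; last exact: posdef_sqrt_succ.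
move=> _ _; exists 0; split; first by rewrite trmx0.
  by move=> x; rewrite [x]thinmx0 eqxx.
by rewrite [A]thinmx0 mulmx0.
Qed.

End SquareRoot.

(** * The matrix inequalities as bounds on second derivatives *)

Section ViscosityBounds.
Context {R : realType} {d : nat}.
Variables (H : 'rV[R]_d -> R) (th Th : R).
Hypotheses (C2 : Ck 2 H) (th0 : 0 < th) (Th0 : 0 < Th).
Hypothesis Hlo : forall p v, th * dot v v <= hform H p v v.
Hypothesis Hhi : forall p v, hform H p v v <= Th * dot v v.
Implicit Types (p q v w x y z h : 'rV[R]_d).

Local Notation b := (grad H).
Local Notation L := (legendre C2 th0 Th0 Hlo Hhi).

Lemma sqrt_hessP p : let F := sqrtmx (hess H p) in
  [/\ F^T = F, posdef F & F *m F = hess H p].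
Proof.
move=> F; rewrite /F /sqrtmx; case: xgetP => [B _ [HB1 HB2 HB3]//|E].
have [B HB] : exists B, [/\ B^T = B, posdef B & B *m B = hess H p].
  apply: posdef_sqrt; first exact: hess_sym.
  move=> x x0; rewrite -hformE; apply: lt_le_trans (Hlo p x).
  by rewrite mulr_gt0 // dot_gt0.
by case: (E B).
Qed.

Lemma posdef_unit (A : 'M[R]_d) : posdef A -> A \in unitmx.
Proof.
move=> pA; rewrite -row_free_unit -kermx_eq0; apply/eqP/row_matrixP => i.
rewrite row0; set k := row i _; have kA : k *m A = 0.
  by apply/sub_kermxP; exact: row_sub.
by apply/eqP/negPn/negP => /pA; rewrite kA dot0l ltxx.
Qed.

(** The substitution [h = z F] removes the square root: the inequality compares
    the second derivatives of [phi] with the inverse Hessian of [H]. *)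
Lemma mxle_FD2F (phi : 'rV[R]_d -> R) x (c : R) :
  mxle (- c)%:M (FD2F H phi x) <->
  forall h, hform phi x h h <= c * nform H (grad phi x) h h.
Proof.
rewrite /mxle /FD2F; set F := sqrtmx _; set p := grad phi x.
have [sF pF FF] := sqrt_hessP p; rewrite -/F in sF pF FF.
have uF := posdef_unit pF.
have FE z : dot (z *m - (F *m hess phi x *m F)) z = - hform phi x (z *m F) (z *m F).
  rewrite hformE mulmxN dotNl !mulmxA; congr (- _).
  by rewrite [LHS]dot_mulmx sF.
have NE z : nform H p (z *m F) (z *m F) = dot z z.
  have kE : z *m F = z *m invmx F *m hess H p by rewrite -FF !mulmxA mulmxKV.
  rewrite {1}kE (nform_hess th0 Hlo) -{2}sF -dot_mulmx mulmxKV //.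
split=> Hx.
  move=> h; have := Hx (h *m invmx F); rewrite FE mul_mx_scalar dotZl mulmxKV //.
  by rewrite -NE mulmxKV // mulNr lerN2.
move=> z; rewrite FE mul_mx_scalar dotZl -NE mulNr lerN2; exact: Hx.
Qed.

(** A quadratic function lowered away from [x0] by a quartic term, which does
    not change its first two derivatives there. *)
Definition qtest (c : R) (g : 'rV[R]_d) (B : 'M[R]_d) (K : R) x0 x : R :=
  c + dot g (x - x0) + dot ((x - x0) *m B) (x - x0) / 2
  - K * dot (x - x0) (x - x0) ^+ 2.

Lemma qtest_smooth c g B K x0 : smooth (qtest c g B K x0).
Proof.
move=> k; apply: Ck_sub.
  apply: Ck_add; first by apply: Ck_add; [exact: Ck_cst|apply: Ck_dot => i; [exact: Ck_cst|exact: Ck_coord]].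
  by apply: Ck_mul; [apply: Ck_form => i; exact: Ck_coord|exact: Ck_cst].
apply: Ck_mul; first exact: Ck_cst.
by apply: Ck_exp; apply: Ck_dot => i; exact: Ck_coord.
Qed.

Lemma qtest_derivatives c g B K x0 : grad (qtest c g B K x0) x0 = g /\
  forall v, hform (qtest c g B K x0) x0 v v = dot (v *m B) v.
Proof.
have [|] := @grad_hess_expansion _ _ (qtest c g B K x0) x0 g
   (fun v => dot (v *m B) v) (qtest_smooth _ _ _ _ _ 2).
  move=> v; exists (`|K| * dot v v ^+ 2) => h h1; rewrite /qtest.
  have -> : x0 + h *: v - x0 = h *: v by rewrite addrAC subrr add0r.
  rewrite subrr mul0mx !dot0l dot0r.
  rewrite -scalemxAl !dotZl !dotZr.
  set D := _ - _; have -> : D = - (h ^+ 4 * (K * dot v v ^+ 2)) by rewrite /D; ring.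
  rewrite normrN normrM normrX (normrM K) (ger0_norm (sqr_ge0 (dot v v))) mulrC.
  by rewrite ler_wpM2l ?mulr_ge0 ?dot_ge0 // ler_wiXn2l.
by move=> -> E; split=> // v; rewrite hformE E.
Qed.

(** As [v] is bounded, [qtest] with a large quartic coefficient turns a local
    contact into a global one. *)
Lemma visc_ge_quadratic (v : 'rV[R]_d -> R) (c M r : R) x0 g (B : 'M[R]_d) :
  visc_FD2F_ge H v (- c) -> (forall x, `|v x| <= M) -> 0 < r ->
  (forall w, `|w| < r ->
     v x0 + dot g w + dot (w *m B) w / 2 <= v (x0 + w)) ->
  forall h, dot (h *m B) h <= c * nform H g h h.
Proof.
move=> Hv vM r0 Hr h.
have [C0 [C00 HC0]] : exists C0 : R, 0 <= C0 /\ forall w,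
    v x0 + dot g w + dot (w *m B) w / 2 <= C0 * (1 + dot w w).
  pose e := \big[Num.max/0]_(ij : 'I_d * 'I_d) `|B ij.1 ij.2|.
  have e0 : 0 <= e by exact: bigmax_ge_id.
  have Be i j : `|B i j| <= e by exact: (le_bigmax _ _ (i, j)).
  have M0 : 0 <= M by apply: le_trans (vM x0).
  exists (M + (1 + dot g g) + d%:R ^+ 2 * e); split.
    by rewrite !addr_ge0 ?dot_ge0 // mulr_ge0 // exprn_ge0.
  move=> w; have h1 : v x0 <= M by apply: le_trans (vM x0); exact: ler_norm.
  have := form_le_entries w e0 Be; rewrite ler_norml => /andP[_ h2].
  have := young g w ltr01; have g0 := dot_ge0 g; have w0 := dot_ge0 w.
  have : 0 <= d%:R ^+ 2 * e * dot w w by rewrite mulr_ge0 // mulr_ge0 // exprn_ge0.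
  have := mulr_ge0 M0 w0; have := mulr_ge0 g0 w0.
  have : 0 <= d%:R ^+ 2 * e by rewrite mulr_ge0 // exprn_ge0.
  move: (d%:R ^+ 2 * e) h2 => E h2; lra.
pose s0 := r ^+ 2; have s00 : 0 < s0 by rewrite exprn_gt0.
have M0 : 0 <= M by apply: le_trans (vM x0).
pose K := (C0 + M) / s0 ^+ 2 + C0 / s0.
have K0 : 0 <= K by rewrite addr_ge0 // divr_ge0 ?addr_ge0 // ?exprn_ge0 // ltW.
have [gE hE] := qtest_derivatives (v x0) g B K x0.
have touch x : v x0 - qtest (v x0) g B K x0 x0 <= v x - qtest (v x0) g B K x0 x.
  rewrite {1}/qtest subrr mul0mx !dot0l dot0r /qtest.
  have [w ->] : exists w, x = x0 + w by exists (x - x0); rewrite subrKC.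
  have -> : x0 + w - x0 = w by rewrite addrAC subrr add0r.
  have q0 : 0 <= dot w w ^+ 2 by rewrite sqr_ge0.
  have [wr|wr] := ltP `|w| r.
    have := Hr w wr; have := mulr_ge0 K0 q0; lra.
  have sw : s0 <= dot w w.
    by apply: le_trans (norm_sqr_le_dot w); rewrite ler_sqr ?nnegrE // ltW.
  have := HC0 w; have := vM (x0 + w); rewrite ler_norml => /andP[h1 _].
  have h2 : (C0 + M) <= (C0 + M) / s0 ^+ 2 * dot w w ^+ 2.
    rewrite mulrAC ler_pdivlMr ?exprn_gt0 // ler_wpM2l ?addr_ge0 //.
    by rewrite ler_sqr ?nnegrE ?dot_ge0 // (ltW s00).
  have h3 : C0 * dot w w <= C0 / s0 * dot w w ^+ 2.
    rewrite mulrAC ler_pdivlMr // -mulrA ler_wpM2l // expr2 ler_wpM2l //.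
    exact: dot_ge0.
  rewrite /K mulrDl; lra.
have /mxle_FD2F := Hv _ (qtest_smooth (v x0) g B K x0) x0 touch.
by move=> /(_ h); rewrite gE hE.
Qed.

Lemma visc_ge_min (v1 v2 : 'rV[R]_d -> R) (c : R) :
  visc_FD2F_ge H v1 c -> visc_FD2F_ge H v2 c ->
  visc_FD2F_ge H (fun x => Num.min (v1 x) (v2 x)) c.
Proof.
move=> H1 H2 phi sphi x0 Hx; have [h|/ltW h] := leP (v1 x0) (v2 x0).
  apply: H1 => // x; have := Hx x; rewrite (min_idPl h) => /le_trans; apply.
  by rewrite lerD2r ge_min lexx.
apply: H2 => // x; have := Hx x; rewrite (min_idPr h) => /le_trans; apply.
by rewrite lerD2r ge_min lexx orbT.
Qed.

Lemma touching_upper (phi : 'rV[R]_d -> R) x0 g (n : 'rV[R]_d -> R) :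
  Ck 2 phi -> (forall v (e : R), 0 < e -> exists2 r : R, 0 < r & forall h : R, `|h| < r ->
    phi (x0 + h *: v) <= phi x0 + h * dot g v + h ^+ 2 / 2 * n v + e * h ^+ 2) ->
  grad phi x0 = g /\ forall v, hform phi x0 v v <= n v.
Proof.
move=> Cphi Hphi; have D v := derive2_upper Cphi (Hphi v).
have gE : grad phi x0 = g.
  by apply: dot_inj => v; rewrite -derive_grad; [case: (D v)|exact: CkW].
by split=> // v; rewrite -derive_hess //; case: (D v).
Qed.

Lemma visc_ge_cst (a c : R) : 0 <= c -> visc_FD2F_ge H (fun _ => a) (- c).
Proof.
move=> c0 phi sphi x0 Hx; apply/mxle_FD2F => h.
have [|gE hE] := @touching_upper phi x0 0 (fun _ => 0) (sphi 2).
  move=> v e e0; exists 1 => // k _; have := Hx (x0 + k *: v).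
  rewrite dot0l !mulr0 !addr0; have := mulr_ge0 (ltW e0) (sqr_ge0 k); lra.
by apply: (le_trans (hE h)); rewrite mulr_ge0 // (nform_ge0 th0 Hlo).
Qed.

(** The Lagrangian saturates the bound: [D^2 L (DH(p))] is the inverse of
    [D^2 H(p)]. *)
Lemma visc_ge_legendre (a : 'rV[R]_d) (k : R) :
  visc_FD2F_ge H (fun x => L (x + a) + k) (- 1).
Proof.
move=> phi sphi x0 Hx; apply/mxle_FD2F => h; rewrite mul1r.
pose q := slope C2 th0 Th0 Hlo Hhi (x0 + a).
have qE : b q = x0 + a by exact: grad_slope.
have [|gE hE] := @touching_upper phi x0 q (fun v => nform H q v v) (sphi 2); last first.
  by rewrite gE; exact: hE.
move=> v e e0; have v1 : 0 < dot v v + 1 by rewrite ltr_wpDl // dot_ge0.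
have [r r0 Hr] := legendre_taylor2 C2 th0 Th0 Hlo Hhi q (divr_gt0 e0 v1).
have nv : 0 < `|v| + 1 by rewrite ltr_wpDl.
exists (r / (`|v| + 1)) => [|s]; first by rewrite divr_gt0.
rewrite ltr_pdivlMr // => sr.
have sv : `|s *: v| < r.
  by rewrite normrZ; apply: le_lt_trans sr; rewrite ler_wpM2l // lerDl.
have := Hr _ sv; have := Hx (x0 + s *: v).
rewrite (addrAC x0 _ a) qE ler_norml !nformZl !nformZr !dotZl !dotZr => h1 /andP[_ h2].
have h3 : e / (dot v v + 1) * (s * (s * dot v v)) <= e * s ^+ 2.
  have -> : e / (dot v v + 1) * (s * (s * dot v v)) =
    e * s ^+ 2 * (dot v v / (dot v v + 1)) by field; rewrite gt_eqF.
  rewrite ler_piMr ?(mulr_ge0 (ltW e0) (sqr_ge0 s)) //.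
  by rewrite ler_pdivrMr // mul1r lerDl.
rewrite expr2 in h3 *; lra.
Qed.

End ViscosityBounds.

(** * Functions negligible with respect to the squared norm *)

Section LittleO.
Context {R : realType} {d : nat}.
Implicit Types (f g : 'rV[R]_d -> R) (w : 'rV[R]_d).

Definition osq f := forall e : R, 0 < e -> exists2 r : R, 0 < r &
  forall w, `|w| < r -> `|f w| <= e * dot w w.

Lemma osq_add f g : osq f -> osq g -> osq (fun w => f w + g w).
Proof.
move=> of_ og e e0; have e2 : 0 < e / 2 by rewrite divr_gt0.
have [r1 r10 H1] := of_ _ e2; have [r2 r20 H2] := og _ e2.
exists (Num.min r1 r2); first by rewrite lt_min r10 r20.
move=> w; rewrite lt_min => /andP[w1 w2]; apply: (le_trans (ler_normD _ _)).
have := H1 w w1; have := H2 w w2; lra.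
Qed.

Lemma osq_scale f (c : R) : osq f -> osq (fun w => c * f w).
Proof.
move=> of_ e e0; have c1 : 0 < `|c| + 1 by rewrite ltr_wpDl.
have [r r0 Hr] := of_ _ (divr_gt0 e0 c1); exists r => // w /Hr h.
rewrite normrM; apply: (le_trans (ler_wpM2l (normr_ge0 c) h)).
rewrite mulrA ler_wpM2r ?dot_ge0 // mulrA ler_pdivrMr //.
by rewrite mulrC ler_wpM2l ?(ltW e0) // lerDl.
Qed.

Lemma osq_comp f (y : 'rV[R]_d -> 'rV[R]_d) (C : R) : osq f -> 0 <= C ->
  (forall w, `|w| < 1 -> dot (y w) (y w) <= C * dot w w) -> osq (fun w => f (y w)).
Proof.
move=> of_ C0 Hy e e0; have C1 : 0 < C + 1 by rewrite ltr_wpDl.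
have [r r0 Hr] := of_ _ (divr_gt0 e0 C1).
have [r' r'0 Hr'] := @dot_small R d (r ^+ 2 / (C + 1)) (divr_gt0 (exprn_gt0 2 r0) C1).
exists (Num.min 1 r'); first by rewrite lt_min ltr01.
move=> w; rewrite lt_min => /andP[w1 /Hr' w2].
have yw := Hy w w1; rewrite ltr_pdivlMr // in w2.
have w0 := dot_ge0 w; have yr : `|y w| < r.
  by apply: norm_lt_dot => //; apply: (le_lt_trans yw); lra.
apply: (le_trans (Hr _ yr)); rewrite mulrAC ler_pdivrMr // -mulrA ler_wpM2l ?(ltW e0) //.
by apply: (le_trans yw); lra.
Qed.

Lemma osq_cubic f (C : R) : 0 <= C ->
  (forall w, `|w| < 1 -> `|f w| <= C * (`|w| * dot w w)) -> osq f.
Proof.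
move=> C0 Hf e e0; have C1 : 0 < C + 1 by rewrite ltr_wpDl.
exists (Num.min 1 (e / (C + 1))); first by rewrite lt_min ltr01 divr_gt0.
move=> w; rewrite lt_min ltr_pdivlMr // => /andP[/Hf w1 w2].
apply: (le_trans w1); rewrite mulrA ler_wpM2r ?dot_ge0 //.
apply: (le_trans _ (ltW w2)); have := normr_ge0 w; lra.
Qed.

Lemma osq_cube (a c : 'rV[R]_d) : osq (fun w => dot w a ^+ 2 * dot w c).
Proof.
apply: (@osq_cubic _ (dot a a * (d%:R * `|c|))) => [|w _].
  by rewrite !mulr_ge0 ?dot_ge0.
rewrite normrM [`|_ ^+ 2|]ger0_norm ?sqr_ge0 //.
have -> : dot a a * (d%:R * `|c|) * (`|w| * dot w w) =
   (dot w w * dot a a) * (d%:R * (`|w| * `|c|)) by ring.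
by rewrite ler_pM ?sqr_ge0 // ?sqr_dot_le // dot_le_norm.
Qed.

Lemma osq_quartic (a : 'rV[R]_d) : osq (fun w => dot w a ^+ 2 * dot w a ^+ 2).
Proof.
apply: (@osq_cubic _ (dot a a ^+ 2 * d%:R)) => [|w w1].
  by rewrite mulr_ge0 ?sqr_ge0.
rewrite ger0_norm ?(mulr_ge0 (sqr_ge0 _) (sqr_ge0 _)) //.
have h1 := sqr_dot_le w a; have h2 : dot w w <= d%:R * `|w|.
  apply: (le_trans (dot_le_sqr_norm w)); rewrite ler_wpM2l // expr2.
  by rewrite ler_piMl // ltW.
apply: (@le_trans _ _ ((dot w w * dot a a) * (dot w w * dot a a))).
  by rewrite ler_pM ?sqr_ge0.
have -> : dot w w * dot a a * (dot w w * dot a a) =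
  dot a a ^+ 2 * dot w w * dot w w by ring.
have -> : dot a a ^+ 2 * d%:R * (`|w| * dot w w) =
  dot a a ^+ 2 * (d%:R * `|w|) * dot w w by ring.
by rewrite ler_wpM2r ?dot_ge0 // ler_wpM2l ?sqr_ge0.
Qed.

End LittleO.

(** * Rarefaction of a concave corner *)

Section Corner.
Context {R : realType} {d : nat}.
Variables (H : 'rV[R]_d -> R) (th Th : R).
Hypotheses (C2 : Ck 2 H) (th0 : 0 < th) (Th0 : 0 < Th).
Hypothesis Hlo : forall p v, th * dot v v <= hform H p v v.
Hypothesis Hhi : forall p v, hform H p v v <= Th * dot v v.
Implicit Types (p q v w x y z h xi : 'rV[R]_d).

Local Notation b := (grad H).
Local Notation L := (legendre C2 th0 Th0 Hlo Hhi).
Local Notation hl := (hopf_lax C2 th0 Th0 Hlo Hhi).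

Lemma slope_bound w :
  dot (slope C2 th0 Th0 Hlo Hhi w) (slope C2 th0 Th0 Hlo Hhi w)
    <= dot (w - b 0) (w - b 0) / th ^+ 2.
Proof.
set q := slope _ _ _ _ _ _; have bq : b q = w by exact: grad_slope.
have h1 := H_lower C2 Hlo 0 q; rewrite add0r in h1.
have := H_lower C2 Hlo q (- q); rewrite subrr bq !dotNr dotNl opprK => h2; have := young q (w - b 0) th0.
rewrite dotBr (dotC q w) (dotC q (b 0)) => h3.
have : th * dot q q <= dot (w - b 0) (w - b 0) / th.
  have -> : dot (w - b 0) (w - b 0) / th = 2 * (dot (w - b 0) (w - b 0) / (2 * th)).
    by field; rewrite gt_eqF.
  lra.
by rewrite mulrC -ler_pdivlMr // => /le_trans; apply; rewrite expr2 invfM mulrA.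
Qed.

(** Below the cap the growth of [L] bounds the argument, hence the slope. *)
Lemma legendre_cap_lip (k : R) : exists K : R, 0 <= K /\ forall v w,
  `|Num.min (L v) k - Num.min (L w) k| <= K * `|v - w|.
Proof.
pose rho := 2 * Th * (k + H 0); pose Q : R := 1 + `|rho| / th ^+ 2.
have Q1 : 1 <= Q by rewrite lerDl divr_ge0 // exprn_ge0 // ltW.
have Q0 : 0 <= Q by apply: le_trans Q1.
have d0 : 0 <= d%:R / (2 * th) by rewrite divr_ge0 // mulr_ge0 // ltW.
pose K := d%:R * Q + d%:R / (2 * th) + `|k + H 0|.
have dQ : 0 <= d%:R * Q by rewrite mulr_ge0.
have K0 : 0 <= K by rewrite !addr_ge0.
suff one v w : Num.min (L v) k <= Num.min (L w) k + K * `|v - w|.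
  exists K; split=> // v w; rewrite ler_norml; apply/andP.
  by have := one v w; have := one w v; rewrite (distrC w) => *; split; lra.
have Kvw : 0 <= K * `|v - w| by rewrite mulr_ge0.
have [wk|wk] := leP k (L w).
  by rewrite ge_min [k <= _]lerDl Kvw orbT.
have [vw1|vw1] := leP 1 `|v - w|.
  rewrite ge_min; apply/orP; right.
  have h1 := legendre_ge C2 th0 Th0 Hlo Hhi w.
  have h2 : `|k + H 0| <= K * `|v - w|.
    apply: (@le_trans _ _ K); first by rewrite /K lerDr addr_ge0.
    by rewrite ler_peMr.
  have := ler_norm (k + H 0); lra.
rewrite ge_min; apply/orP; left.
pose q := slope C2 th0 Th0 Hlo Hhi w.
have bq : b q = w by exact: grad_slope.
have h1 := legendre_upper C2 th0 Th0 Hlo Hhi q (v - w).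
rewrite bq subrKC in h1.
have h2 := legendre_grow C2 th0 Th0 Hlo Hhi w.
have h3 : dot (w - b 0) (w - b 0) <= rho.
  have : dot (w - b 0) (w - b 0) / (2 * Th) <= k + H 0 by lra.
  by rewrite ler_pdivrMr ?mulr_gt0 // mulrC.
have h4 : `|q| <= Q.
  have : `|q| ^+ 2 <= Q.
    apply: (le_trans (norm_sqr_le_dot q)); apply: (le_trans (slope_bound w)).
    rewrite /Q; apply: (@le_trans _ _ (`|rho| / th ^+ 2)); last by rewrite lerDr.
    rewrite ler_wpM2r ?invr_ge0 ?exprn_ge0 ?(ltW th0) //.
    exact: le_trans h3 (ler_norm _).
  have [q1|q1] := leP `|q| 1; first by rewrite (le_trans q1).
  by apply: le_trans; rewrite expr2 ler_peMr // ltW.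
have n0 := normr_ge0 (v - w).
have h5 : dot q (v - w) <= d%:R * Q * `|v - w|.
  apply: (le_trans (ler_norm _)); apply: (le_trans (dot_le_norm _ _)).
  by rewrite -mulrA ler_wpM2l // ler_wpM2r.
have h6 : dot (v - w) (v - w) / (2 * th) <= d%:R / (2 * th) * `|v - w|.
  rewrite mulrAC ler_wpM2r ?invr_ge0 ?mulr_ge0 ?(ltW th0) //.
  apply: (le_trans (dot_le_sqr_norm _)); rewrite ler_wpM2l // expr2 ler_piMl //.
  exact: ltW.
have h7 : 0 <= `|k + H 0| * `|v - w| by rewrite mulr_ge0.
rewrite /K; lra.
Qed.

(** The profile [L(. + b) - L(b)], capped at height 1: it saturates the
    second order bound and vanishes at the origin with slope [p] there, where
    [b = DH(p)]. *)
Definition cap p y : R := Num.min (L (y + b p)) (L (b p) + 1) - L (b p).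

Lemma cap_le p y : cap p y <= L (y + b p) - L (b p).
Proof. by rewrite /cap lerD2r ge_min lexx. Qed.

Lemma cap_lip p : exists K : R, 0 <= K /\ forall x y, `|cap p x - cap p y| <= K * `|x - y|.
Proof.
have [K [K0 HK]] := legendre_cap_lip (L (b p) + 1); exists K; split=> // x y.
have := HK (x + b p) (y + b p); rewrite /cap.
have -> : x + b p - (y + b p) = x - y by rewrite opprD addrACA subrr addr0.
move: (Num.min _ _) (Num.min (L (y + _)) _) => A B.
by have -> : A - L (b p) - (B - L (b p)) = A - B by ring.
Qed.

Lemma cap_bounded p : exists M : R, forall y, `|cap p y| <= M.
Proof.
exists (1 + `|H 0 + L (b p)|) => y; rewrite /cap.
have h1 := legendre_ge C2 th0 Th0 Hlo Hhi (y + b p).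
have h2 := legendre_ge C2 th0 Th0 Hlo Hhi (b p).
have h3 := ler_norm (H 0 + L (b p)); have h4 := normr_ge0 (H 0 + L (b p)).
rewrite ler_norml; apply/andP; split.
  rewrite lerBrDr le_min; apply/andP; split; lra.
by rewrite lerBlDr ge_min; apply/orP; right; lra.
Qed.

Lemma cap_visc p : visc_FD2F_ge H (cap p) (- 1).
Proof.
have -> : cap p = (fun y => Num.min (L (y + b p) + - L (b p)) 1).
  apply/funext => y; rewrite /cap; move: (L (y + b p)) (L (b p)) => A B.
  have [h|h] := leP A (B + 1); have [k|k] := leP (A + - B) 1; lra.
apply: visc_ge_min; first exact: visc_ge_legendre.
by apply: (@visc_ge_cst _ _ H th C2 th0 Hlo 1 1).
Qed.

Variables (p0 xi h : 'rV[R]_d) (l : R).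
Hypotheses (l01 : 0 <= l <= 1) (xi0 : xi != 0) (h0 : h != 0) (xih : dot xi h = 0).

Local Notation p1 := (p0 + xi).
Local Notation pl := (p0 + l *: xi).

Definition corner y : R := Num.min (cap p0 y) (cap p1 y).

Lemma corner_visc : visc_FD2F_ge H corner (- 1).
Proof. by apply: visc_ge_min; exact: cap_visc. Qed.

Lemma corner_bounded : exists M : R, forall y, `|corner y| <= M.
Proof.
have [M1 H1] := cap_bounded p0; have [M2 H2] := cap_bounded p1.
exists (`|M1| + `|M2|) => y; have := H1 y; have := H2 y.
have := ler_norm M1; have := ler_norm M2.
have := normr_ge0 M1; have := normr_ge0 M2.
by rewrite /corner; case: (leP (cap p0 y) (cap p1 y)) => *; lra.
Qed.

Lemma corner_lip : exists K : R, 0 <= K /\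
  forall x y, `|corner x - corner y| <= K * `|x - y|.
Proof.
have [K1 [K10 H1]] := cap_lip p0; have [K2 [K20 H2]] := cap_lip p1.
exists (K1 + K2); split; first by rewrite addr_ge0.
have one x y : corner x <= corner y + (K1 + K2) * `|x - y|.
  have n1 : 0 <= K1 * `|x - y| by rewrite mulr_ge0.
  have n2 : 0 <= K2 * `|x - y| by rewrite mulr_ge0.
  have := H1 x y; have := H2 x y; rewrite !ler_norml => /andP[_ h2] /andP[_ h1].
  rewrite /corner; move: (cap p0 y) (cap p1 y) h1 h2 => c0 c1 h1 h2.
  have [c|c] := leP c0 c1.
    by rewrite ge_min; apply/orP; left; lra.
  by rewrite ge_min; apply/orP; right; lra.
move=> x y; rewrite ler_norml; apply/andP.
by have := one x y; have := one y x; rewrite (distrC y) => *; split; lra.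
Qed.

(** So short that the curvature of the data, at most [1 / th], is dominated by
    that of the Lagrangian run for a time [t], at least [1 / (t Th)]. *)
Let t : R := th / (2 * Th).
Let nbar : R := (1 - l) * nform H p0 h h + l * nform H p1 h h.
Let a : 'rV[R]_d := ((1 - t) * dot h h)^-1 *: h.
(** The displacement along [xi] at which the two profiles, whose slopes differ
    by [xi], make up for the difference of their second derivatives. *)
Let gam : R := (nform H p0 h h - nform H p1 h h) / (2 * dot xi xi).

Let th_le_Th : th <= Th.
Proof.
have := le_trans (Hlo 0 h) (Hhi 0 h); rewrite ler_pM2r // dot_gt0; exact: h0.
Qed.

Let t0 : 0 < t. Proof. by rewrite divr_gt0 // mulr_gt0. Qed.

Let t2 : t <= 1 / 2.
Proof.
rewrite /t ler_pdivrMr ?mulr_gt0 //; have := th_le_Th; lra.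
Qed.

Let tTh : t / (2 * th) <= 1 / (2 * Th).
Proof.
rewrite /t ler_pdivlMr ?mulr_gt0 //.
have -> : th / (2 * Th) / (2 * th) * (2 * Th) = 1 / 2.
  by field; rewrite !gt_eqF.
lra.
Qed.

(** Paths to [x = - t DH(pl)] start at best from the corner: the data lie below
    the combination of both profiles with weights [1 - l] and [l], of slope
    [pl], and moving away from the corner costs more Lagrangian than it gains. *)
Lemma corner_value : hl corner (- t *: b pl, t) <= - (t * L (b pl)).
Proof.
have [v ->] := hopf_lax_ex C2 th0 Th0 Hlo Hhi corner (- t *: b pl) t.
rewrite /payoff; pose z := v - b pl; have vE : v = b pl + z by rewrite /z subrKC.
have -> : - t *: b pl + t *: v = t *: z by rewrite /z scalerBr scaleNr addrC.
clearbody z; rewrite {}vE.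
have Lz := legendre_lower C2 th0 Th0 Hlo Hhi pl z.
have cp p : cap p (t *: z) <= t * dot p z + t * (t / (2 * th) * dot z z).
  apply: (le_trans (cap_le p _)).
  have := legendre_upper C2 th0 Th0 Hlo Hhi p (t *: z).
  rewrite addrC !dotZr dotZl; lra.
have cE : corner (t *: z) <= t * dot pl z + t * (t / (2 * th) * dot z z).
  have h1 := cp p0; have h2 := cp p1.
  have : corner (t *: z) <= (1 - l) * cap p0 (t *: z) + l * cap p1 (t *: z).
    case/andP: l01 => l0 l1.
    have c1 : corner (t *: z) <= cap p0 (t *: z) by rewrite ge_min lexx.
    have c2 : corner (t *: z) <= cap p1 (t *: z) by rewrite ge_min lexx orbT.
    have m1 := ler_wpM2l l0 c2.
    have l1' : 0 <= 1 - l by lra.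
    have m2 := ler_wpM2l l1' c1; lra.
  move=> /le_trans; apply; case/andP: l01 => l0 l1.
  have l1' : 0 <= 1 - l by lra.
  have m1 := ler_wpM2l l0 h2; have m2 := ler_wpM2l l1' h1.
  rewrite dotDl in m1; rewrite [dot pl z]dotDl dotZl; lra.
have m1 := ler_wpM2r (dot_ge0 z) tTh.
have m2 := ler_wpM2l (ltW t0) m1; have m3 := ler_wpM2l (ltW t0) Lz.
have e1 : dot z z / (2 * Th) = 1 / (2 * Th) * dot z z by rewrite mul1r mulrC.
rewrite e1 in m3; lra.
Qed.

(** Starting points of competing paths: the set where both profiles agree is
    followed to second order, which is what the term in [xi] is for. *)
Let y w : 'rV[R]_d := dot w a *: h + (gam * dot w a ^+ 2) *: xi.

Let rem p z : R := L (b p + z) - (L (b p) + dot p z + nform H p z z / 2).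

Lemma osq_rem p : osq (rem p).
Proof. by move=> e e0; exact: legendre_taylor2. Qed.

Lemma y_bound : exists C : R, 0 <= C /\
  forall w, `|w| < 1 -> dot (y w) (y w) <= C * dot w w.
Proof.
rewrite /y; clearbody a gam.
pose C : R := dot a a * dot h h + gam ^+ 2 * (dot a a ^+ 2 * d%:R) * dot xi xi.
have C0 : 0 <= C.
  apply: addr_ge0; first by rewrite mulr_ge0 ?dot_ge0.
  apply: mulr_ge0 (dot_ge0 _); apply: mulr_ge0 (sqr_ge0 _) _.
  by apply: mulr_ge0 (sqr_ge0 _) _.
exists C; split=> // w w1.
have h1 := sqr_dot_le w a; have h2 : dot w w <= d%:R.
  apply: (le_trans (dot_le_sqr_norm w)); rewrite ler_piMr // expr2.
  by rewrite mulr_ile1 // ltW.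
rewrite dotDl !dotDr !dotZl !dotZr (dotC h xi) xih !mulr0 addr0 add0r.
have w0 := dot_ge0 w; have a0 := dot_ge0 a.
have h3 : dot w a ^+ 2 * dot w a ^+ 2 <= dot a a ^+ 2 * d%:R * dot w w.
  apply: (@le_trans _ _ ((dot w w * dot a a) * (dot w w * dot a a))).
    by rewrite ler_pM ?sqr_ge0.
  have -> : dot w w * dot a a * (dot w w * dot a a) =
    dot a a ^+ 2 * dot w w * dot w w by ring.
  by rewrite ler_wpM2r // ler_wpM2l // sqr_ge0.
have m1 := ler_wpM2r (dot_ge0 h) h1.
have m2 := ler_wpM2l (mulr_ge0 (sqr_ge0 gam) (dot_ge0 xi)) h3.
rewrite /C; move: m1 m2; move: gam (dot w a) (dot h h) (dot xi xi) => G A P Q.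
move: (dot a a) (dot w w) => X Y m1 m2; lra.
Qed.

(** The payoff of the path from [y w] to [- t DH(pl) + w], expanded to second
    order in both profiles; [gam] makes the two expansions coincide, so that
    the minimum of the profiles has the same one. *)
Lemma corner_lower (e : R) : 0 < e -> exists2 r : R, 0 < r & forall w, `|w| < r ->
  - (t * L (b pl)) + dot pl w +
   (nbar * dot w a ^+ 2 - nform H pl (dot w a *: h - w) (dot w a *: h - w) / t) / 2
   - e * dot w w <= hl corner (- t *: b pl + w, t).
Proof.
move=> e0; have [C [C0 HC]] := y_bound.
have [K [K0 HK]] := corner_lip; have [M HM] := corner_bounded.
have C1 : 0 <= (2 * C + 2) / t ^+ 2.
  by rewrite divr_ge0 ?exprn_ge0 ?(ltW t0) // addr_ge0 // mulr_ge0.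
have HC' w : `|w| < 1 ->
    dot (t^-1 *: (y w - w)) (t^-1 *: (y w - w)) <= (2 * C + 2) / t ^+ 2 * dot w w.
  move=> w1; have := HC w w1; move: (y w) => z; have := dot_ge0 (z + w).
  rewrite dotDl !dotDr !dotZl !dotZr dotBl !dotBr (dotC w z) => h1 h2.
  have -> : t^-1 * (t^-1 * (dot z z - dot z w - (dot z w - dot w w))) =
    (dot z z - dot z w - (dot z w - dot w w)) / t ^+ 2.
    by field; rewrite gt_eqF.
  rewrite mulrAC ler_wpM2r ?invr_ge0 ?exprn_ge0 ?(ltW t0) //; lra.
(* one branch of the corner, with its exact remainder *)
pose br p w : R := L (b p + y w) - L (b p) - t * L (b pl + t^-1 *: (y w - w)).
pose quad w : R := - (t * L (b pl)) + dot pl w +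
   (nbar * dot w a ^+ 2 - nform H pl (dot w a *: h - w) (dot w a *: h - w) / t) / 2.
pose nl : 'rV[R]_d := xi *m (invmx (hess H pl))^T.
have nlE w : nform H pl w xi = dot w nl by rewrite nformE dot_mulmx.
have branch p : dot p xi * gam + nform H p h h / 2 = dot pl xi * gam + nbar / 2 ->
    dot p h = dot pl h -> osq (fun w => br p w - quad w).
  move=> Ep Eh.
  pose k1 : R := gam * nform H p h xi - gam / t * nform H pl h xi.
  pose k2 : R := gam ^+ 2 * nform H p xi xi / 2 - gam ^+ 2 * nform H pl xi xi / (2 * t).
  have -> : (fun w => br p w - quad w) = (fun w =>
    (rem p (y w) + (- t) * rem pl (t^-1 *: (y w - w))) +
    (k1 * (dot w a ^+ 2 * dot w a) + k2 * (dot w a ^+ 2 * dot w a ^+ 2)) +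
    gam / t * (dot w a ^+ 2 * dot w nl)).
    apply/funext => w; rewrite /br /quad /rem.
    set L1 := L (b p + _); set L2 := L (b pl + _).
    have [al alE] : exists s, s = dot w a by eexists.
    rewrite -alE; have [e1 e1E] : exists z, z = al *: h - w by eexists.
    have [z zE] : exists z, z = y w by eexists.
    rewrite -zE -e1E; have zE' : z = al *: h + (gam * al ^+ 2) *: xi by rewrite zE alE.
    have zw : z - w = e1 + (gam * al ^+ 2) *: xi by rewrite zE' e1E addrAC.
    have E1 : nform H p z z = al ^+ 2 * nform H p h h +
       2 * (gam * al ^+ 2 * al) * nform H p h xi + (gam * al ^+ 2) ^+ 2 * nform H p xi xi.
      rewrite zE' nformDl !nformDr !nformZl !nformZr (nformC C2 p xi h); ring.
    have E2 : nform H pl e1 xi = al * nform H pl h xi - dot w nl.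
      by rewrite e1E -(scaleN1r w) nformDl !nformZl (nlE w); ring.
    have E3 : nform H pl (t^-1 *: (z - w)) (t^-1 *: (z - w)) =
       (nform H pl e1 e1 + 2 * (gam * al ^+ 2) * nform H pl e1 xi +
         (gam * al ^+ 2) ^+ 2 * nform H pl xi xi) / t ^+ 2.
      rewrite zw nformZl nformZr nformDl !nformDr !nformZl !nformZr (nformC C2 pl xi e1).
      by field; rewrite gt_eqF.
    have E4 : dot p z = al * dot pl h + gam * al ^+ 2 * dot p xi.
      by rewrite zE' dotDr !dotZr Eh.
    have E5 : dot pl (t^-1 *: (z - w)) =
      (al * dot pl h + gam * al ^+ 2 * dot pl xi - dot pl w) / t.
      by rewrite dotZr dotBr zE' dotDr !dotZr mulrC.
    rewrite E1 E3 E4 E5 E2 /k1 /k2.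
    have -> : nform H p h h = 2 * (dot pl xi * gam + nbar / 2 - dot p xi * gam).
      by rewrite -Ep; field.
    move: (nform H pl e1 e1) (nform H p h xi) (nform H pl h xi) => X1 X2 X3.
    move: (nform H p xi xi) (nform H pl xi xi) (dot pl xi) (dot p xi) => X4 X5 X6 X7.
    move: (dot w nl) (dot pl h) (dot pl w) (L (b p)) (L (b pl)) => X8 X9 X10 X11 X12.
    clearbody L1 L2; move: gam nbar => G N; field; rewrite gt_eqF //.
  apply: osq_add; last exact/osq_scale/osq_cube.
  apply: osq_add; last first.
    by apply: osq_add; apply: osq_scale; [exact: osq_cube|exact: osq_quartic].
  apply: osq_add; first exact: osq_comp (osq_rem p) C0 HC.
  by apply: osq_scale; exact: osq_comp (osq_rem pl) C1 HC'.
have xx : 0 < dot xi xi by rewrite dot_gt0.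
have [r0 r00 H0] : exists2 r : R, 0 < r &
    forall w, `|w| < r -> quad w - e * dot w w <= br p0 w.
  have [||r r0 Hr] := branch p0 _ _ e e0.
  - rewrite dotDl dotZl /nbar /gam; field; rewrite gt_eqF //.
  - by rewrite dotDl dotZl xih mulr0 addr0.
  by exists r => // w /Hr; rewrite ler_norml => /andP[]; lra.
have [r1 r10 H1] : exists2 r : R, 0 < r &
    forall w, `|w| < r -> quad w - e * dot w w <= br p1 w.
  have [||r r1 Hr] := branch p1 _ _ e e0.
  - rewrite !dotDl dotZl /nbar /gam; field; rewrite gt_eqF //.
  - by rewrite !dotDl dotZl xih mulr0 !addr0.
  by exists r => // w /Hr; rewrite ler_norml => /andP[]; lra.
have capE p : exists2 r : R, 0 < r & forall w, `|w| < r ->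
    cap p (y w) = L (b p + y w) - L (b p).
  have /cont_at_eps /(_ _ ltr01)[s s0 Hs] := @legendre_cont _ _ H th Th C2 th0 Th0 Hlo Hhi (b p).
  have [r' r'0 Hr'] := @dot_small R d (s ^+ 2 / (C + 1))
    (divr_gt0 (exprn_gt0 2 s0) (ltr_wpDl C0 ltr01)).
  exists (Num.min 1 r'); first by rewrite lt_min ltr01.
  move=> w; rewrite lt_min => /andP[w1 /Hr']; rewrite ltr_pdivlMr ?ltr_wpDl // => w2.
  have /Hs : `|y w| < s.
    apply: norm_lt_dot => //; apply: (le_lt_trans (HC w w1)).
    have := dot_ge0 w; lra.
  rewrite ltr_norml => /andP[_ hs].
  rewrite /cap (addrC (y w)); move: hs; move: (L (b p + y w)) (L (b p)) => A B hs.
  by case: (leP A (B + 1)) => ?; lra.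
have [r2 r20 H2] := capE p0; have [r3 r30 H3] := capE p1.
exists (Num.min (Num.min r0 r1) (Num.min r2 r3)); first by rewrite !lt_min r00 r10 r20.
move=> w; rewrite !lt_min => /andP[/andP[w0 w1] /andP[w2 w3]].
have := hopf_lax_ge C2 th0 Th0 Hlo Hhi HM K0 HK (- t *: b pl + w)
   (b pl + t^-1 *: (y w - w)) (ltW t0); apply: le_trans.
rewrite /payoff.
have -> : - t *: b pl + w + t *: (b pl + t^-1 *: (y w - w)) = y w.
  rewrite scalerDr scalerA divff ?gt_eqF // scale1r scaleNr.
  by rewrite addrACA addNr add0r subrKC.
rewrite -/(quad w) /corner (H2 w w2) (H3 w w3).
have := H0 w w0; have := H1 w w1; rewrite /br.
move: (L (b p0 + y w)) (L (b p1 + y w)) (t * _) (e * _) (quad w) => X1 X2 X3 X4 X5.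
by case: (leP (X1 - _) _) => *; lra.
Qed.

(** The data satisfy the bound with constant 1. At time [t] the solution is
    touched from below by a quadratic function with second derivative
    [(nbar - t n_l) / (1 - t)^2] along [h], where [n_l] is the inverse Hessian
    form at [pl]. The propagated bound for it is [n_l / (1 - t)], that is,
    [nbar <= n_l]. *)
Lemma corner_inequality :
  (forall (C : R) (u : 'rV[R]_d * R -> R), 0 < C ->
     buc_spacetime u -> viscosity_solution H u ->
     lipschitz (slice u 0 : 'rV[R]_d -> R^o) -> propagates_ge H u C) ->
  (1 - l) * nform H p0 h h + l * nform H p1 h h <= nform H pl h h.
Proof.
move=> Hprop; have [K [K0 HK]] := corner_lip; have [M HM] := corner_bounded.
pose u := hl corner.
have buc_u : buc_spacetime u by exact: (hopf_lax_buc C2 th0 Th0 Hlo Hhi HM K0 HK).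
have visc_u : viscosity_solution H u by exact: (hopf_lax_viscosity C2 th0 Th0 Hlo Hhi HM K0 HK).
have u0E : slice u 0 = corner.
  by apply/funext => x; rewrite /slice /u hopf_lax0.
have lip_u : lipschitz (slice u 0 : 'rV[R]_d -> R^o).
  rewrite u0E; exists K; split=> [|k Kk [x x'] _ /=]; first exact: num_real.
  by apply: (le_trans (HK x x')); rewrite ler_wpM2r // ltW.
have := Hprop 1 u ltr01 buc_u visc_u lip_u; rewrite /propagates_ge u0E.
have t1 : 0 < 1 - t by have := t2; lra.
have maxE : Num.max (1 - 1 * t) 0 = 1 - t by rewrite mul1r (max_idPl _) // ltW.
move=> /(_ corner_visc t t0); rewrite maxE => /(_ t1) Hv.
have [[M' HM'] _] := buc_u t t0.
have HM'' x : `|slice u t x| <= M' by apply: HM'; rewrite /= lexx ltW.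
have hh : 0 < dot h h by rewrite dot_gt0.
have th2 : 0 < (1 - t) ^+ 2 by rewrite exprn_gt0.
apply/ler_addgt0Pr => e e0.
pose e' := e / (2 * (1 - t) ^+ 2 * dot h h).
have e'0 : 0 < e' by rewrite divr_gt0 // mulr_gt0 // mulr_gt0.
have [r r0 Hr] := corner_lower e'0.
have ah : dot h a = (1 - t)^-1.
  by rewrite /a dotZr invfM mulfVK // gt_eqF.
clearbody a.
pose E : 'M[R]_d := a^T *m h - 1%:M.
have EE w : w *m E = dot w a *: h - w.
  by rewrite /E mulmxBr mulmx1 mulmxA [w *m a^T]mx11_scalar mul_scalar_mx.
pose B : 'M[R]_d := nbar *: (a^T *m a) - t^-1 *: (E *m invmx (hess H pl) *m E^T)
   - (2 * e')%:M.
have BE w : dot (w *m B) w = nbar * dot w a ^+ 2 -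
   nform H pl (dot w a *: h - w) (dot w a *: h - w) / t - 2 * e' * dot w w.
  rewrite /B !mulmxBr !dotBl dot_scalar -!scalemxAr !dotZl; congr (_ * _ - _ - _).
    by rewrite mulmxA [w *m a^T]mx11_scalar mul_scalar_mx dotZl -/(dot w a) (dotC a w) expr2.
  by rewrite nformE -!EE !mulmxA [LHS]mulrC [in LHS]dot_mulmx trmxK.
have := @visc_ge_quadratic _ _ H th C2 th0 Hlo (slice u t) (1 / (1 - t)) M' r
  (- t *: b pl) pl B Hv HM'' r0 _ h.
have step w : `|w| < r -> slice u t (- t *: b pl) + dot pl w + dot (w *m B) w / 2 <=
    slice u t (- t *: b pl + w).
  move=> /Hr; have := corner_value; rewrite BE /slice -/u; lra.
move=> /(_ step); rewrite BE.
have -> : dot h a *: h - h = (t / (1 - t)) *: h.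
  rewrite ah -{2}[h]scale1r -scalerBl; congr (_ *: _).
  by field; rewrite gt_eqF.
rewrite ah nformZl nformZr -/nbar => Hfin.
have {}Hfin : (1 - t) ^+ 2 * (nbar * (1 - t)^-1 ^+ 2 -
   t / (1 - t) * (t / (1 - t) * nform H pl h h) / t - 2 * e' * dot h h) <=
   (1 - t) ^+ 2 * (1 / (1 - t) * nform H pl h h) by rewrite ler_pM2l.
have E1 : (1 - t) ^+ 2 * (nbar * (1 - t)^-1 ^+ 2 -
   t / (1 - t) * (t / (1 - t) * nform H pl h h) / t - 2 * e' * dot h h) =
   nbar - t * nform H pl h h - e.
  by rewrite /e'; field; rewrite !gt_eqF.
have E2 : (1 - t) ^+ 2 * (1 / (1 - t) * nform H pl h h) = (1 - t) * nform H pl h h.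
  by field; rewrite gt_eqF.
rewrite E1 E2 in Hfin; lra.
Qed.

End Corner.

(** * From the corner inequality to a constant Hessian *)

Section Constancy.
Context {R : realType} {d : nat}.
Variables (H : 'rV[R]_d -> R) (th Th : R).
Hypotheses (C2 : Ck 2 H) (th0 : 0 < th) (Th0 : 0 < Th).
Hypothesis Hlo : forall p v, th * dot v v <= hform H p v v.
Hypothesis Hhi : forall p v, hform H p v v <= Th * dot v v.
Implicit Types (p q v w x y z h xi : 'rV[R]_d).

Hypothesis Hprop : forall (C : R) (u : 'rV[R]_d * R -> R), 0 < C ->
  buc_spacetime u -> viscosity_solution H u ->
  lipschitz (slice u 0 : 'rV[R]_d -> R^o) -> propagates_ge H u C.

Lemma le_of_le_div (A B : R) : (forall n : nat, A <= B / n.+1%:R) -> A <= 0.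
Proof.
move=> AB; rewrite leNgt; apply/negP => A0.
pose n := Num.truncn (B / A); have := Num.Theory.truncnS_gt (B / A); rewrite -/n => Bn.
have := AB n; rewrite ler_pdivlMr ?ltr0n // => h.
by move: Bn; rewrite ltr_pdivrMr // mulrC ltNge h.
Qed.

(** [corner_inequality] says that the form is concave along [xi]; it is also
    bounded below, and concave functions bounded below on a line are constant. *)
Lemma nform_orthogonal p xi h : dot xi h = 0 ->
  nform H (p + xi) h h = nform H p h h.
Proof.
move=> xih; have [->|h0] := eqVneq h 0.
  by rewrite -(scale0r 0) !nformZl !mul0r.
suff le q x : dot x h = 0 -> nform H q h h <= nform H (q + x) h h.
  apply/eqP; rewrite eq_le le // andbT.
  by have := le (p + xi) (- xi); rewrite addrK dotNl xih oppr0 => ->.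
move=> xh; have [->|x0] := eqVneq x 0; first by rewrite addr0.
rewrite -subr_le0; apply: (@le_of_le_div _ (nform H q h h)) => n.
have n0 : 0 < n.+1%:R :> R by rewrite ltr0n.
have l01 : 0 <= (n.+1%:R^-1 : R) <= 1.
  by rewrite invr_ge0 ltW //= invf_le1 // ler1n.
have nx0 : n.+1%:R *: x != 0 by rewrite scaler_eq0 negb_or x0 gt_eqF.
have nxh : dot (n.+1%:R *: x) h = 0 by rewrite dotZl xh mulr0.
have := @corner_inequality _ _ H th Th C2 th0 Th0 Hlo Hhi q _ h _ l01 nx0 h0 nxh Hprop.
rewrite scalerA mulVf ?gt_eqF // scale1r.
have := nform_ge0 th0 Hlo (q + n.+1%:R *: x) h => h1.
have l0 : 0 <= n.+1%:R^-1 :> R by rewrite invr_ge0 ltW.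
have := mulr_ge0 l0 h1; move: (n.+1%:R^-1) (nform H q h h) => s A; lra.
Qed.

Lemma bounded_affine (a c B : R) : (forall n : nat, `|a + n%:R * c| <= B) -> c = 0.
Proof.
move=> H1; apply/eqP; rewrite -normr_eq0 eq_le normr_ge0 andbT.
apply: (@le_of_le_div _ (B + `|a|)) => n; rewrite ler_pdivlMr ?ltr0n //.
have := H1 n.+1; have := ler_normB (a + n.+1%:R * c) a.
rewrite addrAC subrr add0r normrM (@ger0_norm _ n.+1%:R) //.
by rewrite mulrC; lra.
Qed.

Lemma bounded_second_difference (g : nat -> R) (k B : R) :
  (forall n, g n.+2 - 2 * g n.+1 + g n = k) -> (forall n, `|g n| <= B) ->
  g 1%N = g 0%N.
Proof.
move=> gk gB; have D n : g n.+1 - g n = g 1%N - g 0%N + n%:R * k.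
  elim: n => [|n IH]; first by rewrite mul0r addr0.
  by have := gk n; rewrite -natr1 mulrDl mul1r; lra.
have k0 : k = 0.
  apply: (@bounded_affine (g 1%N - g 0%N) _ (B + B)) => n; rewrite -D.
  by apply: (le_trans (ler_normB _ _)); rewrite lerD.
have S n : g n = g 0%N + n%:R * (g 1%N - g 0%N).
  elim: n => [|n IH]; first by rewrite mul0r addr0.
  by have := D n; rewrite k0 mulr0 -natr1 IH; lra.
apply/eqP; rewrite -subr_eq0; apply/eqP.
by apply: (@bounded_affine (g 0%N) _ B) => n; rewrite -S.
Qed.

Local Notation Q p v := (nform H p v v).

Lemma nform_parallelogram p e f :
  Q p (e + f) + Q p (e - f) = 2 * Q p e + 2 * Q p f.
Proof.
rewrite -(scaleN1r f) !nformDl !nformDr !nformZl !nformZr; ring.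
Qed.

Lemma nform_polar p e f : 4 * nform H p e f = Q p (e + f) - Q p (e - f).
Proof.
rewrite -(scaleN1r f) !nformDl !nformDr !nformZl !nformZr (nformC C2 p f e); ring.
Qed.

(** In the plane of [e] and [f] the form at [e] only depends on one coordinate,
    the form at [f] on the other, and the forms at [e + f] and [e - f] on the
    diagonal ones. The parallelogram law then equates a second difference
    along one diagonal with one along the other, hence both are constant, and
    boundedness kills them. *)
Lemma nform_diagonal p e f (a : R) : dot e f = 0 -> dot e e = dot f f ->
  Q (p + a *: (e + f)) (e + f) = Q p (e + f).
Proof.
move=> ef ee; pose G p := Q p (e + f); pose K p := Q p (e - f).
have GI q s : G (q + s *: (e - f)) = G q.
  apply: nform_orthogonal; rewrite dotZl dotBl !dotDr ef (dotC f e) ef ee.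
  by rewrite addr0 add0r subrr mulr0.
have KI q s : K (q + s *: (e + f)) = K q.
  apply: nform_orthogonal; rewrite dotZl dotDl !dotBr ef (dotC f e) ef ee.
  by rewrite subr0 sub0r subrr mulr0.
have EI q s : Q (q + s *: f) e = Q q e.
  by apply: nform_orthogonal; rewrite dotZl dotC ef mulr0.
have FI q s : Q (q + s *: e) f = Q q f.
  by apply: nform_orthogonal; rewrite dotZl ef mulr0.
have par q : G q + K q = 2 * Q q e + 2 * Q q f by exact: nform_parallelogram.
have uE q s : q + s *: (e + f) = q + s *: e + s *: f by rewrite scalerDr addrA.
have vE q s : q + s *: (e - f) = q + s *: e + (- s) *: f.
  by rewrite scalerBr scaleNr addrA.
have second q s : G (q + s *: (e + f)) + G (q + (- s) *: (e + f)) - 2 * G q =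
    K (q + s *: (e - f)) + K (q + (- s) *: (e - f)) - 2 * K q.
  have h1 := par (q + s *: (e + f)); have h2 := par (q + (- s) *: (e + f)).
  have h3 := par (q + s *: (e - f)); have h4 := par (q + (- s) *: (e - f)).
  rewrite KI in h1; rewrite KI in h2; rewrite GI in h3; rewrite GI in h4.
  rewrite [in RHS]uE EI -addrA (addrC (s *: e)) addrA FI in h1.
  rewrite [in RHS]uE EI -addrA (addrC (- s *: e)) addrA FI in h2.
  rewrite [in RHS]vE EI -addrA (addrC (s *: e)) addrA FI in h3.
  rewrite [in RHS]vE EI -addrA (addrC (- s *: e)) addrA FI opprK in h4.
  lra.
pose g n := G (p + n%:R * a *: (e + f)).
have g01 : g 1%N = g 0%N.
  apply: (@bounded_second_difference g (G (p + a *: (e + f)) + G (p + (- a) *: (e + f)) - 2 * G p)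
     (dot (e + f) (e + f) / th)) => n.
    have := second (p + n.+1%:R * a *: (e + f)) a.
    have -> : p + n.+1%:R * a *: (e + f) + a *: (e - f) =
      p + a *: (e - f) + n.+1%:R * a *: (e + f) by rewrite addrAC.
    have -> : p + n.+1%:R * a *: (e + f) + - a *: (e - f) =
      p + - a *: (e - f) + n.+1%:R * a *: (e + f) by rewrite addrAC.
    rewrite !KI -second -!addrA -!scalerDl.
    have -> : n.+1%:R * a + a = n.+2%:R * a by rewrite -(natr1 n.+1); ring.
    have -> : n.+1%:R * a + - a = n%:R * a by rewrite -(natr1 n); ring.
    by rewrite /g => <-; ring.
  rewrite ger0_norm; first exact: (nform_le th0 Hlo).
  exact: (nform_ge0 th0 Hlo).
by move: g01; rewrite /g mul1r mul0r scale0r addr0.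
Qed.

(** A move along [e] is one along [e + f] followed by one along [e - f]. *)
Lemma nform_plane p e f (a : R) : dot e f = 0 -> dot e e = dot f f ->
  Q (p + a *: e) e = Q p e /\ nform H (p + a *: e) e f = nform H p e f.
Proof.
move=> ef ee; have ef' : dot e (- f) = 0 by rewrite dotNr ef oppr0.
have ee' : dot e e = dot (- f) (- f) by rewrite dotNl dotNr opprK.
have aE : p + a *: e = p + (a / 2) *: (e + f) + (a / 2) *: (e - f).
  by apply/rowP => k; rewrite !mxE; field.
have GE : Q (p + a *: e) (e + f) = Q p (e + f).
  rewrite aE nform_orthogonal ?nform_diagonal //.
  by rewrite dotZl dotBl !dotDr ef (dotC f e) ef ee addr0 add0r subrr mulr0.
have KE : Q (p + a *: e) (e - f) = Q p (e - f).
  rewrite aE addrAC nform_orthogonal ?nform_diagonal //.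
  by rewrite dotZl dotDl !dotBr ef (dotC f e) ef ee subr0 sub0r subrr mulr0.
have FE : Q (p + a *: e) f = Q p f.
  by apply: nform_orthogonal; rewrite dotZl ef mulr0.
split.
  have := nform_parallelogram (p + a *: e) e f; have := nform_parallelogram p e f.
  rewrite GE KE FE; lra.
by have := nform_polar (p + a *: e) e f; have := nform_polar p e f; rewrite GE KE; lra.
Qed.

Lemma dot_basis2 (i j : 'I_d) : dot (basis_vec R i) (basis_vec R j) = (i == j)%:R.
Proof. by rewrite dot_basis mxE eqxx /= eq_sym. Qed.

Lemma nform_translate (d_gt1 : (1 < d)%N) p (a : R) (i j k : 'I_d) :
  nform H (p + a *: basis_vec R k) (basis_vec R i) (basis_vec R j) =
  nform H p (basis_vec R i) (basis_vec R j).
Proof.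
have ort (m n : 'I_d) : m != n -> dot (basis_vec R m) (basis_vec R n) = 0.
  by move=> mn; rewrite dot_basis2 (negbTE mn).
have same (m n : 'I_d) : dot (basis_vec R m) (basis_vec R m) =
   dot (basis_vec R n) (basis_vec R n) by rewrite !dot_basis2 !eqxx.
have [n jn] : exists n : 'I_d, j != n.
  case: (eqVneq j (Ordinal (ltnW d_gt1))) => [->|]; last by eexists; eassumption.
  by exists (Ordinal d_gt1).
have [<-|ij] := eqVneq j i.
  have [->|kj] := eqVneq k j; first by case: (nform_plane p a (ort _ _ jn) (same _ _)).
  by apply: nform_orthogonal; rewrite dotZl ort ?mulr0.
have [->|ki] := eqVneq k i.
  by case: (nform_plane p a (ort i j _) (same i j)); rewrite // eq_sym.
have [->|kj] := eqVneq k j.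
  rewrite !(nformC C2 _ (basis_vec R i)).
  by case: (nform_plane p a (ort j i ij) (same j i)).
have E1 := nform_polar (p + a *: basis_vec R k) (basis_vec R i) (basis_vec R j).
have E2 := nform_polar p (basis_vec R i) (basis_vec R j).
rewrite !nform_orthogonal in E1; first by lra.
  by rewrite dotZl ?dotBr ?dotDr !ort // ?subr0 ?addr0 mulr0.
by rewrite dotZl ?dotBr ?dotDr !ort // ?subr0 ?addr0 mulr0.
Qed.

Lemma mx_form_inj (A B : 'M[R]_d) : (forall i j : 'I_d,
  dot (basis_vec R i *m A) (basis_vec R j) = dot (basis_vec R i *m B) (basis_vec R j)) ->
  A = B.
Proof. by move=> AB; apply/matrixP => i j; rewrite -!form_entry AB. Qed.

Lemma hess_const (d_gt1 : (1 < d)%N) p : hess H p = hess H 0.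
Proof.
have NE i j : nform H p (basis_vec R i) (basis_vec R j) =
   nform H 0 (basis_vec R i) (basis_vec R j).
  rewrite [p in LHS]row_basis.
  elim/big_rec: _ => // k q _ <-.
  by rewrite addrC nform_translate.
apply: (can_inj (@invmxK R d)); apply: mx_form_inj => i j.
by have := NE i j; rewrite !nformE.
Qed.

End Constancy.

(** * Explicit test functions in space-time *)

Section TestFunctions.
Context {R : realType} {d : nat}.
Implicit Types (phi psi : 'rV[R]_d * R -> R) (x v g : 'rV[R]_d) (s t : R).

(** Retraction of the time axis to [0, T], where solutions are controlled: it
    makes them continuous functions on the whole of space-time. *)
Definition clamp (T s : R) : R := Num.max 0 (Num.min s T).

Lemma clamp_id (T s : R) : 0 <= s <= T -> clamp T s = s.
Proof. by move=> /andP[s0 sT]; rewrite /clamp (min_idPl sT) (max_idPr s0). Qed.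

Lemma clamp_in (T s : R) : 0 <= T -> 0 <= clamp T s <= T.
Proof.
by move=> T0; rewrite /clamp le_max lexx ge_max T0 ge_min lexx orbT.
Qed.

Lemma clamp_lip (T s s' : R) : `|clamp T s - clamp T s'| <= `|s - s'|.
Proof.
have one a c : clamp T a <= clamp T c + `|a - c|.
  have h := ler_norm (a - c); have h0 := normr_ge0 (a - c).
  rewrite /clamp ge_max addr_ge0 // ?le_max ?lexx //=.
  apply: (@le_trans _ _ (Num.min c T + `|a - c|)); last first.
    by rewrite lerD2r le_max lexx orbT.
  have [cT|cT] := leP c T; rewrite ge_min; apply/orP; [left|right]; lra.
rewrite ler_norml; apply/andP; have := one s s'; have := one s' s.
by rewrite (distrC s'); split; lra.
Qed.

Lemma clamp_cont (T : R) : continuous (clamp T).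
Proof.
move=> s; apply/cont_at_eps => e e0; exists e => // h he.
by apply: le_lt_trans (clamp_lip _ _ _) _; rewrite addrAC subrr add0r.
Qed.

Lemma buc_clamp_cont (u : 'rV[R]_d * R -> R) (T : R) : buc_spacetime u -> 0 < T ->
  continuous (fun z : 'rV[R]_d * R => u (z.1, clamp T z.2)).
Proof.
move=> bu T0 z; apply/cont_at_eps => e e0.
have [_ /(_ e e0)[r r0 Hr]] := bu T T0; exists r => // w wr.
apply: Hr; rewrite /= ?clamp_in ?(ltW T0) //.
apply: le_lt_trans wr; rewrite [leLHS]/Num.norm /= ge_max; apply/andP; split.
  rewrite -[(_ - _).1]/(z.1 + w.1 - z.1) addrAC subrr add0r; exact: fst_norm_le.
rewrite -[(_ - _).2]/(clamp T (z.2 + w.2) - clamp T z.2).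
apply: (le_trans (clamp_lip _ _ _)); rewrite addrAC subrr add0r; exact: snd_norm_le.
Qed.

Lemma grad_dt_add phi psi (z : 'rV[R]_d * R) : Ck 1 phi -> Ck 1 psi ->
  grad (slice (fun y => phi y + psi y) z.2) z.1 =
    grad (slice phi z.2) z.1 + grad (slice psi z.2) z.1 /\
  dt (fun y => phi y + psi y) z = dt phi z + dt psi z.
Proof.
move=> Cphi Cpsi; have Cs := Ck_add Cphi Cpsi.
have D w : 'D_w (fun y => phi y + psi y) z = 'D_w phi z + 'D_w psi z.
  by rewrite -deriveD //; apply: (@Ck_derivable _ _ 0).
split; last by rewrite !dtE D.
by apply: dot_inj => v; rewrite dotDl !dot_grad_slice // D.
Qed.

(** Equal to [eta] at time [t] and, for large [m], as large as desired at a given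
    later time. It keeps extrema away from the final time of a strip, and its
    time derivative makes the viscosity inequalities strict. *)
Definition barrier (eta t : R) (m : nat) (z : 'rV[R]_d * R) : R :=
  eta * (z.2 / t) ^+ m.+1.

Lemma Ck_barrier k eta t m : Ck k (barrier eta t m).
Proof.
apply: Ck_mul; first exact: Ck_cst.
by apply: Ck_exp; apply: Ck_mul; [exact: Ck_time | exact: Ck_cst].
Qed.

Lemma barrier_derivatives eta t m (z : 'rV[R]_d * R) :
  grad (slice (barrier eta t m) z.2) z.1 = 0 /\
  dt (barrier eta t m) z = eta * (m.+1%:R * (z.2 / t) ^+ m / t).
Proof.
split.
  have -> : slice (barrier eta t m) z.2 = cst (eta * (z.2 / t) ^+ m.+1) by [].
  by apply/rowP => i; rewrite !mxE derive_cst.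
rewrite /dt derive1E.
have D1 : is_derive z.2 (1 : R) (fun s : R => s / t) t^-1.
  apply/is_derive_epsP => e e0; exists 1 => // h _.
  have -> : (z.2 + h *: 1) / t - z.2 / t - h / t = 0.
    by rewrite /GRing.scale /=; ring.
  by rewrite normr0 mulr_ge0 // ltW.
have D n : is_derive z.2 (1 : R) (fun s : R => (s / t) ^+ n.+1)
    (n.+1%:R * (z.2 / t) ^+ n / t).
  elim: n => [|n IH].
    by rewrite expr0 mulr1 mul1r; under eq_fun do rewrite expr1.
  have -> : (fun s : R => (s / t) ^+ n.+2) =
     (fun s : R => s / t) * (fun s : R => (s / t) ^+ n.+1).
    by apply/funext => s; rewrite exprS.
  have -> : n.+2%:R * (z.2 / t) ^+ n.+1 / t =
    (z.2 / t) *: (n.+1%:R * (z.2 / t) ^+ n / t) + (z.2 / t) ^+ n.+1 *: t^-1.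
    by rewrite /GRing.scale /= exprS -(natr1 n.+1); ring.
  exact: is_deriveM.
have [dD vD] := D m.
have -> : (fun s : R => barrier eta t m (z.1, s)) = eta \*o (fun s : R => (s / t) ^+ m.+1).
  by [].
by rewrite deriveMl // vD.
Qed.

(** A quadratic function of [x - z + s v], moving with velocity [- v], whose
    coefficient is itself quadratic in time, plus an affine function. *)
Definition paraboloid (k0 : R) g (z : 'rV[R]_d) v (kap a0 a1 a2 s0 : R) (N : 'M[R]_d)
    (y : 'rV[R]_d * R) : R :=
  k0 + dot g (y.1 - z) + kap * y.2 +
  (a0 + a1 * (y.2 - s0) + a2 * (y.2 - s0) ^+ 2) / 2 *
    dot ((y.1 - z + y.2 *: v) *m N) (y.1 - z + y.2 *: v).

Lemma Ck_paraboloid k k0 g (z : 'rV[R]_d) v kap a0 a1 a2 s0 N :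
  Ck k (paraboloid k0 g z v kap a0 a1 a2 s0 N).
Proof.
have Ct : Ck k (fun y : 'rV[R]_d * R => y.2) by exact: Ck_time.
have Cc (c : R) : Ck k (fun _ : 'rV[R]_d * R => c) by exact: Ck_cst.
apply: Ck_add; first apply: Ck_add; first apply: Ck_add => //.
- have -> : (fun y : 'rV[R]_d * R => dot g (y.1 - z)) =
     (fun y => dot g (y.1 - z + y.2 *: 0)).
    by apply/funext => y; rewrite scaler0 addr0.
  by apply: Ck_dot => i; [exact: Ck_cst | exact: Ck_coord_st].
- exact: Ck_mul.
apply: Ck_mul; last by apply: Ck_form => i; exact: Ck_coord_st.
apply: Ck_mul => //; apply: Ck_add; first by apply: Ck_add => //; apply: Ck_mul => //; exact: Ck_sub.
by apply: Ck_mul => //; apply: Ck_exp; exact: Ck_sub.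
Qed.

Lemma paraboloid_derivatives k0 g (z : 'rV[R]_d) v kap a0 a1 a2 s0 (N : 'M[R]_d) x w :
  N^T = N -> w = x - z + s0 *: v ->
  grad (slice (paraboloid k0 g z v kap a0 a1 a2 s0 N) s0) x = g + a0 *: (w *m N) /\
  dt (paraboloid k0 g z v kap a0 a1 a2 s0 N) (x, s0) = kap + a1 / 2 * dot (w *m N) w + a0 * dot (w *m N) v.
Proof.
move=> sN wE; set P := paraboloid _ _ _ _ _ _ _ _ _ _.
apply: (@grad_dt_expansion _ _ P (x, s0)); first exact: Ck_paraboloid.
move=> xi c; have [ze zeE] : exists ze, ze = xi + c *: v by eexists.
pose A := dot (w *m N) ze; pose Z := dot (ze *m N) ze; pose q := dot (w *m N) w.
pose c0 := (a0 * Z + 2 * a1 * c * A + a2 * c ^+ 2 * q) / 2.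
pose c1 := (a1 * c * Z + 2 * a2 * c ^+ 2 * A) / 2.
pose c2 := a2 * c ^+ 2 * Z / 2.
exists (`|c0| + `|c1| + `|c2|) => h h1.
have E : P (x + h *: xi, s0 + h * c) - P (x, s0) -
    h * (dot (g + a0 *: (w *m N)) xi +
      c * (kap + a1 / 2 * dot (w *m N) w + a0 * dot (w *m N) v)) =
    h ^+ 2 * (c0 + h * c1 + h ^+ 2 * c2).
  rewrite /P /paraboloid /= -wE.
  have -> : x + h *: xi - z + (s0 + h * c) *: v = w + h *: ze.
    by rewrite wE zeE; apply/rowP => i; rewrite !mxE; ring.
  have -> : x + h *: xi - z = (x - z) + h *: xi by rewrite addrAC.
  have -> : dot ((w + h *: ze) *m N) (w + h *: ze) = q + 2 * h * A + h ^+ 2 * Z.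
    rewrite mulmxDl -scalemxAl dotDl !dotDr !dotZl !dotZr (dot_sym ze w sN).
    by rewrite /q /A /Z; ring.
  have AE : A = dot (w *m N) xi + c * dot (w *m N) v.
    by rewrite /A zeE dotDr dotZr.
  have -> : dot (g + a0 *: (w *m N)) xi = dot g xi + a0 * (A - c * dot (w *m N) v).
    by rewrite dotDl dotZl AE; ring.
  rewrite [dot g (_ + _)]dotDr dotZr -/q /c0 /c1 /c2.
  by field.
rewrite {}E normrM ger0_norm ?sqr_ge0 // mulrC ler_wpM2r ?sqr_ge0 //.
have hh : `|h ^+ 2| <= 1 by rewrite normrX expr2 mulr_ile1.
apply: (le_trans (ler_normD _ _)); apply: lerD.
  apply: (le_trans (ler_normD _ _)); rewrite lerD2l normrM.
  by rewrite ler_piMl.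
by rewrite normrM ler_piMl.
Qed.

Lemma bernoulli (r : R) n : 0 <= r -> 1 + n%:R * r <= (1 + r) ^+ n.
Proof.
move=> r0; elim: n => [|n IH]; first by rewrite mul0r addr0 expr0.
rewrite exprS; have r1 : 0 <= 1 + r by lra.
apply: le_trans (ler_wpM2l r1 IH); rewrite -natr1.
have : 0 <= n%:R * (r * r) by rewrite !mulr_ge0.
lra.
Qed.

Lemma pow_large (X a : R) : 1 < a -> exists m : nat, X < a ^+ m.+1.
Proof.
move=> a1; have a0 : 0 < a - 1 by lra.
exists (Num.truncn (X / (a - 1))).
set m := Num.truncn _; have := Num.Theory.truncnS_gt (X / (a - 1)).
rewrite -/m ltr_pdivrMr // => h; apply: (lt_trans h).
have := @bernoulli (a - 1) m.+1 (ltW a0); rewrite [1 + (a - 1)]addrC subrK; lra.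
Qed.

End TestFunctions.

(** * A lower bound for supersolutions *)

Section SupersolutionBound.
Context {R : realType} {d : nat}.
Variables (H : 'rV[R]_d -> R) (th Th : R).
Hypotheses (C2 : Ck 2 H) (th0 : 0 < th) (Th0 : 0 < Th).
Hypothesis Hlo : forall p v, th * dot v v <= hform H p v v.
Hypothesis Hhi : forall p v, hform H p v v <= Th * dot v v.
Implicit Types (p q v w x y z h : 'rV[R]_d) (s t T : R).

Local Notation b := (grad H).
Local Notation L := (legendre C2 th0 Th0 Hlo Hhi).

Variable u : 'rV[R]_d * R -> R.
Hypotheses (buc_u : buc_spacetime u) (visc_u : viscosity_solution H u).

Lemma near_time x s T : 0 < s < T ->
  \forall z \near (x, s), 0 <= z.2 <= T.
Proof.
move=> /andP[s0 sT]; apply/nbhs_ballP; exists (Num.min s (T - s)).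
  by rewrite /= lt_min s0 subr_gt0.
move=> [y t]; rewrite -ball_normE /= lt_min => /andP[h1 h2].
have h := snd_norm_le ((x, s) - (y, t)).
have {h1} := le_lt_trans h h1; have {h2} := le_lt_trans h h2.
rewrite -[(_ - _).2]/(s - t) !ltr_norml => /andP[a1 a2] /andP[a3 a4].
by apply/andP; split; lra.
Qed.

Lemma dot_split (x y : 'rV[R]_d) : dot x x / 2 <= dot (x - y) (x - y) + dot y y.
Proof.
have := dot_ge0 (x - y - y); rewrite !dotBl !dotBr (dotC y x); lra.
Qed.

(** A supersolution of [u_t = H(Du)] is one of the transport equation
    [u_t = (v, Du) - L(v)], hence does not fall below the payoff of [v]. *)
Lemma supersolution_ge x t v : 0 < t ->
  slice u 0 (x + t *: v) - t * L v <= u (x, t).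
Proof.
move=> t0; have [z zE] : exists z, z = x + t *: v by eexists.
rewrite -zE leNgt; apply/negP => gap.
pose del : R := slice u 0 z - t * L v - u (x, t).
have del0 : 0 < del by rewrite subr_gt0.
have T0 : 0 < 2 * t by rewrite mulr_gt0.
have [[M HM] /(_ (del / 3))[|r r0 Hr]] := buc_u T0; first by rewrite divr_gt0.
have inT s : 0 <= s <= 2 * t -> forall y, `|u (y, s)| <= M by move=> hs y; apply: HM.
have t_in : 0 <= t <= 2 * t by rewrite ltW //=; lra.
have z_in : 0 <= (0 : R) <= 2 * t by rewrite lexx ltW.
have M0 : 0 <= M by apply: le_trans (inT t t_in x).
pose eta : R := del / 3; have eta0 : 0 < eta by rewrite divr_gt0.
pose K : R := (2 * M + `|t * L v| + eta + 1) / r ^+ 2.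
have rr : 0 < r ^+ 2 by rewrite exprn_gt0.
have K0 : 0 < K by rewrite divr_gt0 // ltr_wpDl // !addr_ge0 // ?mulr_ge0 // ltW.
pose A : R := 2 * t * `|L v| + M + K * (2 * dot z z + 8 * t ^+ 2 * dot v v).
have one2 : 1 < 2 :> R by rewrite ltr1n.
have [m Hm] := pow_large ((A + M + `|t * L v| + eta) / eta) one2.
pose P := paraboloid 0 0 z v (- L v) (- (2 * K)) 0 0 0 1%:M.
pose phi (Y : 'rV[R]_d * R) : R := P Y + barrier (- eta) t m Y.
have phiE y s : phi (y, s) = - s * L v - K * dot (y - z + s *: v) (y - z + s *: v)
   - eta * (s / t) ^+ m.+1.
  by rewrite /phi /P /paraboloid /barrier /= mulmx1 dot0l; field.
have Cphi k : Ck k phi by apply: Ck_add; [exact: Ck_paraboloid | exact: Ck_barrier].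
pose f (Y : 'rV[R]_d * R) : R := phi Y - u (Y.1, clamp (2 * t) Y.2).
have cf : continuous f.
  apply: (@Ck_cont _ _ 0); apply: Ck_sub => //; split=> //.
  exact: buc_clamp_cont.
have fE y s : 0 <= s <= 2 * t -> f (y, s) = phi (y, s) - u (y, s).
  by move=> hs; rewrite /f /= clamp_id.
have fA y s : 0 <= s <= 2 * t -> f (y, s) <= A - K / 2 * dot y y - eta * (s / t) ^+ m.+1.
  move=> hs; rewrite fE // phiE; have := inT s hs y.
  rewrite ler_norml => /andP[hM _]; case/andP: hs => s0 s2.
  have h1 : - s * L v <= 2 * t * `|L v|.
    rewrite mulNr -mulrN; apply: (@le_trans _ _ (s * `|L v|)).
      by rewrite ler_wpM2l // -normrN ler_norm.
    by rewrite ler_wpM2r.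
  have h2 := dot_split y (z - s *: v).
  have ye : y - (z - s *: v) = y - z + s *: v by rewrite opprB addrA addrAC.
  rewrite ye in h2.
  have h3 : dot (z - s *: v) (z - s *: v) <= 2 * dot z z + 8 * t ^+ 2 * dot v v.
    have := dot_ge0 (z + s *: v); rewrite dotBl !dotBr dotDl !dotDr !dotZl !dotZr => h4.
    have : s * (s * dot v v) <= 4 * t ^+ 2 * dot v v.
      rewrite mulrA ler_wpM2r ?dot_ge0 //.
      have : s * s <= 2 * t * (2 * t) by rewrite ler_pM.
      rewrite expr2; lra.
    rewrite (dotC v z) in h4 *; lra.
  have h5 : K * (dot y y / 2) <=
     K * (dot (y - z + s *: v) (y - z + s *: v) + (2 * dot z z + 8 * t ^+ 2 * dot v v)).
    rewrite ler_pM2l //; by apply: (le_trans h2); rewrite lerD.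
  rewrite /A; lra.
have K2 : 0 < K / 2 by rewrite divr_gt0.
have [|y [s [hs smax]]] := @evt_strip _ _ f (2 * t) A (K / 2) cf (ltW T0) K2.
  move=> y s hs; apply: (le_trans (fA y s hs)); rewrite gerBl mulr_ge0 ?(ltW eta0) //.
  by rewrite exprn_ge0 // divr_ge0 ?(ltW t0) //; case/andP: hs.
have := smax x t t_in; rewrite [f (x, t)]fE // phiE.
have -> : x - z + t *: v = 0 by rewrite zE opprD addrA subrr add0r addNr.
rewrite dot0l mulr0 subr0 divff ?gt_eqF // expr1n mulr1 => h1.
have sA := fA y s hs; have Ky : 0 <= K / 2 * dot y y by rewrite mulr_ge0 ?dot_ge0 ?ltW.
case/andP: (hs) => s0 s2.
have tL := ler_norm (t * L v).
have uM := inT t t_in x; rewrite ler_norml in uM; case/andP: uM => uM1 uM2.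
move: s2; rewrite le_eqVlt => /orP[/eqP sE|s2].
  have E2 : s / t = 2 by rewrite sE mulfK // gt_eqF.
  rewrite E2 in sA; rewrite ltr_pdivrMr // in Hm; lra.
move: s0; rewrite le_eqVlt => /orP[/eqP sE|s0].
  rewrite -sE in h1 hs *; rewrite fE // phiE mul0r exprS !mul0r scale0r addr0 oppr0 in h1.
  have u0M := inT 0 z_in y; rewrite ler_norml in u0M; case/andP: u0M => u0M1 u0M2.
  have yz : dot (y - z) (y - z) < r ^+ 2.
    have KE : K * r ^+ 2 = 2 * M + `|t * L v| + eta + 1.
      by rewrite /K divfK // gt_eqF.
    by rewrite -(ltr_pM2l K0) KE; clearbody K eta; lra.
  have := Hr (y, 0) (z, 0) z_in z_in; rewrite -/eta.
  have yzr : `|(y, 0 : R) - (z, 0 : R)| < r.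
    rewrite [X in X < _]/Num.norm /= gt_max.
    rewrite -[(_ - _).1]/(y - z) -[(_ - _).2]/(0 - 0 : R) subrr normr0 r0 andbT.
    exact: norm_lt_dot.
  move=> /(_ yzr); rewrite ltr_norml => /andP[h2 _].
  have : 0 <= K * dot (y - z) (y - z) by rewrite mulr_ge0 ?dot_ge0 ?ltW.
  move: gap; rewrite /eta /del /slice in h1 h2 *; lra.
have [_ Hmin] := visc_u (Cphi 1%N) (z0 := (y, s)) s0.
have near_min : \forall z' \near (y, s), u (y, s) - phi (y, s) <= u z' - phi z'.
  have : 0 < s < 2 * t by rewrite s0.
  move=> /(near_time y); apply: filterS => -[y' s'] /= hs'.
  by have := smax y' s' hs'; rewrite !fE //; lra.
have := Hmin near_min; rewrite /=.
have [gE dE] := grad_dt_add (y, s) (Ck_paraboloid 1 0 0 z v (- L v) (- (2 * K)) 0 0 0 1%:M)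
  (Ck_barrier 1 (- eta) t m).
rewrite -/P -/phi /= in gE dE; rewrite {}gE {}dE.
have [w wE] : exists w, w = y - z + s *: v by eexists.
have [bg bd] := barrier_derivatives (- eta) t m (y, s); rewrite /= in bg bd.
rewrite bg bd addr0.
(* the coefficient is constant in time, so its reference time is immaterial *)
have PE : P = paraboloid 0 0 z v (- L v) (- (2 * K)) 0 0 s 1%:M.
  by apply/funext => y'; rewrite /P /paraboloid !mul0r.
have [pg pd] := paraboloid_derivatives 0 0 (- L v) (- (2 * K)) 0 0 (trmx1 _ _) wE.
rewrite PE pg pd mulmx1 add0r mul0r mul0r addr0.
have := fenchel C2 th0 Th0 Hlo Hhi (- (2 * K) *: w) v.
rewrite dotZl; have : 0 < eta * (m.+1%:R * (s / t) ^+ m / t).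
  by rewrite mulr_gt0 // divr_gt0 // mulr_gt0 ?ltr0n // exprn_gt0 // divr_gt0.
lra.
Qed.

End SupersolutionBound.

(** * Propagation for a constant Hessian *)

Section QuadraticHamiltonian.
Context {R : realType} {d : nat}.
Variables (H : 'rV[R]_d -> R) (th Th : R).
Hypotheses (C2 : Ck 2 H) (th0 : 0 < th) (Th0 : 0 < Th).
Hypothesis Hlo : forall p v, th * dot v v <= hform H p v v.
Hypothesis Hhi : forall p v, hform H p v v <= Th * dot v v.
Hypothesis Hc : forall p, hess H p = hess H 0.
Implicit Types (p q v w x y z h : 'rV[R]_d) (s t T : R).

Local Notation b := (grad H).
Local Notation L := (legendre C2 th0 Th0 Hlo Hhi).
Local Notation M0 := (hess H 0).
Local Notation N0 := (invmx (hess H 0)).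
Local Notation n v := (nform H 0 v v).

Lemma hform_const p v w : hform H p v w = hform H 0 v w.
Proof. by rewrite !hformE Hc. Qed.

Lemma nform_const p v w : nform H p v w = nform H 0 v w.
Proof. by rewrite !nformE Hc. Qed.

Lemma H_quadratic p q : H (p + q) = H p + dot (b p) q + hform H 0 q q / 2.
Proof. by have [c _ ->] := taylor2_form p q C2; rewrite hform_const. Qed.

Lemma grad_affine p : b p = b 0 + p *m M0.
Proof.
have [|gE _] := @grad_hess_expansion _ _ H p (b 0 + p *m M0) (fun v => hform H 0 v v) C2; last exact: gE.
move=> v; exists 0 => h _; rewrite mul0r.
have e1 := H_quadratic 0 (p + h *: v); have e2 := H_quadratic 0 p.
rewrite !add0r in e1 e2; rewrite e1 e2 dotDr dotZr dotDl.
rewrite [hform H 0 (p + _) _]hformDl !hformDr !hformZl !hformZr (hform_sym C2 0 v p).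
rewrite -!hformE; set D := _ - _; have -> : D = 0 by rewrite /D; field.
by rewrite normr0.
Qed.

Lemma legendre_quadratic p z : L (b p + z) = L (b p) + dot p z + n z / 2.
Proof.
have [k [zE nh nk _]] := nform_slope th0 Hlo 0 z.
have bE : b p + z = b (p + k) by rewrite [RHS]grad_affine mulmxDl -zE addrA -grad_affine.
rewrite {1}bE !legendre_grad H_quadratic -bE dotDl !dotDr -nk -nh (dotC (b p) k).
by field.
Qed.

Lemma nform_ge z : dot z z / Th <= n z.
Proof.
have := legendre_lower C2 th0 Th0 Hlo Hhi 0 z; rewrite legendre_quadratic.
have -> : dot z z / (2 * Th) = dot z z / Th / 2 by field; rewrite gt_eqF.
lra.
Qed.

Lemma trN0 : N0^T = N0.
Proof. by rewrite trmx_inv hess_sym. Qed.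

Section Solution.
Variable u : 'rV[R]_d * R -> R.
Hypotheses (buc_u : buc_spacetime u) (visc_u : viscosity_solution H u).
Variables (C : R) (C0 : 0 < C).

(** A paraboloid with second derivatives [C] times the inverse Hessian is
    carried by the equation to the explicit solution below, with [C] replaced
    by [C / (1 - C s)]; that solution serves as the test function. *)
Lemma subsolution_le x t p y0 c0 : 0 < t -> C * t < 1 ->
  (forall y, u (y, 0) <= c0 + dot p (y - y0) + C / 2 * n (y - y0)) ->
  u (x, t) <= c0 + dot p (x - y0) + t * H p +
    C / (1 - C * t) / 2 * n (x - y0 + t *: b p).
Proof.
move=> t0 Ct u0P; rewrite leNgt; apply/negP => gap.
pose a s : R := C / (1 - C * s).
pose W y s := y - y0 + s *: b p.
pose P y s := c0 + dot p (y - y0) + s * H p + a s / 2 * n (W y s).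
have {}gap : P x t < u (x, t) by exact: gap.
pose T : R := (t + C^-1) / 2.
have tC : t < C^-1 by rewrite -(ltr_pM2l C0) divff ?gt_eqF.
have tT : t < T by rewrite /T; lra.
have T0 : 0 < T by apply: lt_trans tT.
have CT : C * T < 1.
  have -> : C * T = (C * t + 1) / 2 by rewrite /T; field; rewrite gt_eqF.
  lra.
have pos s : s <= T -> 0 < 1 - C * s.
  by move=> sT; have := ler_wpM2l (ltW C0) sT; lra.
have aC s : 0 <= s <= T -> C <= a s.
  case/andP=> s0 sT; rewrite /a ler_pdivlMr ?pos // ler_piMr ?(ltW C0) //.
  by rewrite gerBl mulr_ge0 // ltW.
have [[M HM] _] := buc_u T0.
have uM y s : 0 <= s <= T -> u (y, s) <= M.
  by move=> hs; apply: le_trans (HM (y, s) hs); exact: ler_norm.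
have t_in : 0 <= t <= T by rewrite !ltW.
pose eta : R := (u (x, t) - P x t) / 2.
have eta0 : 0 < eta by rewrite divr_gt0 // subr_gt0.
pose c : R := C / (2 * Th); have cp : 0 < c by rewrite divr_gt0 // mulr_gt0.
pose A : R := M - c0 + dot p p / (2 * c) + T * `|dot p (b p)| + T * `|H p| +
  c / 2 * (2 * dot y0 y0 + 2 * T ^+ 2 * dot (b p) (b p)).
have one : 1 < T / t by rewrite ltr_pdivlMr // mul1r.
have [m Hm] := pow_large (A / eta) one.
pose f (Y : 'rV[R]_d * R) : R := u (Y.1, clamp T Y.2) - (c0 + dot p (Y.1 - y0) + H p * Y.2 +
   C / (1 - C * clamp T Y.2) / 2 * dot ((Y.1 - y0 + Y.2 *: b p) *m N0) (Y.1 - y0 + Y.2 *: b p))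
   - barrier eta t m Y.
have cf : continuous f.
  apply: (@Ck_cont _ _ 0); apply: Ck_sub; last exact: Ck_barrier.
  apply: Ck_sub; first by split=> //; exact: buc_clamp_cont.
  have Cq := Ck_paraboloid 0 c0 p y0 (b p) (H p) 2 0 0 0 N0.
  have Cl := Ck_paraboloid 0 c0 p y0 (b p) (H p) 0 0 0 0 N0.
  apply: Ck_add.
    have -> : (fun Y : 'rV[R]_d * R => c0 + dot p (Y.1 - y0) + H p * Y.2) =
       paraboloid c0 p y0 (b p) (H p) 0 0 0 0 N0.
      by apply/funext => Y; rewrite /paraboloid !mul0r addr0 addr0 !mul0r addr0.
    exact: Cl.
  apply: Ck_mul; last by apply: Ck_form => i; exact: Ck_coord_st.
  apply: Ck_mul; last exact: Ck_cst.
  apply: Ck_mul; first exact: Ck_cst.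
  split=> // Y; apply: cvgV.
    by rewrite gt_eqF // pos // (andP (clamp_in Y.2 (ltW T0))).2.
  apply: cvgB; first exact: cvg_cst.
  apply: cvgM; first exact: cvg_cst.
  apply: (@cvg_comp _ _ _ snd (clamp T)); first exact: cvg_snd.
  exact: clamp_cont.
have fE y s : 0 <= s <= T -> f (y, s) = u (y, s) - P y s - eta * (s / t) ^+ m.+1.
  by move=> hs; rewrite /f /P /a /W /barrier /= clamp_id // nformE (mulrC s (H p)).
have fA y s : 0 <= s <= T ->
    f (y, s) <= A - c / 4 * dot y y - eta * (s / t) ^+ m.+1.
  move=> hs; rewrite fE // /P; have h1 := uM y s hs; case/andP: (hs) => s0 sT.
  have [w wE] : exists w, w = W y s by eexists.
  rewrite -wE; have n0 : 0 <= n w by exact: (nform_ge0 th0 Hlo).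
  have h2 : C * n w <= a s * n w by rewrite ler_wpM2r // aC.
  have h3 : c * dot w w <= C / 2 * n w.
    have -> : c * dot w w = C / 2 * (dot w w / Th) by rewrite /c; field; rewrite gt_eqF.
    by rewrite ler_pM2l ?divr_gt0 // nform_ge.
  have yE : y - y0 = w - s *: b p by rewrite wE /W addrK.
  have h4 := young w (- p) cp; rewrite dotNr dotNl dotNr opprK in h4.
  have h5 : s * dot p (b p) <= T * `|dot p (b p)|.
    apply: (@le_trans _ _ (s * `|dot p (b p)|)); last by rewrite ler_wpM2r.
    by rewrite ler_wpM2l // ler_norm.
  have h6 : - (s * H p) <= T * `|H p|.
    rewrite -mulrN; apply: (@le_trans _ _ (s * `|H p|)); last by rewrite ler_wpM2r.
    by rewrite ler_wpM2l // -normrN ler_norm.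
  have h7 := dot_split y (y0 - s *: b p).
  have yw : y - (y0 - s *: b p) = w by rewrite wE /W opprB addrA addrAC.
  rewrite yw in h7.
  have h8 : dot (y0 - s *: b p) (y0 - s *: b p) <=
      2 * dot y0 y0 + 2 * T ^+ 2 * dot (b p) (b p).
    have := dot_ge0 (y0 + s *: b p).
    rewrite dotBl !dotBr dotDl !dotDr !dotZl !dotZr (dotC (b p) y0) => h9.
    have : s * (s * dot (b p) (b p)) <= T ^+ 2 * dot (b p) (b p).
      by rewrite mulrA expr2 ler_wpM2r ?dot_ge0 // ler_pM.
    lra.
  have h10 : c / 2 * (dot y y / 2) <=
     c / 2 * (dot w w + (2 * dot y0 y0 + 2 * T ^+ 2 * dot (b p) (b p))).
    by rewrite ler_pM2l ?(divr_gt0 cp) //; apply: (le_trans h7); rewrite lerD2l.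
  rewrite yE dotBr dotZr (dotC p w) /A.
  move: h4 h5; move: (dot w p) (dot p (b p)) => X1 X2 h4 h5.
  clearbody c a; lra.
have c4 : 0 < c / 4 by rewrite divr_gt0.
have [|y [s [hs smax]]] := @evt_strip _ _ f T A (c / 4) cf (ltW T0) c4.
  move=> y s hs; apply: (le_trans (fA y s hs)); rewrite gerBl mulr_ge0 ?(ltW eta0) //.
  by rewrite exprn_ge0 // divr_ge0 ?(ltW t0) //; case/andP: hs.
have := smax x t t_in; rewrite [f (x, t)]fE // divff ?gt_eqF // expr1n mulr1.
have -> : u (x, t) - P x t - eta = eta by rewrite /eta; field.
move=> h1; have sA := fA y s hs.
have Ky : 0 <= c / 4 * dot y y by rewrite mulr_ge0 ?dot_ge0 ?ltW.
case/andP: (hs) => s0 s2; move: s2; rewrite le_eqVlt => /orP[/eqP sE|s2].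
  by rewrite sE in sA h1 *; rewrite ltr_pdivrMr // in Hm; lra.
move: s0; rewrite le_eqVlt => /orP[/eqP sE|s0].
  move: h1; rewrite fE // -sE mul0r exprS !mul0r mulr0 subr0 /P /a /W.
  rewrite mulr0 subr0 divr1 mul0r addr0 scale0r addr0.
  have := u0P y; lra.
have [Hmax _] := visc_u (phi := fun Y => paraboloid c0 p y0 (b p) (H p) (a s) (a s ^+ 2)
    (a s ^+ 2 * a T) s N0 Y + barrier eta t m Y)
    (Ck_add (Ck_paraboloid 1 _ _ _ _ _ _ _ _ _ _) (Ck_barrier 1 _ _ _)) (z0 := (y, s)) s0.
have aT0 : 0 <= a T by rewrite divr_ge0 ?(ltW C0) // ltW // pos.
(* a smooth majorant of the coefficient [a], exact to first order at [s] *)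
have major s' : 0 <= s' <= T ->
    a s' <= a s + a s ^+ 2 * (s' - s) + a s ^+ 2 * a T * (s' - s) ^+ 2.
  move=> /andP[s'0 s'T]; have p1 := pos s' s'T; have p2 := pos s (ltW s2).
  have -> : a s' = a s + a s ^+ 2 * (s' - s) + a s ^+ 2 * a s' * (s' - s) ^+ 2.
    by rewrite /a; field; rewrite !gt_eqF.
  rewrite lerD2l ler_wpM2r ?sqr_ge0 // ler_wpM2l ?sqr_ge0 //.
  rewrite /a ler_pM2l // lef_pV2 ?posrE ?pos // lerD2l lerN2 ler_pM2l //.
have near_max : \forall z' \near (y, s), u z' -
    (paraboloid c0 p y0 (b p) (H p) (a s) (a s ^+ 2) (a s ^+ 2 * a T) s N0 z' + barrier eta t m z') <=
    u (y, s) - (paraboloid c0 p y0 (b p) (H p) (a s) (a s ^+ 2) (a s ^+ 2 * a T) s N0 (y, s)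
     + barrier eta t m (y, s)).
  have : 0 < s < T by rewrite s0.
  move=> /(near_time y); apply: filterS => -[y' s'] /= hs'.
  have := smax y' s' hs'; rewrite !fE // /P /W /paraboloid /barrier /= -!nformE.
  rewrite subrr mulr0 expr0n /= mulr0 !addr0.
  have := ler_wpM2r (nform_ge0 th0 Hlo 0 (y' - y0 + s' *: b p)) (major s' hs').
  rewrite (mulrC s') (mulrC s).
  move: (n (y' - _ + _)) (n (y - _ + _)) (dot p (y' - _)) (dot p (y - _)) => X1 X2 X3 X4.
  move: (eta * _) (eta * _) (u (y', s')) (u (y, s)) (a s') => X5 X6 X7 X8 X9.
  move: (a s + a s ^+ 2 * (s' - s) + _) => X10 h2 h3; lra.
have := Hmax near_max; rewrite /=.
have [gE dE] := grad_dt_add (y, s)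
  (Ck_paraboloid 1 c0 p y0 (b p) (H p) (a s) (a s ^+ 2) (a s ^+ 2 * a T) s N0)
  (Ck_barrier 1 eta t m).
rewrite /= in gE dE; rewrite {}gE {}dE.
have [w wE] : exists w, w = y - y0 + s *: b p by eexists.
have [bg bd] := barrier_derivatives eta t m (y, s); rewrite /= in bg bd.
rewrite bg bd addr0.
have [pg pd] := paraboloid_derivatives c0 p (H p) (a s) (a s ^+ 2) (a s ^+ 2 * a T) trN0 wE.
rewrite pg pd -!nformE H_quadratic dotZr hformZl hformZr.
have -> : hform H 0 (w *m N0) (w *m N0) = n w.
  by rewrite hformE mulmxKV ?(hess_unit th0 Hlo) // nformE dotC.
rewrite (dotC (b p)) -nformE.
have : 0 < eta * (m.+1%:R * (s / t) ^+ m / t).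
  by rewrite mulr_gt0 // divr_gt0 // mulr_gt0 ?ltr0n // exprn_gt0 // divr_gt0.
move: (n w) (nform H 0 w (b p)) (a s) => X1 X2 X3; rewrite expr2; lra.
Qed.

(** Where the data are touched from above by some paraboloid of slope [p], the
    viscosity bound improves its opening to [C]. Let [g] be the difference with
    the improved paraboloid, and suppose [g e > 0]. On the segment from [0] to
    [e] it is at least [par] at both ends, but not near [0], where it grows at
    most quadratically. Lowering [par] off the segment by a steep paraboloid
    gives a function touching [g] from below inside, with positive second
    derivative along [e]: this contradicts the bound on the data. *)
Lemma semiconcave_at (v : 'rV[R]_d -> R) M p y0 c1 : continuous v ->
  (forall y, `|v y| <= M) -> visc_FD2F_ge H v (- C) ->
  (forall y, v y <= v y0 + dot p (y - y0) + c1 * n (y - y0)) ->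
  forall y, v y <= v y0 + dot p (y - y0) + C / 2 * n (y - y0).
Proof.
move=> cv vM vv vc1 y1; rewrite leNgt; apply/negP => gap.
have [e eE] : exists e, e = y1 - y0 by eexists.
have y1E : y1 = y0 + e by rewrite eE subrKC.
pose g y : R := v (y0 + y) - v y0 - dot p y - C / 2 * n y.
have ge0 : 0 < g e by rewrite /g -y1E eE; rewrite -eE in gap *; lra.
have g0 : g 0 = 0 by rewrite /g addr0 dot0r nformE dot0r; ring.
have cg : continuous g.
  apply: (@Ck_cont _ _ 0); rewrite /g.
  have Cid i : Ck 0 (fun y : 'rV[R]_d => y 0 i).
    have -> : (fun y : 'rV[R]_d => y 0 i) = (fun y => (y - 0) 0 i).
      by apply/funext => y; rewrite subr0.
    exact: Ck_coord.
  apply: Ck_sub; last first.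
    apply: Ck_mul; first exact: Ck_cst.
    have -> : (fun y : 'rV[R]_d => n y) = (fun y => dot (y *m N0) y).
      by apply/funext => y; rewrite nformE.
    exact: Ck_form.
  apply: Ck_sub; last by apply: Ck_dot => // i; exact: Ck_cst.
  apply: Ck_sub; last exact: Ck_cst.
  split=> // y; apply/cont_at_eps => eps eps0.
  have /cont_at_eps /(_ _ eps0)[r r0 Hr] := cv (y0 + y).
  by exists r => // w /Hr; rewrite -addrA.
pose K1 : R := 2 * M + dot p p / 2 + 1 / 2 + C / (2 * th).
have Mp : 0 <= M by apply: le_trans (vM 0).
have Cth : 0 <= C / (2 * th) by rewrite divr_ge0 ?mulr_ge0 ?ltW.
have K10 : 0 <= K1 by have := dot_ge0 p; rewrite /K1; lra.
have glow y : - (K1 * (1 + dot y y)) <= g y.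
  have := vM (y0 + y); have := vM y0; rewrite !ler_norml => /andP[_ h1] /andP[h2 _].
  have h3 := young p y ltr01; have h4 := nform_le th0 Hlo 0 y.
  have h5 : C / 2 * n y <= C / (2 * th) * dot y y.
    have -> : C / (2 * th) * dot y y = C / 2 * (dot y y / th).
      by field; rewrite gt_eqF.
    by rewrite ler_wpM2l // divr_ge0 // ltW.
  have d0 := dot_ge0 y; have := mulr_ge0 Mp d0; have := mulr_ge0 (dot_ge0 p) d0.
  have := mulr_ge0 Cth d0.
  rewrite /g /K1; lra.
(* vanishes at 0 with positive slope, and equals [g e] at 1 *)
pose k := g e; pose par s : R := k * (s + s ^+ 2) / 2.
pose c2 := `|c1 - C / 2| * n e + k.
have ne0 : 0 <= n e by exact: (nform_ge0 th0 Hlo).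
have c20 : 0 < c2 by rewrite ltr_wpDl // mulr_ge0.
pose s1 : R := k / (4 * c2).
have s10 : 0 < s1 by rewrite divr_gt0 // mulr_gt0.
have s11 : s1 <= 1.
  rewrite ler_pdivrMr ?mulr_gt0 // mul1r /c2.
  have : 0 <= `|c1 - C / 2| * n e by rewrite mulr_ge0.
  have : 0 < k by []; lra.
pose m := k * s1 / 4; have m0 : 0 < m by rewrite divr_gt0 // mulr_gt0.
have neg : g (s1 *: e) - par s1 <= - m.
  have h1 : g (s1 *: e) <= (c1 - C / 2) * (s1 * (s1 * n e)).
    have := vc1 (y0 + s1 *: e); rewrite /g (addrAC y0) subrr add0r nformZl nformZr; lra.
  have h2 : (c1 - C / 2) * (s1 * (s1 * n e)) <= `|c1 - C / 2| * (s1 * (s1 * n e)).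
    by rewrite ler_wpM2r ?ler_norm ?(mulr_ge0 (ltW s10) (mulr_ge0 (ltW s10) ne0)).
  have h3 : s1 * (4 * c2) = k by rewrite /s1 divfK // gt_eqF // mulr_gt0.
  have h4 : 0 <= k * s1 ^+ 2 by rewrite mulr_ge0 ?sqr_ge0 // ltW.
  have h5 : `|c1 - C / 2| * (s1 * (s1 * n e)) <= s1 * (s1 * c2).
    rewrite mulrCA ler_wpM2l ?(ltW s10) // mulrCA ler_wpM2l ?(ltW s10) //.
    by rewrite /c2 lerDl ltW.
  have h6 : s1 * (s1 * c2) = k * s1 / 4 by rewrite -[in RHS]h3; field.
  rewrite /par /m; lra.
(* [g] drops by less than [m] near [y], and further away a steep paraboloid
   makes up for its quadratic growth *)
have penal y : 0 <= g y -> exists2 l0 : R, 0 < l0 & forall l w, l0 <= l ->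
    - m < g (y + w) - g y + l * dot w w.
  move=> gy; have /cont_at_eps /(_ _ m0)[r r0 Hr] := cg y.
  have rr : 0 < r ^+ 2 by rewrite exprn_gt0.
  have [B BE] : exists B, B = K1 * (1 + 2 * dot y y) + g y by eexists.
  have B0 : 0 <= B.
    by rewrite BE addr_ge0 // mulr_ge0 // addr_ge0 // mulr_ge0 // dot_ge0.
  exists (B / r ^+ 2 + 2 * K1 + 1).
    by rewrite ltr_wpDl // addr_ge0 ?divr_ge0 ?mulr_ge0 // ltW.
  move=> l w ll; have w0 := dot_ge0 w.
  have hl := ler_wpM2r w0 ll.
  have Bd : 0 <= B / r ^+ 2 * dot w w by rewrite mulr_ge0 // divr_ge0 // ltW.
  have Kd : 0 <= K1 * dot w w by rewrite mulr_ge0.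
  have [wr|wr] := ltP `|w| r.
    have := Hr w wr; rewrite ltr_norml => /andP[h1 _]; lra.
  have h1 := glow (y + w).
  have h2 : dot (y + w) (y + w) <= 2 * dot y y + 2 * dot w w.
    have := dot_ge0 (y - w); rewrite dotBl !dotBr dotDl !dotDr (dotC w y); lra.
  have h3 : K1 * (1 + dot (y + w) (y + w)) <= B - g y + 2 * K1 * dot w w.
    have := ler_wpM2l K10 h2; rewrite BE; lra.
  have h4 : B <= B / r ^+ 2 * dot w w.
    rewrite mulrAC ler_pdivlMr // ler_wpM2l //; apply: le_trans (norm_sqr_le_dot w).
    by rewrite ler_sqr ?nnegrE // ltW.
  lra.
have [|l0 l00 Hl0] := penal 0; first by rewrite g0.
have [l1 l10 Hl1] := penal e (ltW ge0).
pose l : R := l0 + l1 + 2 * K1 + 1.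
have ll0 : l0 <= l by rewrite /l; lra.
have ll1 : l1 <= l by rewrite /l; lra.
pose f (Y : 'rV[R]_d * R) : R := par Y.2 - g (Y.2 *: e + Y.1) - l * dot Y.1 Y.1.
have cf : continuous f.
  have Cc i : Ck 0 (fun Y : 'rV[R]_d * R => Y.1 0 i).
    have -> : (fun Y : 'rV[R]_d * R => Y.1 0 i) = (fun Y => (Y.1 - 0 + Y.2 *: 0) 0 i).
      by apply/funext => Y; rewrite subr0 scaler0 addr0.
    exact: Ck_coord_st.
  apply: (@Ck_cont _ _ 0); apply: Ck_sub; last first.
    by apply: Ck_mul; [exact: Ck_cst | exact: Ck_dot].
  apply: Ck_sub.
    apply: Ck_mul; last exact: Ck_cst.
    apply: Ck_mul; first exact: Ck_cst.
    by apply: Ck_add; [exact: Ck_time | apply: Ck_exp; exact: Ck_time].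
  split=> // Y; apply: (@cvg_comp _ _ _ (fun Y : 'rV[R]_d * R => Y.2 *: e + Y.1) g).
    apply: cvgD; last exact: cvg_fst.
    by apply: cvgZr_tmp; exact: cvg_snd.
  exact: cg.
have fA w s : 0 <= s <= 1 -> f (w, s) <= k + K1 * (1 + 2 * dot e e) - 1 * dot w w.
  move=> /andP[s0 s_1]; rewrite /f /=.
  have h1 := glow (s *: e + w).
  have h2 : dot (s *: e + w) (s *: e + w) <= 2 * dot e e + 2 * dot w w.
    have := dot_ge0 (s *: e - w).
    rewrite dotBl !dotBr dotDl !dotDr !dotZl !dotZr (dotC w e) => h3.
    have : s * (s * dot e e) <= dot e e.
      rewrite mulrA ler_piMl ?dot_ge0 //; exact: mulr_ile1.
    lra.
  have h3 := ler_wpM2l K10 h2.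
  have h4 : par s <= k.
    have k0 : 0 <= k by exact: ltW.
    have ss : s + s ^+ 2 <= 2.
      have : s * s <= 1 by exact: mulr_ile1.
      rewrite expr2; lra.
    have := ler_wpM2l k0 ss; rewrite /par; lra.
  have w0 := dot_ge0 w; have h5 : (2 * K1 + 1) * dot w w <= l * dot w w.
    by rewrite ler_wpM2r // /l; lra.
  lra.
have [w [s [hs smax]]] := evt_strip cf ler01 ltr01 fA.
have fm : m <= f (w, s).
  have s1_in : 0 <= s1 <= 1 by rewrite ltW.
  apply: le_trans (smax 0 s1 s1_in); rewrite /f /= addr0 dot0l mulr0 subr0.
  move: neg; lra.
case/andP: (hs) => s0 s_1; move: s0; rewrite le_eqVlt => /orP[/eqP sE|s0].
  move: fm; rewrite -sE /f /= scale0r /par expr0n /= addr0 mulr0 mul0r sub0r.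
  have := Hl0 l w ll0; rewrite add0r g0; lra.
move: s_1; rewrite le_eqVlt => /orP[/eqP sE|s_1].
  move: fm; rewrite sE /f /= scale1r /par expr1n.
  have := Hl1 l w ll1; rewrite -/k; lra.
have e0 : e != 0.
  by apply/negP => /eqP e0; move: ge0; rewrite e0 g0 ltxx.
have ee : 0 < dot e e by rewrite dot_gt0.
have [a aE] : exists a, a = (dot e e)^-1 *: e by eexists.
have ae : dot e a = 1 by rewrite aE dotZr mulVf // gt_eqF.
have [E EE] : exists E : 'M[R]_d, forall z, z *m E = z - dot z a *: e.
  exists (1%:M - a^T *m e) => z.
  by rewrite mulmxBr mulmx1 mulmxA [z *m a^T]mx11_scalar mul_scalar_mx.
have [ys ysE] : exists ys, ys = s *: e + w by eexists.
pose B : 'M[R]_d := C *: N0 + k *: (a^T *m a) - (2 * l) *: (E *m E^T).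
have BE z : dot (z *m B) z = C * n z + k * dot z a ^+ 2
    - 2 * l * dot (z - dot z a *: e) (z - dot z a *: e).
  have e1 : dot (z *m (a^T *m a)) z = dot z a ^+ 2.
    by rewrite mulmxA [z *m a^T]mx11_scalar mul_scalar_mx dotZl -/(dot z a) (dotC a z) expr2.
  have e2 : dot (z *m (E *m E^T)) z = dot (z - dot z a *: e) (z - dot z a *: e).
    by rewrite -EE mulmxA [LHS]dot_mulmx trmxK.
  by rewrite -e1 -e2 nformE /B mulmxBr mulmxDr dotBl dotDl -!scalemxAr !dotZl.
pose G := p + C *: (ys *m N0) + (k * (1 + 2 * s) / 2) *: a - (2 * l) *: (w *m E^T).
have [r r0 Hr] : exists2 r : R, 0 < r & forall z : 'rV[R]_d, `|z| < r ->
    0 <= s + dot z a <= 1.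
  pose D : R := d%:R * `|a| + 1; have D0 : 0 < D by rewrite ltr_wpDl // mulr_ge0.
  exists (Num.min s (1 - s) / D).
    by rewrite divr_gt0 // lt_min s0 subr_gt0.
  move=> z; rewrite ltr_pdivlMr // lt_min => /andP[z1 z2].
  have : `|dot z a| <= `|z| * D.
    apply: (le_trans (dot_le_norm z a)); rewrite /D.
    have := normr_ge0 z; lra.
  by rewrite ler_norml => /andP[h1 h2]; apply/andP; split; lra.
have Hquad z : `|z| < r ->
    v (y0 + ys) + dot G z + dot (z *m B) z / 2 <= v (y0 + ys + z).
  move=> /Hr hz; have := smax (w + (z - dot z a *: e)) (s + dot z a) hz; rewrite /f /=.
  have -> : (s + dot z a) *: e + (w + (z - dot z a *: e)) = ys + z.
    by rewrite ysE; apply/rowP => i; rewrite !mxE; ring.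
  rewrite -ysE; have [zz zzE] : exists zz, zz = z - dot z a *: e by eexists.
  rewrite -zzE BE -zzE /g -(addrA y0 ys z).
  have -> : dot (w + zz) (w + zz) = dot w w + 2 * dot w zz + dot zz zz.
    by rewrite dotDl !dotDr (dotC zz w); ring.
  have -> : n (ys + z) = n ys + 2 * nform H 0 ys z + n z.
    by rewrite nformDl !nformDr (nformC C2 0 z ys); ring.
  have -> : dot G z = dot p z + C * nform H 0 ys z + k * (1 + 2 * s) / 2 * dot z a
       - 2 * l * dot w zz.
    rewrite /G dotBl !dotDl !dotZl nformE (dotC a z); congr (_ - _ * _).
    by rewrite dot_mulmx trmxK EE -zzE.
  rewrite [dot p (_ + _)]dotDr /par.
  move: (v (y0 + (ys + z))) (v (y0 + ys)) (v y0) (n ys) (n z) => X1 X2 X3 X4 X5.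
  move: (nform H 0 ys z) (dot p ys) (dot p z) (dot z a) => X6 X7 X8 X9.
  move: (dot w w) (dot w zz) (dot zz zz) => Y1 Y2 Y3.
  clearbody k l; lra.
have := visc_ge_quadratic C2 th0 Hlo vv vM r0 Hquad e.
rewrite BE ae scale1r subrr dot0l mulr0 subr0 expr1n mulr1 nform_const.
have : 0 < k by []; lra.
Qed.

End Solution.

(** Let [vh] be the best velocity for [(x0, t)]. Its optimality puts the data
    below a paraboloid of opening [1 / t] centred at the start [y0] of the path;
    [semiconcave_at] improves the opening to [C], [subsolution_le] carries the
    paraboloid to time [t] with opening [C / (1 - C t)], and by
    [supersolution_ge] it touches the solution at [x0]. *)
Lemma quadratic_propagates_ge (C : R) (u : 'rV[R]_d * R -> R) : 0 < C ->
  buc_spacetime u -> viscosity_solution H u -> propagates_ge H u C.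
Proof.
move=> C0 bu vu v0 t t0; rewrite lt_max ltxx orbF subr_gt0 => Ct.
have Ct' : 0 < 1 - C * t by rewrite subr_gt0.
rewrite (max_idPl (ltW Ct')) => phi sphi x0 Hx; apply/(mxle_FD2F C2 th0 Hlo).
pose u0 := slice u 0.
have [[M HM] _] := bu 1 ltr01.
have u0M y : `|u0 y| <= M by apply: HM; rewrite /= lexx ler01.
have cu0 : continuous u0.
  have cc := buc_clamp_cont bu ltr01.
  move=> y; apply/cont_at_eps => e e0.
  have /cont_at_eps /(_ _ e0)[r r0 Hr] := cc (y, 0).
  exists r => // w wr; have := Hr (w, 0).
  rewrite /= addr0 clamp_id ?lexx ?ler01 //; apply.
  by rewrite [X in X < _]/Num.norm /= gt_max wr normr0.
have [vh Hvh] := payoff_opt C2 th0 Th0 Hlo Hhi u0M x0 cu0 (ltW t0).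
pose p := slope C2 th0 Th0 Hlo Hhi vh; have bp : b p = vh by exact: grad_slope.
have [y0 y0E] : exists y0, y0 = x0 + t *: vh by eexists.
have above y : u0 y <= u0 y0 + dot p (y - y0) + (2 * t)^-1 * n (y - y0).
  have := Hvh (vh + t^-1 *: (y - y0)); rewrite /payoff -y0E scalerDr scalerA.
  rewrite divff ?gt_eqF // scale1r addrA -y0E subrKC -bp legendre_quadratic.
  rewrite dotZr nformZl nformZr; set X := nform _ _ _ _; set D := dot p _.
  have -> : t * (L (b p) + t^-1 * D + t^-1 * (t^-1 * X) / 2) =
     t * L (b p) + D + (2 * t)^-1 * X by field; rewrite gt_eqF.
  lra.
have P0 := semiconcave_at C0 cu0 u0M v0 above.
have uP x : u (x, t) <= u0 y0 + dot p (x - y0) + t * H p +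
    C / (1 - C * t) / 2 * n (x - y0 + t *: b p).
  exact: (subsolution_le bu vu C0 x t0 Ct P0).
have low := supersolution_ge C2 th0 Th0 Hlo Hhi bu vu x0 vh t0.
rewrite -y0E -bp legendre_grad in low.
have xy : x0 - y0 = - (t *: b p) by rewrite y0E opprD addNKr bp.
have [|gE hE] := @touching_upper _ _ phi x0 p
  (fun v => C / (1 - C * t) * nform H 0 v v) (sphi 2).
  move=> v e e0; exists 1 => // h _; have := Hx (x0 + h *: v); rewrite /slice.
  have := uP (x0 + h *: v); rewrite (addrAC x0 _ (- y0)) xy.
  have -> : - (t *: b p) + h *: v + t *: b p = h *: v by rewrite addrAC addNr add0r.
  rewrite dotDr dotNr !dotZr nformZl nformZr -/u0.
  rewrite -/(u0 y0) in low.
  have := mulr_ge0 (ltW e0) (sqr_ge0 h); rewrite !expr2.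
  set q := C / (1 - C * t); lra.
by move=> h; rewrite gE nform_const; exact: hE.
Qed.

End QuadraticHamiltonian.

(** * Reflection of the Hamiltonian *)

Section Reflection.
Context {R : realType} {d : nat}.
Implicit Types (f g H v phi : 'rV[R]_d -> R) (u psi : 'rV[R]_d * R -> R).

Definition reflection (f : 'rV[R]_d -> R) (p : 'rV[R]_d) : R := f (- p).

Lemma is_derive_reflection f x w : Ck 1 f ->
  is_derive x w (reflection f) (- 'D_w f (- x)).
Proof.
move=> Cf; apply/is_derive_epsP => e e0.
have /is_derive_epsP /(_ _ e0)[r r0 Hr] :
  is_derive (- x) w f ('D_w f (- x)) by apply: derivableP; exact: Ck_derivable Cf.
exists r => // h hr; have := Hr (- h); rewrite normrN => /(_ hr).
by rewrite /reflection opprD scaleNr mulrN mulNr.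
Qed.

Lemma derive_reflection f x w : Ck 1 f -> 'D_w (reflection f) x = - 'D_w f (- x).
Proof. by move=> Cf; case: (is_derive_reflection x w Cf). Qed.

Lemma Ck_reflection k f : Ck k f -> Ck k (reflection f).
Proof.
elim: k f => [|k IH] f Cf.
  split=> // x; apply/cont_at_eps => e e0.
  have /cont_at_eps /(_ _ e0)[r r0 Hr] :
    {for - x, continuous f} by exact: (Ck_cont Cf).
  exists r => // w wr; have := Hr (- w); rewrite normrN => /(_ wr).
  by rewrite /reflection opprD.
have C1 : Ck 1 f by exact: Ck_le Cf.
split; first exact: (Ck_cont (IH f (CkW Cf))).
move=> w; split=> [x|]; first by case: (is_derive_reflection x w C1).
have -> : (fun x => 'D_w (reflection f) x) =
    (fun x => - reflection (fun y => 'D_w f y) x).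
  by apply/funext => x; exact: derive_reflection.
by apply/Ck_opp/IH; exact: Ck_D.
Qed.

Lemma hess_reflection f x : Ck 2 f -> hess (reflection f) x = hess f (- x).
Proof.
move=> Cf; apply/matrixP => i j; rewrite [LHS]mxE [RHS]mxE.
have C1 w : Ck 1 (fun y => 'D_w f y) by exact: Ck_D.
have -> : (fun y => 'D_(basis_vec R j) (reflection f) y) =
    (fun y => - reflection (fun y => 'D_(basis_vec R j) f y) y).
  by apply/funext => y; rewrite derive_reflection //; exact: CkW.
rewrite deriveN ?derive_reflection ?opprK //.
by case: (is_derive_reflection x (basis_vec R i) (C1 (basis_vec R j))).
Qed.

Lemma gradN f x : Ck 1 f -> grad (fun y => - f y) x = - grad f x.
Proof.
move=> Cf; apply/rowP => i; rewrite !mxE deriveN //; exact: Ck_derivable Cf.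
Qed.

Lemma hessN f x : Ck 2 f -> hess (fun y => - f y) x = - hess f x.
Proof.
move=> Cf; apply/matrixP => i j; rewrite !mxE.
have -> : (fun y => 'D_(basis_vec R j) (fun y => - f y) y) =
    (fun y => - 'D_(basis_vec R j) f y).
  by apply/funext => y; rewrite deriveN //; exact: Ck_derivable Cf.
by rewrite deriveN //; exact: Ck_derivable (Ck_D (basis_vec R j) Cf).
Qed.

Lemma viscosity_solution_reflection (G : 'rV[R]_d -> R) u :
  viscosity_solution G u ->
  viscosity_solution (fun p => - G (- p)) (fun z => - u z).
Proof.
move=> vu psi Cpsi z z0; have [sub sup] := vu _ (Ck_opp Cpsi) z z0.
have gE : grad (slice (fun z => - psi z) z.2) z.1 = - grad (slice psi z.2) z.1.
  apply: dot_inj => v; rewrite dotNl !dot_grad_slice ?deriveN //.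
    exact: Ck_derivable Cpsi.
  exact: Ck_opp.
have dE : dt (fun z => - psi z) z = - dt psi z.
  by rewrite !dtE deriveN //; exact: Ck_derivable Cpsi.
rewrite gE dE in sub sup; split=> ext.
  rewrite lerNr; apply: sup; apply: filterS ext => w; lra.
rewrite lerNl; apply: sub; apply: filterS ext => w; lra.
Qed.

Lemma FD2F_reflection H phi x : Ck 2 H -> Ck 2 phi ->
  FD2F H (fun y => - phi y) x = - FD2F (reflection H) phi x.
Proof.
move=> CH Cp; rewrite /FD2F hessN // gradN ?hess_reflection //; last exact: CkW.
by rewrite mulmxN mulNmx opprK.
Qed.

Lemma mxle_opp_scalar (A : 'M[R]_d) K : mxle (- A) K%:M <-> mxle (- K)%:M A.
Proof.
by split=> AB x; have := AB x; rewrite !dot_scalar mulmxN dotNl; lra.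
Qed.

Lemma visc_le_reflection H v K : Ck 2 H -> visc_FD2F_le H v K ->
  visc_FD2F_ge (reflection H) (fun x => - v x) (- K).
Proof.
move=> CH vv phi sphi x0 ext; apply/mxle_opp_scalar.
rewrite -(FD2F_reflection _ CH (sphi 2)); apply: vv.
  by move=> k; exact: Ck_opp.
by move=> x; have := ext x; lra.
Qed.

Lemma visc_ge_reflection H v K : Ck 2 H ->
  visc_FD2F_ge (reflection H) (fun x => - v x) (- K) -> visc_FD2F_le H v K.
Proof.
move=> CH vv phi sphi x0 ext.
have Cp k : Ck k (fun y => - phi y) by exact: Ck_opp.
have phiE : phi = (fun y => - - phi y) by apply/funext => y; rewrite opprK.
rewrite {1}phiE (FD2F_reflection _ CH (Cp 2)); apply/mxle_opp_scalar.
apply: vv => // x; have := ext x; lra.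
Qed.

(** The change of unknown [u |-> - u] turns [u_t = - H(Du)] into the equation
    of the reflected Hamiltonian and exchanges the two matrix inequalities, so
    that the second propagation property is an instance of the first. *)
Lemma propagates_reflection H u C : Ck 2 H ->
  propagates_le H u C <-> propagates_ge (reflection H) (fun z => - u z) C.
Proof.
move=> CH; split=> pu v0 t t0 tC.
  by apply: visc_le_reflection => //; apply: pu => //; exact: visc_ge_reflection.
by apply: visc_ge_reflection => //; apply: pu => //; exact: visc_le_reflection.
Qed.

Lemma buc_opp u : buc_spacetime u -> buc_spacetime (fun z => - u z).
Proof.
move=> bu T T0; have [[M HM] unif] := bu T T0; split.
  by exists M => z /HM; rewrite normrN.
move=> e /unif[r r0 Hr]; exists r => // x y Xx Xy /(Hr x y Xx Xy).
by rewrite -opprD normrN.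
Qed.

Lemma lipschitz_opp (v : 'rV[R]_d -> R^o) :
  lipschitz v -> lipschitz ((fun x => - v x) : 'rV[R]_d -> R^o).
Proof.
move=> [K [Kr HK]]; exists K; split=> // k kK z zT.
by have := HK k kK z zT; rewrite /= -opprD normrN.
Qed.

End Reflection.

(** * Quadratic Hamiltonians *)

Section ConstantHessian.
Context {R : realType} {d : nat}.
Variables (H : 'rV[R]_d -> R) (th Th : R).
Hypotheses (C2 : Ck 2 H) (th0 : 0 < th) (Th0 : 0 < Th).
Hypothesis Hlo : forall p v, th * dot v v <= hform H p v v.
Hypothesis Hhi : forall p v, hform H p v v <= Th * dot v v.

Lemma hess_const_quadratic : (forall p, hess H p = hess H 0) ->
  quadratic (remove_affine H).
Proof.
move=> Hc; exists (2^-1 *: hess H 0); split.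
- by rewrite linearZ /= hess_sym.
- exists (th / 2), (Th / 2); split=> [||v|v]; rewrite ?divr_gt0 //.
    rewrite dot_scalar -scalemxAr dotZl -hformE.
    by have := Hlo 0 v; lra.
  rewrite dot_scalar -scalemxAr dotZl -hformE.
  by have := Hhi 0 v; lra.
move=> p; rewrite /remove_affine -scalemxAr dotZl -hformE.
by have := H_quadratic C2 Hc 0 p; rewrite add0r => ->; lra.
Qed.

Lemma quadratic_hess_const : quadratic (remove_affine H) ->
  forall p, hess H p = hess H 0.
Proof.
move=> [A [Asym _ HA]].
have HE p : H p = H 0 + dot (grad H 0) p + dot (p *m A) p.
  by have := HA p; rewrite /remove_affine; lra.
have diag p v : hform H p v v = 2 * dot (v *m A) v.
  have [|_ ->//] := @grad_hess_expansion _ _ H p (grad H 0 + 2 *: (p *m A))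
    (fun v => 2 * dot (v *m A) v) C2.
  move=> {}v; exists 0 => h _; rewrite mul0r (HE (p + h *: v)) (HE p).
  rewrite mulmxDl -scalemxAl !dotDr !dotDl !dotZl !dotZr.
  have -> : dot (v *m A) p = dot (p *m A) v by rewrite dot_mulmx Asym dotC.
  set D := _ - _; have -> : D = 0 by rewrite /D; field.
  by rewrite normr0.
have polar p v w : hform H p v w = 2 * dot (v *m A) w.
  have := diag p (v + w); rewrite hformDl !hformDr !diag (hform_sym C2 p w v).
  rewrite mulmxDl dotDl !dotDr.
  have -> : dot (w *m A) v = dot (v *m A) w by rewrite dot_mulmx Asym dotC.
  lra.
by move=> p; apply: mx_form_inj => i j; rewrite -[LHS]hformE -[RHS]hformE !polar.
Qed.

End ConstantHessian.

Lemma uniformly_convex_hform (R : realType) (d : nat) (H : 'rV[R]_d -> R) :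
  uniformly_convex H -> exists th Th : R, [/\ 0 < th, 0 < Th,
    forall p v, th * dot v v <= hform H p v v
  & forall p v, hform H p v v <= Th * dot v v].
Proof.
move=> [th [Th [th0 Th0 HH]]]; exists th, Th; split=> // p v; have [lo hi] := HH p.
  by have := lo v; rewrite dot_scalar -hformE.
by have := hi v; rewrite dot_scalar -hformE.
Qed.

Lemma convex_on_line_cst (R : realType) (h : R -> R) (c : R) :
  (forall l, h l = c) -> convex_on_line h.
Proof.
by move=> hc t x y _ _; rewrite !hc convmm.
Qed.

Theorem theorem1p4 (R : realType) (d : nat) (d_gt1 : (1 < d)%N)
    (H : 'rV[R]_d -> R) (H_C2 : Ck 2 H) (H_cvx : uniformly_convex H) :
  [/\ (forall (C : R) (u : 'rV[R]_d * R -> R), 0 < C ->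
         buc_spacetime u -> viscosity_solution H u ->
         lipschitz (slice u 0 : 'rV[R]_d -> R^o) ->
         propagates_ge H u C) ->
      forall p xi eta : 'rV[R]_d, dot xi eta = 0 ->
        concave_on_line
          (fun l : R => dot (eta *m hess H (p + l *: xi)) eta),
      (forall (C : R) (u : 'rV[R]_d * R -> R), 0 < C ->
         buc_spacetime u -> viscosity_solution (fun p => - H p) u ->
         lipschitz (slice u 0 : 'rV[R]_d -> R^o) ->
         propagates_le H u C) ->
      forall p xi eta : 'rV[R]_d, dot xi eta = 0 ->
        convex_on_line
          (fun l : R => dot (eta *m hess H (p + l *: xi)) eta)
    & ((forall (C : R) (u : 'rV[R]_d * R -> R), 0 < C ->
          buc_spacetime u -> viscosity_solution H u ->
          propagates_ge H u C) /\
       (forall (C : R) (u : 'rV[R]_d * R -> R), 0 < C ->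
          buc_spacetime u -> viscosity_solution (fun p => - H p) u ->
          propagates_le H u C))
      <-> quadratic (remove_affine H)].
Proof.
have [th [Th [th0 Th0 Hlo Hhi]]] := uniformly_convex_hform H_cvx.
have C2r : Ck 2 (reflection H) by exact: Ck_reflection.
have hformr p v : hform (reflection H) p v v = hform H (- p) v v.
  by rewrite !hformE hess_reflection.
have Hlor p v : th * dot v v <= hform (reflection H) p v v by rewrite hformr.
have Hhir p v : hform (reflection H) p v v <= Th * dot v v by rewrite hformr.
split.
- move=> prop p xi eta _; apply: (@convex_on_line_cst _ _ (- hform H 0 eta eta)) => l.
  by rewrite (hess_const H_C2 th0 Th0 Hlo Hhi prop d_gt1) hformE.
- move=> prop p xi eta _; apply: (@convex_on_line_cst _ _ (hform H 0 eta eta)) => l.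
  have Hcr : forall q, hess (reflection H) q = hess (reflection H) 0.
    apply: (hess_const C2r th0 Th0 Hlor Hhir _ d_gt1) => C w C0 bw vw lw.
    have -> : w = (fun z => - - w z) by apply/funext => z; rewrite opprK.
    apply/(propagates_reflection _ _ H_C2); apply: prop => //.
    + exact: buc_opp.
    + have -> : (fun q => - H q) = (fun q => - reflection H (- q)).
        by apply/funext => q; rewrite /reflection opprK.
      exact: viscosity_solution_reflection.
    + exact: lipschitz_opp.
  have := Hcr (- (p + l *: xi)); rewrite !(hess_reflection _ H_C2) opprK oppr0 => ->.
  by rewrite hformE.
split=> [[prop _]|/(quadratic_hess_const H_C2) Hc].
  apply: (hess_const_quadratic H_C2 th0 Th0 Hlo Hhi) => p.
  by apply: (hess_const H_C2 th0 Th0 Hlo Hhi _ d_gt1) => C u C0 bu vu _; exact: prop.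
split=> C u C0 bu vu.
  exact: (quadratic_propagates_ge H_C2 th0 Th0 Hlo Hhi Hc).
apply/(propagates_reflection _ _ H_C2).
have Hcr p : hess (reflection H) p = hess (reflection H) 0.
  by rewrite !(hess_reflection _ H_C2) Hc [RHS]Hc.
have vr : viscosity_solution (reflection H) (fun z => - u z).
  have -> : reflection H = (fun p => - (- H (- p))).
    by apply/funext => p; rewrite opprK.
  exact: (viscosity_solution_reflection vu).
exact: (quadratic_propagates_ge C2r th0 Th0 Hlor Hhir Hcr C0 (buc_opp bu) vr).
Qed.
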